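(* Let $d\in\{2,3\}$ and let $m,c,\alpha>0$. Assume that $U\in\mathcal{C}^\infty(\mathbb{R}^d\setminus\{0\})$ (real-valued) and fix $h\in(0,mc^2)$. Let $\tau$ be the minimal period of a circular solution $x_\tau$ of the unperturbed equation $$\frac{\mathrm d}{\mathrm dt}\left(\frac{m\dot x}{\sqrt{1-|\dot x|^2/c^2}}\right)=-\alpha\frac{x}{|x|^3},\qquad x\in\mathbb{R}^d\setminus\{0\},$$ with energy $\mathcal{E}_0(x_\tau)=h$. Then, for each $\eta>0$ there exists $\varepsilon^*>0$ such that for every $\varepsilon\in(-\varepsilon^*,\varepsilon^* )$ the following holds for the fixed-energy problem $$\frac{\mathrm d}{\mathrm dt}\left(\frac{m\dot x}{\sqrt{1-|\dot x|^2/c^2}}\right)=-\alpha\frac{x}{|x|^3}+\varepsilon\,\nabla U(x),\quad x\in\mathbb{R}^d\setminus\{0\},\qquad \mathcal{E}_\varepsilon(x)=h.\qquad( ** )$$ - If $d=2$, there exists a periodic solution $x$ of $( ** )$ with period $\sigma$ such that $|\sigma-\tau|<\eta$ and $$|x(t)-x_\tau(t)|<\eta\quad\text{for every } t\in[0,\tau+\eta].$$ - If $d=3$, there exist a periodic solution $x$ of $( ** )$ with period $\sigma$ and a matrix $M\in SO(3)$ such that $|\sigma-\tau|<\eta$ and $$|x(t)-Mx_\tau(t)|<\eta\quad\text{for every } t\in[0,\tau+\eta].$$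
   Context: The energy is the quantity $$\mathcal{E}_\varepsilon(x)=\frac{mc^2}{\sqrt{1-|\dot x|^2/c^2}}-\frac{\alpha}{|x|}-\varepsilon\,U(x),$$ which is constant along solutions of the equation with parameter $\varepsilon$ (for $\varepsilon=0$ the term with $U$ is absent). A circular solution of the unperturbed equation is a solution $x$ with $|x(t)|\equiv R$ for some constant $R>0$; such solutions are non-constant and periodic, and one with energy $h$ exists for every $h\in(0,mc^2)$. Solutions are understood in the classical sense, with $|\dot x(t)|<c$ and $x(t)\neq0$ for all $t$. ''Period'' is not required to be minimal except where stated. *)

(* Defs.v *)
From HB Require Import structures.
From mathcomp Require Import all_boot all_order all_algebra.
From mathcomp Require Import all_classical all_reals all_analysis.

Set Implicit Arguments.
Unset Strict Implicit.
Unset Printing Implicit Defensive.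

Import Order.TTheory GRing.Theory Num.Theory.
Import numFieldNormedType.Exports.

Local Open Scope classical_set_scope.
Local Open Scope ring_scope.

(* Points of R^d are column vectors. The norm `|x| that the library puts on
   matrices is the sup norm, so the Euclidean norm is defined here; both norms
   induce the same topology, hence the same continuity and derivatives. *)
Definition enorm (R : realType) (d : nat) (x : 'cV[R]_d) : R :=
  Num.sqrt (\sum_(i < d) x i 0 ^+ 2).

Definition basis_vec (R : realType) (d : nat) (i : 'I_d) : 'cV[R]_d :=
  delta_mx i 0.

Definition gradient (R : realType) (d : nat) (U : 'cV[R]_d -> R)
    (x : 'cV[R]_d) : 'cV[R]_d :=
  \col_(i < d) 'D_(basis_vec R i) U x.

(* iter_partial [:: i1; ...; ik] U = d_{i1} (d_{i2} (... (d_{ik} U))). *)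
Definition iter_partial (R : realType) (d : nat) (s : seq 'I_d)
    (U : 'cV[R]_d -> R) : 'cV[R]_d -> R :=
  foldr (fun (i : 'I_d) (f : 'cV[R]_d -> R) => 'D_(basis_vec R i) f) U s.

(* C^oo on D (meant for open D): the partial derivatives of every order exist
   and are continuous at every point of D. Since D is open, they depend only
   on the values of U in D. *)
Definition smooth_on (R : realType) (d : nat) (D : set 'cV[R]_d)
    (U : 'cV[R]_d -> R) : Prop :=
  forall (s : seq 'I_d) (x : 'cV[R]_d), D x ->
    {for x, continuous (iter_partial s U)} /\
    (forall i : 'I_d, derivable (iter_partial s U) x (basis_vec R i)).

Definition lorentz (R : realType) (c : R) (d : nat) (v : 'cV[R]_d) : R :=
  Num.sqrt (1 - enorm v ^+ 2 / c ^+ 2).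

Definition momentum (R : realType) (m c : R) (d : nat) (x : R -> 'cV[R]_d)
    (t : R) : 'cV[R]_d :=
  (m / lorentz c (derive1 x t)) *: derive1 x t.

(* Classical global solutions. For eps = 0 the term with U vanishes and this
   is the unperturbed equation. *)
Definition kepler_solution (R : realType) (d : nat) (m c alpha eps : R)
    (U : 'cV[R]_d -> R) (x : R -> 'cV[R]_d) : Prop :=
  forall t : R,
    [/\ x t != 0,
        derivable x t 1,
        enorm (derive1 x t) < c &
        is_derive t 1 (momentum m c x)
          (- ((alpha / enorm (x t) ^+ 3) *: x t) + eps *: gradient U (x t))].

Definition energy (R : realType) (d : nat) (m c alpha eps : R)
    (U : 'cV[R]_d -> R) (x : R -> 'cV[R]_d) (t : R) : R :=
  m * c ^+ 2 / lorentz c (derive1 x t) - alpha / enorm (x t) - eps * U (x t).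

Definition fixed_energy_solution (R : realType) (d : nat)
    (m c alpha eps h : R) (U : 'cV[R]_d -> R) (x : R -> 'cV[R]_d) : Prop :=
  kepler_solution m c alpha eps U x /\
  (forall t : R, energy m c alpha eps U x t = h).

Definition circular (R : realType) (d : nat) (x : R -> 'cV[R]_d) : Prop :=
  exists2 r : R, 0 < r & forall t : R, enorm (x t) = r.

Definition is_period (R : realType) (d : nat) (x : R -> 'cV[R]_d)
    (sigma : R) : Prop :=
  0 < sigma /\ (forall t : R, x (t + sigma) = x t).

Definition is_minimal_period (R : realType) (d : nat) (x : R -> 'cV[R]_d)
    (tau : R) : Prop :=
  is_period x tau /\ (forall sigma : R, is_period x sigma -> tau <= sigma).

Definition special_orthogonal (R : realType) (d : nat) (M : 'M[R]_d) : Prop :=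
  M^T *m M = 1%:M /\ \det M = 1.

(* Main.v *)
(* In the time s with dt = (W / c^2) ds, where W = h + alpha / |x| + eps U, the
   fixed-energy equation becomes x'' = grad (W^2 / (2 c^2)) with
   |x'|^2 = N^2 := W^2 / c^2 - (m c)^2. Near the circular solution the orbit is
   parametrized by the angle th, x = (cos th, sin th, z) / u, and its linearization
   is v'' + k^2 v for the radial part v = u - u0 and z'' + z for the inclination z.
   The relativistic correction makes k^2 = 1 - (alpha / (c l0))^2 lie in ]0, 1[, so the
   radial part has no 2 pi-periodic kernel. The kernel of the inclination part comes
   from the rotations of the orbital plane. Adding the magnetic force lam x x', with
   lam = (l1, l2, 0), which does no work, and imposing z(0) = z'(0) = 0 makes the
   linear problem invertible, and a fixed point argument gives a 2 pi-periodic orbit.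

   In the plane z = 0 and lam = 0 by symmetry. In space the construction is carried
   out in the rotated potential U(N x) for every N in SO(3), and the action
   (the integral of N |x'|) of the resulting orbit is continuous in N, hence minimal
   somewhere. Under a small rotation of N about the axes 1 and 2 its first variation
   is, up to O(eps |lam|), a multiple of lam, so that lam = 0 at a minimum, and the
   orbit solves the original problem. *)
Require Import Defs.
From HB Require Import structures.
From mathcomp Require Import all_boot all_order all_algebra.
From mathcomp Require Import all_classical all_reals all_analysis.
From mathcomp Require Import ring lra.

Set Implicit Arguments.
Unset Strict Implicit.
Unset Printing Implicit Defensive.

Import Order.TTheory GRing.Theory Num.Theory.
Import numFieldNormedType.Exports.

Local Open Scope classical_set_scope.
Local Open Scope ring_scope.

(** * Real calculus *)

(** The angle fixes the period at 2 pi; the period in time only reappears at the end, when dt/dth is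
    integrated. The fixed point is sought among the forcings of the linearized equations. Their
    remainders [sG1], [sG2] have at the circle a differential that sees only the coordinates
    carrying a factor eps, hence they contract in the other coordinates, and the orbit has size
    O(eps) and depends on the potential in a Lipschitz way. The obstacle in space is that the orbits
    are not shown to be differentiable in the rotation N. Since a minimum is only compared with its
    neighbours, an upper bound of the action at N T, with an error quadratic in the angle of T, does
    the work of a derivative: AM-GM gives it, and the Lipschitz estimate controls the error. Moving
    both ways around each axis yields |lam| <= O(eps) |lam|, hence lam = 0. Both dimensions share
    one construction in R^3: the potential is pulled back by a d x 3 matrix A with A A^T = 1, a
    rotation if d = 3, with third column zero if d = 2; in the latter case the pulled back force has
    no third component and the orbit stays flat. *)

Definition der (R : realType) (f : R -> R) (x l : R) : Prop := is_derive x 1 f l.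

Section RealCalculus.
Variable R : realType.
Implicit Types (f g : R -> R) (x a b : R).

Lemma der_val f x a b : der f x a -> a = b -> der f x b.
Proof. by move=> ? <-. Qed.

Lemma derD f g x a b : der f x a -> der g x b -> der (fun y => f y + g y) x (a + b).
Proof. move=> fa gb; exact: (is_deriveD fa gb). Qed.

Lemma derN f x a : der f x a -> der (fun y => - f y) x (- a).
Proof. move=> fa; exact: (is_deriveN fa). Qed.

Lemma derB f g x a b : der f x a -> der g x b -> der (fun y => f y - g y) x (a - b).
Proof. move=> fa gb; exact: (is_deriveB fa gb). Qed.

Lemma derM f g x a b : der f x a -> der g x b ->
  der (fun y => f y * g y) x (a * g x + f x * b).
Proof.
move=> fa gb; apply: der_val (is_deriveM fa gb) _.
by rewrite addrC; congr (_ + _); rewrite [LHS]mulrC.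
Qed.

Lemma derC a x : der (fun=> a) x 0.
Proof. exact: is_derive_cst. Qed.

Lemma derZ a f x b : der f x b -> der (fun y => a * f y) x (a * b).
Proof. by move=> fb; apply: der_val (derM (derC a x) fb) _; rewrite mul0r add0r. Qed.

Lemma der_id x : der (fun y : R => y) x 1.
Proof. exact: is_derive_id. Qed.

Lemma derV f x a : f x != 0 -> der f x a -> der (fun y => (f y)^-1) x (- a / f x ^+ 2).
Proof.
move=> f0 fa; apply: der_val (is_deriveV f0 fa) _.
by rewrite [LHS]mulrC mulNr mulrN.
Qed.

Lemma der_comp f g x a b : der f (g x) a -> der g x b -> der (fun y => f (g y)) x (a * b).
Proof. by move=> fa gb; exact: (is_derive1_comp fa gb). Qed.

Lemma der_sqrt f x a : 0 < f x -> der f x a ->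
  der (fun y => Num.sqrt (f y)) x (a / (2 * Num.sqrt (f x))).
Proof.
by move=> f0 fa; apply: der_val (der_comp (is_derive1_sqrt f0) fa) _; rewrite mulrC.
Qed.

Lemma der_cos a x : der (fun y => cos (a * y)) x (- a * sin (a * x)).
Proof.
apply: der_val (der_comp (is_derive_cos _) (derZ a (der_id x))) _.
by rewrite mulr1 mulrC mulrN mulNr.
Qed.

Lemma der_sin a x : der (fun y => sin (a * y)) x (a * cos (a * x)).
Proof.
apply: der_val (der_comp (is_derive_sin _) (derZ a (der_id x))) _.
by rewrite mulr1 mulrC.
Qed.

Lemma der_shift f x a b : der f (x + a) b -> der (fun y => f (y + a)) x b.
Proof.
move=> fb; apply: der_val (@der_comp f (fun y => y + a) x b _ fb (derD (der_id x) (derC a x))) _.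
by rewrite addr0 mulr1.
Qed.

Lemma der_continuous f : (forall x, exists a, der f x a) -> continuous f.
Proof.
move=> df x; have [a fa] := df x.
by case: fa => fa _; exact/differentiable_continuous/derivable1_diffP.
Qed.

Lemma der_cst f : (forall x, der f x 0) -> forall x y, f x = f y.
Proof. by move=> f0 x y; exact: is_derive_0_is_cst f0. Qed.

Lemma mean_value f (df : R -> R) a b : a <= b -> (forall x, der f x (df x)) ->
  exists2 x, a <= x <= b & f b - f a = df x * (b - a).
Proof.
move=> ab dfx; have [|c] := @MVT_segment R f df a b ab (fun x _ => dfx x).
  by apply: continuous_subspaceT; apply: der_continuous => x; exists (df x).
by rewrite in_itv /= => cab ->; exists c.
Qed.

Lemma der_bound f (df : R -> R) a b k : a <= b -> (forall x, der f x (df x)) ->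
  (forall x, a <= x <= b -> `|df x| <= k) -> `|f b - f a| <= k * (b - a).
Proof.
move=> ab dfx dfk; have [c cab ->] := mean_value ab dfx.
by rewrite normrM (ger0_norm (_ : 0 <= b - a)) ?subr_ge0// ler_wpM2r ?subr_ge0// dfk.
Qed.

Lemma der_le f (df : R -> R) a b k : a <= b -> (forall x, der f x (df x)) ->
  (forall x, a <= x <= b -> df x <= k) -> f b - f a <= k * (b - a).
Proof.
move=> ab dfx dfk; have [c cab ->] := mean_value ab dfx.
by rewrite ler_wpM2r ?subr_ge0// dfk.
Qed.

Lemma primitive_right f (a : R) : continuous f ->
  exists F : R -> R, forall x, a < x -> der F x (f x).
Proof.
move=> cf; exists (fun x => (\int[lebesgue_measure]_(t in `[a, x]) f t)%R) => x ax.
have xu : x < x + 1 by rewrite ltrDl.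
have intf : (@lebesgue_measure R).-integrable `[a, x + 1] (EFin \o f).
  apply: continuous_compact_integrable; first exact: segment_compact.
  exact: continuous_subspaceT.
have [H1 H2] := continuous_FTC1_closed xu intf ax (cf x).
exact: (DeriveDef H1 (etrans (esym (derive1E _ _)) H2)).
Qed.

Lemma der_cst_on f a : (forall x, a < x -> der f x 0) -> forall x y, a < x -> a < y -> f x = f y.
Proof.
move=> f0 x y ax ay; wlog xy : x y ax ay / x <= y => [H|].
  by have [?|/ltW ?] := leP x y; [apply: H|symmetry; apply: H].
have [||c _ /eqP] := @MVT_segment R f (fun=> 0) x y xy.
- by move=> z; rewrite in_itv /= => /andP[xz _]; apply: f0; apply: lt_trans xz.
- apply: derivable_within_continuous => z; rewrite in_itv /= => /andP[xz _].
  by have [] := f0 _ (lt_le_trans ax xz).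
- by rewrite mul0r subr_eq0 => /eqP ->.
Qed.

(* The library integrates from a finite left end; primitives on the half lines
   ]-n, +oo[, normalized at 0, are glued. *)
Lemma primitive_ex f : continuous f ->
  exists F : R -> R, F 0 = 0 /\ forall x, der F x (f x).
Proof.
move=> cf.
have /choice[G HG] : forall n : nat, exists G : R -> R,
    G 0 = 0 /\ forall x, - n.+1%:R < x -> der G x (f x).
  move=> n; have [G HG] := primitive_right (- n.+1%:R) cf.
  exists (fun x => G x - G 0); split => [|x xn]; first by rewrite subrr.
  by apply: der_val (derB (HG x xn) (derC _ x)) _; rewrite subr0.
have Gnm n m x : - n.+1%:R < x -> - m.+1%:R < x -> G n x = G m x.
  wlog nm : n m / (n <= m)%N => [H|].
    by case/orP: (leq_total n m) => /H; [apply|move=> {}H ? ?; symmetry; apply: H].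
  move=> xn xm.
  have := @der_cst_on (fun y => G n y - G m y) (- n.+1%:R) _ x 0 xn.
  rewrite (HG n).1 (HG m).1 subrr => /(_ _ _)/eqP; rewrite subr_eq0 => E; apply/eqP/E.
    move=> y yn; apply: der_val (derB ((HG n).2 y yn) ((HG m).2 y _)) _.
      by apply: le_lt_trans yn; rewrite lerN2 ler_nat.
    by rewrite subrr.
  by rewrite oppr_lt0 ltr0n.
pose N x := Num.truncn `|x|.
have NP x : - (N x).+1%:R < x.
  rewrite ltrNl (le_lt_trans (ler_norm _))// normrN.
  exact: truncnS_gt.
exists (fun x => G (N x) x); split => [|x]; first exact: (HG _).1.
(* The index [N y] may jump near [x], so the derivative is taken for a fixed index, whose primitive
   agrees by [Gnm] with the glued function at every nearby [y]. *)
have xN : - (N x).+1.+1%:R < x.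
  by apply: le_lt_trans (NP x); rewrite lerN2 ler_nat.
have Ge := (HG (N x).+1).2 x xN.
have nE : {near x, G (N x).+1 =1 (fun y => G (N y) y)}.
  near=> y; apply: Gnm; last exact: NP.
  by rewrite ltrNl; near: y; apply: Nlt_nbhsl; rewrite ltrNl.
have [Gd Gv] := Ge; split; first exact: near_eq_derivable nE Gd.
by rewrite -(near_eq_derive _ nE).
Unshelve. all: by end_near. Qed.

End RealCalculus.

(** * Contractions *)

Section FixedPoint.
Variable R : realType.

(** As 2^n exceeds n, C / 2^n drops below any positive [x]. The limits of the geometric error bounds
    below are taken with this lemma. *)
Lemma le_geometric (x C : R) : (forall n, x <= C / 2 ^+ n) -> x <= 0.
Proof.
move=> H; rewrite leNgt; apply/negP => x0.
have C0 : 0 < C by rewrite (lt_le_trans x0)//; have := H 0%N; rewrite expr0 divr1.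
have [n] : exists n : nat, C / x < n%:R.
  by exists (Num.truncn (C / x)).+1; exact: truncnS_gt.
rewrite ltr_pdivrMr// => Cn; have := H n.
rewrite ler_pdivlMr ?exprn_gt0// leNgt => /negP; apply.
rewrite (lt_le_trans Cn)// mulrC ler_wpM2l ?(ltW x0)//.
by rewrite -natrX ler_nat ltnW// ltn_expl.
Qed.

Lemma geometric_limit (s : nat -> R) r :
  (forall n m, (n <= m)%N -> `|s m - s n| <= r / 2 ^+ n) ->
  exists y, forall n, `|s n - y| <= r / 2 ^+ n.
Proof.
(* The limit is the supremum of the lower bounds [s n - r / 2 ^+ n], each of which is below every
   [s m + r / 2 ^+ m]; the rate of convergence comes with it. *)
move=> H; pose A := range (fun n => s n - r / 2 ^+ n).
have ub n : ubound A (s n + r / 2 ^+ n).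
  move=> _ [m _ <-]; case/orP: (leq_total n m) => /[dup] nm /H /ler_normlP[H1 H2].
    have : 0 <= r / 2 ^+ m by apply: le_trans (H m m (leqnn _)).
    by move=> ?; lra.
  have : 0 <= r / 2 ^+ n by apply: le_trans (H n n (leqnn _)).
  by move=> ?; lra.
have A0 : A !=set0 by exists (s 0%N - r / 2 ^+ 0); exists 0%N.
exists (sup A) => n; apply/ler_normlP; split.
  by rewrite opprB lerBlDl; apply: ge_sup.
rewrite lerBlDl -lerBlDr; apply: ub_le_sup; last by exists n.
by exists (s 0%N + r / 2 ^+ 0).
Qed.

(** Contraction principle for the sup distance, stated by pointwise bounds. A first displacement of
    at most r / 2 and the factor 1 / 2 keep all iterates in the ball of radius [r]. [P] stands for
    the qualitative properties (continuity, periodicity) that survive uniform limits. *)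
Lemma fixed_point (I : Type) (P : (I -> R) -> Prop) (T : (I -> R) -> I -> R) r :
  0 <= r ->
  (forall Y : I -> R, (forall e, 0 < e ->
     exists2 Z, P Z & forall i, `|Z i - Y i| <= e) -> P Y) ->
  P (fun=> 0) ->
  (forall Y, P Y -> (forall i, `|Y i| <= r) -> P (T Y)) ->
  (forall i, `|T (fun=> 0) i| <= r / 2) ->
  (forall Y Z k, P Y -> P Z -> (forall i, `|Y i| <= r) -> (forall i, `|Z i| <= r) ->
     (forall i, `|Y i - Z i| <= k) -> forall i, `|T Y i - T Z i| <= k / 2) ->
  exists Y, [/\ P Y, forall i, `|Y i| <= r & forall i, T Y i = Y i].
Proof.
move=> r0 Pclosed P0 PT T0 Tk.
pose s n := iter n T (fun=> 0).
have sP n : P (s n) /\ forall i, `|s n i| <= r.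
  elim: n => [|n [Pn bn]]; first by split=> // i; rewrite normr0.
  split=> [|i]; first exact: PT.
  rewrite /s iterS -/(s n).
  rewrite -(subrK (T (fun=> 0) i) (T (s n) i)) (le_trans (ler_normD _ _))//.
  by rewrite [leRHS](splitr r) lerD//; apply: Tk => // j; rewrite ?normr0 ?subr0.
have step n i : `|s n.+1 i - s n i| <= r / 2 ^+ n.+1.
  elim: n i => [|n IHn] i; first by rewrite /= subr0 expr1.
  rewrite /s !iterS -/(s n) -/(s n.+1).
  have -> : r / 2 ^+ n.+2 = r / 2 ^+ n.+1 / 2.
    by rewrite -mulrA -invfM -exprSr.
  by apply: Tk => //; [exact: (sP n.+1).1|exact: (sP n).1|exact: (sP n.+1).2|exact: (sP n).2].
(* The subtracted term is what makes the telescoping induction close. *)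
have far n k i : `|s (n + k)%N i - s n i| <= r / 2 ^+ n - r / 2 ^+ (n + k).
  elim: k => [|k IHk]; first by rewrite addn0 !subrr normr0.
  rewrite addnS -(subrK (s (n + k)%N i) (s (n + k).+1 i)) -addrA.
  rewrite (le_trans (ler_normD _ _))//.
  have := lerD (step (n + k)%N i) IHk => /le_trans; apply.
  have -> : r / 2 ^+ (n + k) = 2 * (r / 2 ^+ (n + k).+1).
    rewrite exprS invfM mulrCA mulVKf//.
  by lra.
have /choice[Y HY] : forall i, exists y, forall n, `|s n i - y| <= r / 2 ^+ n.
  move=> i; apply: geometric_limit => n m nm; rewrite -(subnKC nm).
  rewrite (le_trans (far _ _ _))// gerBl divr_ge0// exprn_ge0//.
have half e : 0 < e -> exists n, r / 2 ^+ n <= e.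
  move=> e0; apply: contrapT => /forallNP H.
  suff : r + e <= r by rewrite gerDl leNgt e0.
  rewrite leNgt; apply/negP => _.
  have : e <= 0 by apply: (@le_geometric _ r) => n; apply/ltW; rewrite ltNge; exact/negP/H.
  by rewrite leNgt e0.
have Yr i : `|Y i| <= r.
  apply/ler_addgt0Pr => e /half[n ne].
  rewrite -(subrK (s n i) (Y i)) (le_trans (ler_normD _ _))// addrC lerD ?(sP n).2//.
  by rewrite distrC (le_trans (HY i n)).
have PY : P Y.
  apply: Pclosed => e /half[n ne]; exists (s n); first exact: (sP n).1.
  by move=> i; rewrite (le_trans (HY i n)).
exists Y; split=> // i; apply/eqP; rewrite -subr_eq0 -normr_le0.
apply: (@le_geometric _ (2 * r)) => n.
rewrite -(subrK (s n.+1 i) (T Y i)) -addrA (le_trans (ler_normD _ _))//.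
have H1 : `|T Y i - s n.+1 i| <= r / 2 ^+ n / 2.
  rewrite /s iterS -/(s n); apply: Tk => //; [exact: (sP n).1|exact: (sP n).2|].
  by move=> j; rewrite distrC.
have := lerD H1 (HY i n.+1) => /le_trans; apply.
rewrite exprS invfM; set a := _^-1.
have : 0 <= r * a by rewrite mulr_ge0// invr_ge0 exprn_ge0.
by move=> ?; lra.
Qed.

(** Starting from any bound [B], n improvements give B / 2^n + 2 e. Some a priori bound has to be
    known, but its size does not matter. *)
Lemma self_bound (I : Type) (D : I -> R) B e : 0 <= e ->
  (forall i, `|D i| <= B) ->
  (forall k, (forall i, `|D i| <= k) -> forall i, `|D i| <= k / 2 + e) ->
  forall i, `|D i| <= 2 * e.
Proof.
move=> e0 DB H i; rewrite -subr_le0; apply: (@le_geometric _ B) => n.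
rewrite lerBlDr; elim: n i => [|n IHn] i.
  by rewrite expr0 divr1 (le_trans (DB i))// lerDl mulr_ge0.
have := H _ IHn i => /le_trans; apply.
by rewrite exprS invfM; set a := _^-1; lra.
Qed.

End FixedPoint.

(** * Strict differentials at a point, for functions of finitely many variables *)

Section StrictDifferential.
Variable R : realType.

Definition ball0 (r : R) (X : nat -> R) := forall i, `|X i| <= r.
Definition close (k : R) (X Y : nat -> R) := forall i, `|X i - Y i| <= k.

Lemma close_ge0 k X Y : close k X Y -> 0 <= k.
Proof. by move=> /(_ 0%N); apply: le_trans. Qed.

Lemma ball0W r s X : r <= s -> ball0 r X -> ball0 s X.
Proof. by move=> rs Xr i; rewrite (le_trans (Xr i)). Qed.

(* Strict differentiability at the origin, with value [v] and differential
   [L], for functions of finitely many real variables stored in a sequence. *)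
Definition sdiff (f : (nat -> R) -> R) (v : R) (L : (nat -> R) -> R) :=
  [/\ f (fun=> 0) = v,
      exists2 C : R, 0 <= C & forall X Y (k : R), close k X Y -> `|L X - L Y| <= C * k &
      forall d : R, 0 < d -> exists2 r : R, 0 < r & forall X Y (k : R), ball0 r X -> ball0 r Y ->
        close k X Y -> `|f X - f Y - (L X - L Y)| <= d * k].

Lemma sdiff_lip f v L : sdiff f v L ->
  exists C r : R, [/\ 0 <= C, 0 < r & forall X Y (k : R), ball0 r X -> ball0 r Y ->
    close k X Y -> `|f X - f Y| <= C * k].
Proof.
move=> [_ [C C0 LC] /(_ 1 ltr01)[r r0 H]]; exists (C + 1), r; split=> //.
  by rewrite addr_ge0.
move=> X Y k Xr Yr XY; rewrite -(subrK (L X - L Y) (f X - f Y)).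
by rewrite (le_trans (ler_normD _ _))// addrC mulrDl lerD ?LC ?H.
Qed.

Lemma sdiff_cst a : sdiff (fun=> a) a (fun=> 0).
Proof.
split=> //; first by exists 0 => // X Y k _; rewrite subrr normr0 mul0r.
move=> d d0; exists 1 => // X Y k _ _ /close_ge0 k0.
by rewrite !subrr normr0 mulr_ge0// ltW.
Qed.

Lemma sdiff_var i : sdiff (fun X => X i) 0 (fun X => X i).
Proof.
split=> //; first by exists 1 => // X Y k /(_ i); rewrite mul1r.
move=> d d0; exists 1 => // X Y k _ _ /close_ge0 k0.
by rewrite !subrr normr0 mulr_ge0// ltW.
Qed.

Lemma sdiffD f g v w L M : sdiff f v L -> sdiff g w M ->
  sdiff (fun X => f X + g X) (v + w) (fun X => L X + M X).
Proof.
move=> [fv [C C0 LC] Hf] [gw [D D0 MD] Hg]; split; first by rewrite fv gw.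
  exists (C + D); first exact: addr_ge0.
  move=> X Y k XY; rewrite opprD addrACA mulrDl (le_trans (ler_normD _ _))//.
  by rewrite lerD ?LC ?MD.
move=> d d0; have [|r r0 {}Hf] := Hf (d / 2); first by rewrite divr_gt0.
have [|s s0 {}Hg] := Hg (d / 2); first by rewrite divr_gt0.
exists (Num.min r s); first by rewrite lt_min r0.
move=> X Y k Xr Yr XY; rewrite [d]splitr mulrDl.
have -> : f X + g X - (f Y + g Y) - (L X + M X - (L Y + M Y)) =
  (f X - f Y - (L X - L Y)) + (g X - g Y - (M X - M Y)) by ring.
have rm : Num.min r s <= r by rewrite ge_min lexx.
have sm : Num.min r s <= s by rewrite ge_min lexx orbT.
rewrite (le_trans (ler_normD _ _))// lerD//.
  by apply: Hf => //; [exact: ball0W Xr|exact: ball0W Yr].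
by apply: Hg => //; [exact: ball0W Xr|exact: ball0W Yr].
Qed.

Lemma sdiff_near f v L e : sdiff f v L -> 0 < e ->
  exists2 r, 0 < r & forall X, ball0 r X -> `|f X - v| <= e.
Proof.
move=> fv e0; have [C [r [C0 r0 H]]] := sdiff_lip fv.
have C1 : 0 < C + 1 by rewrite ltr_wpDl.
exists (Num.min r (e / (C + 1))); first by rewrite lt_min r0 divr_gt0.
have rm : Num.min r (e / (C + 1)) <= r by rewrite ge_min lexx.
move=> X Xr; case: (fv) => <- _ _.
have := H X (fun=> 0) (Num.min r (e / (C + 1))) (ball0W rm Xr).
have b0 : ball0 r (fun=> 0) by move=> i; rewrite normr0 ltW.
move=> /(_ b0) H1; apply: (le_trans (H1 _)); first by move=> i; rewrite subr0.
rewrite (@le_trans _ _ (C * (e / (C + 1))))//.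
  by rewrite ler_wpM2l// ge_min lexx orbT.
rewrite mulrCA ger_pMr// ler_pdivrMr// mul1r lerDl//.
Qed.

(* With [A = f X - f Y] and so on, the remainder of the product is
   [A' g X + f Y B' + (g X - w) (L X - L Y) + (f Y - v) (M X - M Y)],
   where [A'], [B'] are the remainders of the factors. *)
Lemma sdiffM f g v w L M : sdiff f v L -> sdiff g w M ->
  sdiff (fun X => f X * g X) (v * w) (fun X => L X * w + v * M X).
Proof.
move=> sf sg; case: (sf) => fv [C C0 LC] Hf; case: (sg) => gw [D D0 MD] Hg.
split; first by rewrite fv gw.
  exists (C * `|w| + `|v| * D); first by rewrite addr_ge0// mulr_ge0.
  move=> X Y k XY; rewrite opprD addrACA -mulrBl -mulrBr [leRHS]mulrDl.
  rewrite (le_trans (ler_normD _ _))// !normrM lerD//.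
    by rewrite mulrAC ler_wpM2r ?LC.
  by rewrite -mulrA ler_wpM2l ?MD.
move=> d d0.
pose K := `|v| + `|w| + C + D + 1.
have vK : 0 <= `|v| by []. have wK : 0 <= `|w| by [].
have K0 : 0 < K by rewrite /K; lra.
pose e := Num.min 1 (d / (4 * K)).
have e0 : 0 < e by rewrite lt_min ltr01 divr_gt0// mulr_gt0.
have e1 : e <= 1 by rewrite ge_min lexx.
have eK : 4 * (K * e) <= d.
  by rewrite mulrA -ler_pdivlMl ?mulr_gt0// mulrC ge_min lexx orbT.
have [r1 r10 {}Hf] := Hf e e0; have [r2 r20 {}Hg] := Hg e e0.
have [r3 r30 nf] := sdiff_near sf e0; have [r4 r40 ng] := sdiff_near sg e0.
exists (Num.min (Num.min r1 r2) (Num.min r3 r4)); first by rewrite !lt_min r10 r20 r30.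
move=> X Y k Xr Yr XY; have k0 := close_ge0 XY.
have H Z : ball0 (Num.min (Num.min r1 r2) (Num.min r3 r4)) Z ->
    [/\ ball0 r1 Z, ball0 r2 Z, ball0 r3 Z & ball0 r4 Z].
  by move=> HZ; split; apply: ball0W HZ; rewrite !ge_min lexx ?orbT.
have [X1 X2 X3 X4] := H _ Xr; have [Y1 Y2 Y3 Y4] := H _ Yr.
have -> : f X * g X - f Y * g Y - (L X * w + v * M X - (L Y * w + v * M Y)) =
  (f X - f Y - (L X - L Y)) * g X + f Y * (g X - g Y - (M X - M Y))
  + (g X - w) * (L X - L Y) + (f Y - v) * (M X - M Y) by ring.
have gb : `|g X| <= K.
  rewrite -(subrK w (g X)) (le_trans (ler_normD _ _))//.
  by have := ng _ X4; rewrite /K; lra.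
have fb : `|f Y| <= K.
  rewrite -(subrK v (f Y)) (le_trans (ler_normD _ _))//.
  by have := nf _ Y3; rewrite /K; lra.
have T1 : `|(f X - f Y - (L X - L Y)) * g X| <= (e * k) * K.
  by rewrite normrM ler_pM// Hf.
have T2 : `|f Y * (g X - g Y - (M X - M Y))| <= K * (e * k).
  by rewrite normrM ler_pM// Hg.
have T3 : `|(g X - w) * (L X - L Y)| <= e * (K * k).
  rewrite normrM ler_pM ?ng// (le_trans (LC _ _ _ XY))// ler_wpM2r// /K; lra.
have T4 : `|(f Y - v) * (M X - M Y)| <= e * (K * k).
  rewrite normrM ler_pM ?nf// (le_trans (MD _ _ _ XY))// ler_wpM2r// /K; lra.
have : 4 * (K * e) * k <= d * k by rewrite ler_wpM2r.
apply: le_trans.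
rewrite (le_trans (ler_normD _ _))//.
rewrite (le_trans (lerD (ler_normD _ _) (lexx _)))//.
rewrite (le_trans (lerD (lerD (ler_normD _ _) (lexx _)) (lexx _)))//.
have -> : 4 * (K * e) * k = (e * k * K) + K * (e * k) + e * (K * k) + e * (K * k) by ring.
by rewrite !lerD.
Qed.

Definition sdiff1 (phi : R -> R) (a b d : R) :=
  phi a = b /\ forall e, 0 < e -> exists2 r, 0 < r & forall x y,
    `|x - a| <= r -> `|y - a| <= r -> `|phi x - phi y - d * (x - y)| <= e * `|x - y|.

Lemma sdiff_comp phi f v w d L : sdiff f v L -> sdiff1 phi v w d ->
  sdiff (fun X => phi (f X)) w (fun X => d * L X).
Proof.
move=> sf [pv Hp]; case: (sf) => fv [C C0 LC] Hf.
split; first by rewrite fv.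
  exists (`|d| * C); first by rewrite mulr_ge0.
  by move=> X Y k XY; rewrite -mulrBr normrM -mulrA ler_wpM2l ?LC.
have [C' [r' [C'0 r'0 fl]]] := sdiff_lip sf.
move=> e e0.
pose K := C' + `|d| + 1.
have dK : 0 <= `|d| by [].
have K0 : 0 < K by rewrite /K; lra.
pose e' := e / (2 * K).
have e'0 : 0 < e' by rewrite divr_gt0// mulr_gt0.
have [r1 r10 {}Hp] := Hp e' e'0.
have [r2 r20 nf] := sdiff_near sf r10.
have [r3 r30 {}Hf] := Hf e' e'0.
exists (Num.min (Num.min r' r2) r3); first by rewrite !lt_min r'0 r20.
move=> X Y k Xr Yr XY; have k0 := close_ge0 XY.
have H Z : ball0 (Num.min (Num.min r' r2) r3) Z -> [/\ ball0 r' Z, ball0 r2 Z & ball0 r3 Z].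
  by move=> HZ; split; apply: ball0W HZ; rewrite !ge_min lexx ?orbT.
have [X1 X2 X3] := H _ Xr; have [Y1 Y2 Y3] := H _ Yr.
have -> : phi (f X) - phi (f Y) - (d * L X - d * L Y) =
  (phi (f X) - phi (f Y) - d * (f X - f Y)) + d * (f X - f Y - (L X - L Y)) by ring.
rewrite (le_trans (ler_normD _ _))//.
have T1 : `|phi (f X) - phi (f Y) - d * (f X - f Y)| <= e' * (K * k).
  rewrite (le_trans (Hp _ _ (nf _ X2) (nf _ Y2)))// ler_wpM2l ?(ltW e'0)//.
  rewrite (le_trans (fl _ _ _ X1 Y1 XY))// ler_wpM2r// /K; lra.
have T2 : `|d * (f X - f Y - (L X - L Y))| <= K * (e' * k).
  by rewrite normrM ler_pM ?Hf// /K; lra.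
have -> : e * k = e' * (K * k) + K * (e' * k).
  by rewrite /e'; field; rewrite gt_eqF.
by rewrite lerD.
Qed.

Lemma sdiff1_inv a b d : a != 0 -> b = a^-1 -> d = - b ^+ 2 -> sdiff1 GRing.inv a b d.
Proof.
move=> a0 -> ->; split=> // e e0.
have A0 : 0 < `|a| by rewrite normr_gt0.
(* The first bound keeps [x] and [y] at distance |a| / 2 from 0, the second absorbs the cubic
   denominator of the remainder computed below. *)
pose r := Num.min (`|a| / 2) (e * `|a| ^+ 3 / 8).
have r0 : 0 < r by rewrite lt_min !divr_gt0 ?mulr_gt0 ?exprn_gt0.
exists r => // x y xr yr.
have r1 : r <= `|a| / 2 by rewrite ge_min lexx.
have r2 : r <= e * `|a| ^+ 3 / 8 by rewrite ge_min lexx orbT.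
have big z : `|z - a| <= r -> `|a| / 2 <= `|z|.
  move=> zr; have := ler_normB z (z - a); rewrite opprB addrC subrK.
  by lra.
have x2 := big _ xr; have y2 := big _ yr.
have x0 : x != 0 by rewrite -normr_gt0; lra.
have y0 : y != 0 by rewrite -normr_gt0; lra.
have -> : x^-1 - y^-1 - - a^-1 ^+ 2 * (x - y) =
   (x - y) * ((x * (y - a) + a * (x - a)) / (a * a * (x * y))).
  by field; rewrite x0 y0.
rewrite normrM mulrC ler_wpM2r//.
rewrite normrM normfV ler_pdivrMr ?normr_gt0 ?mulf_neq0// [in leRHS]normrM.
rewrite ![in leRHS]normrM.
rewrite (le_trans (ler_normD _ _))// !normrM.
set p := `|x| in x2 *; set q := `|y| in y2 *; set A := `|a| in A0 r1 r2 x2 y2 *.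
have q1 : A <= 2 * q by lra.
have p0 : 0 < p by lra.
have H1 : p * `|y - a| <= p * r by rewrite ler_wpM2l// ltW.
have H2 : A * `|x - a| <= 2 * p * r.
  rewrite ler_pM//; [exact: ltW|lra].
have H3 : p * r <= p * (e * A ^+ 3 / 8) by rewrite ler_wpM2l// ltW.
have H4 : p * (e * A ^+ 3) <= p * (e * (A ^+ 2 * (2 * q))).
  rewrite exprSr ler_wpM2l ?(ltW p0)// ler_wpM2l ?(ltW e0)//.
  by rewrite ler_wpM2l// exprn_ge0// ltW.
have -> : e * (A * A * (p * q)) = p * (e * (A ^+ 2 * (2 * q))) / 2 by field.
have : 0 <= p * (e * A ^+ 3).
  by rewrite !mulr_ge0 ?exprn_ge0// ltW.
by lra.
Qed.

(** In terms of the roots p, q of the two arguments the remainder is (p - q)(2 b - p - q) / (2 b),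
    small as soon as p and q are close to b. *)
Lemma sdiff1_sqrt a b d : 0 < b -> a = b ^+ 2 -> d = (2 * b)^-1 -> sdiff1 Num.sqrt a b d.
Proof.
move=> b0 -> ->; split; first by rewrite sqrtr_sqr gtr0_norm.
move=> e e0.
pose r := Num.min (b ^+ 2 / 2) (e * b ^+ 3).
have r0 : 0 < r by rewrite lt_min divr_gt0 ?mulr_gt0 ?exprn_gt0.
exists r => // x y xr yr.
have r1 : r <= b ^+ 2 / 2 by rewrite ge_min lexx.
have r2 : r <= e * b ^+ 3 by rewrite ge_min lexx orbT.
have near_b z : `|z - b ^+ 2| <= r -> [/\ 0 <= Num.sqrt z, Num.sqrt z ^+ 2 = z &
    `|Num.sqrt z - b| * b <= r].
  move=> zr; have z0 : 0 <= z by have := exprn_gt0 2 b0; have /ler_normlP[] := zr; lra.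
  split; rewrite ?sqrtr_ge0 ?sqr_sqrtr//.
  apply: le_trans zr; rewrite -[in leRHS](sqr_sqrtr z0) subr_sqr normrM.
  rewrite ler_wpM2l// (le_trans _ (ler_norm _))// lerDr sqrtr_ge0//.
have [sx0 sx xb] := near_b _ xr; have [sy0 sy yb] := near_b _ yr.
set p := Num.sqrt x in sx0 sx xb *; set q := Num.sqrt y in sy0 sy yb *.
rewrite -sx -sy.
have -> : p - q - (2 * b)^-1 * (p ^+ 2 - q ^+ 2) =
   (p - q) * ((b - p) + (b - q)) / (2 * b) by field; rewrite gt_eqF.
have pb : `|p - b| <= b / 2.
  by rewrite -(ler_pM2r b0) (le_trans xb)// (le_trans r1)// mulrAC.
have qb : `|q - b| <= b / 2.
  by rewrite -(ler_pM2r b0) (le_trans yb)// (le_trans r1)// mulrAC.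
have pq : b <= p + q by move/ler_normlP: pb => []; move/ler_normlP: qb => []; lra.
rewrite subr_sqr !normrM normfV (gtr0_norm (_ : 0 < 2 * b)) ?mulr_gt0//.
rewrite (ger0_norm (_ : 0 <= p + q)) ?addr_ge0// ler_pdivrMr ?mulr_gt0//.
have -> : e * (`|p - q| * (p + q)) * (2 * b) = `|p - q| * (e * (p + q) * (2 * b)) by ring.
apply: ler_wpM2l => //.
rewrite -(ler_pM2r b0) (le_trans (ler_wpM2r (ltW b0) (ler_normD _ _)))//.
rewrite mulrDl ![`|b - _|]distrC (@le_trans _ _ (2 * (e * b ^+ 3)))//; first by lra.
have -> : 2 * (e * b ^+ 3) = e * b * (2 * b) * b by ring.
by rewrite ler_pM2r// ler_pM2r ?mulr_gt0// ler_pM2l.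
Qed.

End StrictDifferential.

(** * The equation of the orbit *)

(* The circular orbit of radius 1/u0 and angular momentum l0 in the field al/|x|,
   with energy h; the small radial oscillations have frequency k per unit angle. *)
Record base (R : realType) := Base {
  bm : R; bc : R; bal : R; bh : R; bu : R; bl : R; bk : R;
  bm_gt0 : 0 < bm; bc_gt0 : 0 < bc; bal_gt0 : 0 < bal; bu_gt0 : 0 < bu; bl_gt0 : 0 < bl;
  bW_gt0 : 0 < bh + bal * bu;
  b_energy : (bl * bu) ^+ 2 =
    (bh + bal * bu) * (bh + bal * bu) / bc ^+ 2 - (bm * bc) ^+ 2;
  b_force : bal * (bh + bal * bu) = bc ^+ 2 * bl ^+ 2 * bu;
  bk_itv : 0 < bk < 1;
  bkE : bk ^+ 2 = 1 - (bal / (bc * bl)) ^+ 2 }.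

Section OrbitFunctions.
Variables (R : realType) (b : base R).
Local Notation m := (bm b).
Local Notation c := (bc b).
Local Notation al := (bal b).
Local Notation h := (bh b).
Local Notation u0 := (bu b).
Local Notation l0 := (bl b).
Local Notation k2 := (bk b ^+ 2).
(** Coefficient of the radial multiplier in the linearized equation of [z]: the factor [l0 * u0] in
    [sFz] over the denominator [l0 ^+ 2 * u0 ^+ 3]. *)
Definition bk0 := (l0 * u0 ^+ 2)^-1.

(* A state is stored as X = (u - u0, u', z, z', lr, lt, e0, er, et, ez), where
   the orbit is x = (cos th, sin th, z) / u, (lr, lt) are the radial and
   tangential components of the multiplier, and (e0, er, et, ez) are the values
   of eps U and of the components of eps grad U in the frame (e_r, e_th, e_3). *)
Definition sU (X : nat -> R) := u0 + X 0%N.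
(** As |x| = sqrt(1 + z^2) / u, the inverse distance to the origin is [sU X * sS X]. *)
Definition sS (X : nat -> R) := (Num.sqrt (1 + X 2 * X 2))^-1.
Definition sW X := h + al * (sU X * sS X) + X 6.
(** [sZ] is u^2 (z / u)' and [sQ] is u^4 |dx/dth|^2. With [sN] the squared norm of the momentum p,
    this gives p = [sL] u^2 dx/dth, so that [sL] is the angular momentum of a planar orbit. *)
Definition sZ X := X 3 * sU X - X 2 * X 1%N.
Definition sQ X := X 1%N * X 1%N + sU X * sU X + sZ X * sZ X.
Definition sN X := sW X * sW X / c ^+ 2 - (m * c) ^+ 2.
Definition sL2 X := sN X / sQ X.
Definition sL X := Num.sqrt (sL2 X).
(** Forces are taken in the parameter s, whence the factor dt/ds = [sW X / c ^+ 2]. [sC] is the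
    component of the attraction along e_r; since x is proportional to e_r + z e_3, its vertical
    component is z [sC]. *)
Definition sC X := - (sW X / c ^+ 2) * (al * (sU X * sU X * (sS X * sS X * sS X))).
Definition sFr X := sC X + sW X / c ^+ 2 * X 7 + sL X * (X 5 * sZ X).
Definition sFt X := sW X / c ^+ 2 * X 8 - sL X * (X 4 * sZ X).
Definition sFz X := X 2 * sC X + sW X / c ^+ 2 * X 9 + sL X * (X 4 * sU X + X 5 * X 1%N).
(** The logarithmic derivative of [sL] along an orbit, as [der_L] shows. *)
Definition sPhi X := sFt X / (sL2 X * (sU X * sU X * sU X)).
(** What remains when the orbit equations are written v'' = - k^2 v + [sG1] and z'' = - z + [bk0] lr
    + [sG2], with lr the radial multiplier. *)
Definition sG1 X :=
  - (sFr X / (sL2 X * (sU X * sU X))) - sPhi X * X 1%N - sU X + k2 * X 0%N.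
Definition sG2 X :=
  (sFz X - X 2 * sFr X) / (sL2 X * (sU X * sU X * sU X)) - sPhi X * X 3 - bk0 * X 4.
(* dt/dth, the density of the action, and the einbein *)
Definition sT X := sW X / (c ^+ 2 * (sL X * (sU X * sU X))).
Definition sA X := sL X * sQ X / (sU X * sU X).
Definition sM X := sL X * (sU X * sU X).

Local Notation W0 := (h + al * u0).
Let c0 : 0 < c := bc_gt0 b.
Let u00 : 0 < u0 := bu_gt0 b.
Let l00 : 0 < l0 := bl_gt0 b.
Let E1 : (l0 * u0) ^+ 2 = W0 * W0 / c ^+ 2 - (m * c) ^+ 2 := b_energy b.
Let E2 : al * W0 = c ^+ 2 * l0 ^+ 2 * u0 := b_force b.

Lemma sdiff_eq (f : (nat -> R) -> R) v v' L L' :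
  sdiff f v L -> v = v' -> (forall X, L X = L' X) -> sdiff f v' L'.
Proof. by move=> H <- /funext <-. Qed.

Let cn : c != 0. Proof. by rewrite gt_eqF. Qed.
Let un : u0 != 0. Proof. by rewrite gt_eqF. Qed.
Let ln : l0 != 0. Proof. by rewrite gt_eqF. Qed.

Lemma sdiffZ a f v L : sdiff f v L -> @sdiff R (fun X => a * f X) (a * v) (fun X => a * L X).
Proof.
by move=> H; apply: sdiff_eq (sdiffM (sdiff_cst a) H) _ _ => // X; rewrite mul0r add0r.
Qed.

Lemma sdiffB f g v w L M : sdiff f v L -> sdiff g w M ->
  @sdiff R (fun X => f X - g X) (v - w) (fun X => L X - M X).
Proof.
move=> H K; have := sdiffD H (sdiffZ (-1) K).
have -> : (fun X => f X + -1 * g X) = (fun X => f X - g X) by apply/funext => X; rewrite mulN1r.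
by move/sdiff_eq; apply=> [|X]; rewrite mulN1r.
Qed.

Lemma sdiff_div f g v w L M : w != 0 -> sdiff f v L -> sdiff g w M ->
  @sdiff R (fun X => f X / g X) (v / w) (fun X => L X / w - v * M X / w ^+ 2).
Proof.
move=> w0 H K; have := sdiffM H (sdiff_comp K (sdiff1_inv w0 erefl erefl)).
by move/sdiff_eq; apply=> [//|X]; field; rewrite ?cn ?un ?ln.
Qed.

Lemma sdiff_U : sdiff sU u0 (fun X => X 0%N).
Proof.
by apply: sdiff_eq (sdiffD (sdiff_cst u0) (sdiff_var _ 0%N)) _ _ => [|X]; rewrite ?addr0 ?add0r.
Qed.

Lemma sdiff_S : sdiff sS 1 (fun=> 0).
Proof.
have H : @sdiff R (fun X => 1 + X 2 * X 2) 1 (fun=> 0).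
  apply: sdiff_eq (sdiffD (sdiff_cst 1) (sdiffM (sdiff_var _ 2) (sdiff_var _ 2))) _ _ => [|X]; ring.
have H1 := sdiff_comp H (@sdiff1_sqrt R 1 1 _ ltr01 (esym (expr1n _ _)) erefl).
have := sdiff_comp H1 (sdiff1_inv (oner_neq0 _) erefl erefl).
by move/sdiff_eq; apply=> [|X]; rewrite ?invr1 ?mulr0.
Qed.

Lemma sdiff_W : sdiff sW W0 (fun X => al * X 0%N + X 6).
Proof.
have := sdiffD (sdiffD (sdiff_cst h) (sdiffZ al (sdiffM sdiff_U sdiff_S))) (sdiff_var _ 6).
by move/sdiff_eq; apply=> [|X]; ring.
Qed.

Lemma sdiff_Z : sdiff sZ 0 (fun X => u0 * X 3).
Proof.
have := sdiffB (sdiffM (sdiff_var _ 3) sdiff_U) (sdiffM (sdiff_var _ 2) (sdiff_var _ 1%N)).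
by move/sdiff_eq; apply=> [|X]; ring.
Qed.

Lemma sdiff_Q : sdiff sQ (u0 ^+ 2) (fun X => 2 * u0 * X 0%N).
Proof.
have := sdiffD (sdiffD (sdiffM (sdiff_var _ 1%N) (sdiff_var _ 1%N)) (sdiffM sdiff_U sdiff_U))
  (sdiffM sdiff_Z sdiff_Z).
by move/sdiff_eq; apply=> [|X]; ring.
Qed.

Lemma sdiff_N : sdiff sN ((l0 * u0) ^+ 2) (fun X => 2 * W0 / c ^+ 2 * (al * X 0%N + X 6)).
Proof.
have c2 : c ^+ 2 != 0 by rewrite expf_neq0.
have := sdiffB (sdiff_div c2 (sdiffM sdiff_W sdiff_W) (sdiff_cst _)) (sdiff_cst ((m * c) ^+ 2)).
by move/sdiff_eq; apply=> [|X]; [rewrite E1|field].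
Qed.

(** The contributions of u to [sN] and to [sQ] cancel by the balance of forces on the circle: to
    first order only the perturbing potential changes L. *)
Lemma sdiff_L2 : sdiff sL2 (l0 ^+ 2) (fun X => 2 * W0 / (c * u0) ^+ 2 * X 6).
Proof.
have u2 : u0 ^+ 2 != 0 by rewrite expf_neq0.
have := sdiff_div u2 sdiff_N sdiff_Q.
move/sdiff_eq; apply=> [|X]; first by field.
have -> : 2 * W0 / c ^+ 2 * (al * X 0%N + X 6) = 2 * (al * W0) / c ^+ 2 * X 0%N + 2 * W0 / c ^+ 2 * X 6.
  by field.
by rewrite E2; field; rewrite ?cn ?un ?ln.
Qed.

Lemma sdiff_L : sdiff sL l0 (fun X => W0 / (l0 * (c * u0) ^+ 2) * X 6).
Proof.
have := sdiff_comp sdiff_L2 (sdiff1_sqrt l00 erefl erefl).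
by move/sdiff_eq; apply=> [//|X]; field; rewrite ?cn ?un ?ln.
Qed.

(** Coordinates 6 to 9 hold the values of eps U and eps grad U. A remainder whose differential sees
    nothing else is as flat as desired in the unknowns themselves. *)
Definition depends4 (L : (nat -> R) -> R) := forall X Y : nat -> R,
   X 6 = Y 6 -> X 7 = Y 7 -> X 8 = Y 8 -> X 9 = Y 9 -> L X = L Y.

Lemma sdiff_C : sdiff sC (- (W0 / c ^+ 2) * (al * u0 ^+ 2))
  (fun X => - (al / c ^+ 2) * ((al * X 0%N + X 6) * u0 ^+ 2 + W0 * (2 * u0 * X 0%N))).
Proof.
have := sdiffM (sdiffZ (- (c ^+ 2)^-1) sdiff_W)
  (sdiffZ al (sdiffM (sdiffM sdiff_U sdiff_U) (sdiffM (sdiffM sdiff_S sdiff_S) sdiff_S))).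
have -> : (fun X => - (c ^+ 2)^-1 * sW X * (al * (sU X * sU X * (sS X * sS X * sS X)))) = sC.
  by apply/funext => X; rewrite /sC; congr (_ * _); rewrite mulNr mulrC.
by move/sdiff_eq; apply=> [|X]; field; rewrite ?cn ?un ?ln.
Qed.

Lemma sdiff_Wc : sdiff (fun X => sW X / c ^+ 2) (W0 / c ^+ 2)
   (fun X => (al * X 0%N + X 6) / c ^+ 2).
Proof.
have c2 : c ^+ 2 != 0 by rewrite expf_neq0.
have := sdiff_div c2 sdiff_W (sdiff_cst (c ^+ 2)).
by move/sdiff_eq; apply=> [//|X]; field; rewrite ?cn ?un ?ln.
Qed.

Lemma sdiff_Fr : sdiff sFr (- (W0 / c ^+ 2) * (al * u0 ^+ 2))
  (fun X => - (al / c ^+ 2) * ((al * X 0%N + X 6) * u0 ^+ 2 + W0 * (2 * u0 * X 0%N))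
     + W0 / c ^+ 2 * X 7).
Proof.
have := sdiffD (sdiffD sdiff_C (sdiffM sdiff_Wc (sdiff_var _ 7)))
   (sdiffM sdiff_L (sdiffM (sdiff_var _ 5) sdiff_Z)).
by move/sdiff_eq; apply=> [|X]; field; rewrite ?cn ?un ?ln.
Qed.

Lemma sdiff_Ft : sdiff sFt 0 (fun X => W0 / c ^+ 2 * X 8).
Proof.
have := sdiffB (sdiffM sdiff_Wc (sdiff_var _ 8)) (sdiffM sdiff_L (sdiffM (sdiff_var _ 4) sdiff_Z)).
by move/sdiff_eq; apply=> [|X]; field; rewrite ?cn ?un ?ln.
Qed.

Lemma sdiff_Fz : sdiff sFz 0
  (fun X => X 2 * (- (W0 / c ^+ 2) * (al * u0 ^+ 2)) + W0 / c ^+ 2 * X 9 + l0 * u0 * X 4).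
Proof.
have := sdiffD (sdiffD (sdiffM (sdiff_var _ 2) sdiff_C) (sdiffM sdiff_Wc (sdiff_var _ 9)))
   (sdiffM sdiff_L (sdiffD (sdiffM (sdiff_var _ 4) sdiff_U) (sdiffM (sdiff_var _ 5) (sdiff_var _ 1%N)))).
by move/sdiff_eq; apply=> [|X]; field; rewrite ?cn ?un ?ln.
Qed.

Lemma sdiff_L2U3 : exists L, sdiff (fun X => sL2 X * (sU X * sU X * sU X)) (l0 ^+ 2 * u0 ^+ 3) L.
Proof.
eexists; have := sdiffM sdiff_L2 (sdiffM (sdiffM sdiff_U sdiff_U) sdiff_U).
by move/sdiff_eq; apply=> [|X]; [ring|].
Qed.

Lemma sdiff_Phi : sdiff sPhi 0 (fun X => W0 / (c ^+ 2 * l0 ^+ 2 * u0 ^+ 3) * X 8).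
Proof.
have [L H] := sdiff_L2U3.
have n0 : l0 ^+ 2 * u0 ^+ 3 != 0 by rewrite mulf_neq0 ?expf_neq0.
have := sdiff_div n0 sdiff_Ft H.
move/sdiff_eq; apply=> [|X]; first by rewrite mul0r.
by field; rewrite ?cn ?un ?ln.
Qed.

(** At constant L, - Fr / (L^2 u^2) equals al W / (c^2 L^2), whose derivative in u at the circle is
    (al / (c l0))^2. Together with - u this makes - k^2, which the term k^2 v in [sG1] removes. *)
Lemma sdiff_G1 : exists2 L, sdiff sG1 0 L & depends4 L.
Proof.
have n0 : l0 ^+ 2 * (u0 * u0) != 0 by rewrite !mulf_neq0 ?expf_neq0.
have eW : - (W0 / c ^+ 2) * (al * u0 ^+ 2) = - (al * W0) / c ^+ 2 * u0 ^+ 2 by ring.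
have H := sdiffD (sdiffB (sdiffB (sdiffZ (-1)
   (sdiff_div n0 sdiff_Fr (sdiffM sdiff_L2 (sdiffM sdiff_U sdiff_U))))
     (sdiffM sdiff_Phi (sdiff_var _ 1%N))) sdiff_U)
  (sdiffZ k2 (sdiff_var _ 0%N)).
exists (fun X => (al / (c ^+ 2 * l0 ^+ 2) - 2 * W0 / (c ^+ 2 * u0 * l0 ^+ 2)) * X 6
     - W0 / (c ^+ 2 * l0 ^+ 2 * u0 ^+ 2) * X 7); last by move=> X Y -> ->.
have -> : sG1 = (fun X => -1 * (sFr X / (sL2 X * (sU X * sU X))) -
    sPhi X * X 1%N - sU X + k2 * X 0%N).
  by apply/funext => X; rewrite /sG1 mulN1r.
apply: sdiff_eq H _ _ => [|X].
  by rewrite eW E2; field; rewrite ln un cn.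
rewrite (_ : - (al / c ^+ 2) * _ = - al ^+ 2 / c ^+ 2 * X 0%N * u0 ^+ 2
   - (al * W0) / c ^+ 2 * (2 * u0 * X 0%N) - al / c ^+ 2 * u0 ^+ 2 * X 6); last by ring.
by rewrite eW E2 (bkE b); field; rewrite ln un cn.
Qed.

(** The attraction is central, so it drops out of Fz - z Fr; the first-order term in the multiplier
    is removed by [bk0 * X 4]. *)
Lemma sdiff_G2 : exists2 L, sdiff sG2 0 L & depends4 L.
Proof.
have [L H3] := sdiff_L2U3.
have n0 : l0 ^+ 2 * u0 ^+ 3 != 0 by rewrite mulf_neq0 ?expf_neq0.
have H := sdiffB (sdiffB
   (sdiff_div n0 (sdiffB sdiff_Fz (sdiffM (sdiff_var _ 2) sdiff_Fr)) H3)
     (sdiffM sdiff_Phi (sdiff_var _ 3)))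
  (sdiffZ bk0 (sdiff_var _ 4)).
exists (fun X => W0 / (c ^+ 2 * l0 ^+ 2 * u0 ^+ 3) * X 9); last by move=> X Y _ _ _ ->.
apply: sdiff_eq H _ _ => [|X]; rewrite /bk0; first by field; rewrite ln un.
by field; rewrite cn ln un.
Qed.

Lemma sdiff_T : exists L, sdiff sT (W0 / (c ^+ 2 * (l0 * u0 ^+ 2))) L.
Proof.
have n0 : c ^+ 2 * (l0 * (u0 * u0)) != 0 by rewrite !mulf_neq0 ?expf_neq0.
eexists; have := sdiff_div n0 sdiff_W (sdiffZ (c ^+ 2) (sdiffM sdiff_L (sdiffM sdiff_U sdiff_U))).
by move/sdiff_eq; apply.
Qed.

Lemma sdiff_M : exists L, sdiff sM (l0 * u0 ^+ 2) L.
Proof.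
by eexists; have := sdiffM sdiff_L (sdiffM sdiff_U sdiff_U); move/sdiff_eq; apply.
Qed.

Lemma sdiff_A : exists L, sdiff sA (l0 * u0 ^+ 2 / (u0 * u0)) L.
Proof.
have n0 : u0 * u0 != 0 by rewrite mulf_neq0.
by eexists; have := sdiff_div n0 (sdiffM sdiff_L sdiff_Q) (sdiffM sdiff_U sdiff_U);
  move/sdiff_eq; apply.
Qed.

End OrbitFunctions.

(** * Periodic solutions of the linearized equations *)

Section Oscillator.
Variable R : realType.
Local Notation tpi := (pi *+ 2 : R).

Lemma tpi_gt0 : 0 < tpi.
Proof. by rewrite pmulrn_lgt0// pi_gt0. Qed.

Lemma cos2pi_neq1 (k : R) : 0 < k < 1 -> cos (k * tpi) < 1.
Proof.
move=> /andP[k0 k1]; rewrite mulrnAr cos_mulr2n cos2sin2.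
have : 0 < sin (k * pi) by rewrite sin_gt0_pi// mulr_gt0 ?pi_gt0// gtr_pMl ?pi_gt0.
by move=> s0; have := exprn_gt0 2 s0; lra.
Qed.

Lemma cos_norm_le1 (x : R) : `|cos x| <= 1.
Proof. by rewrite ler_norml cos_geN1 cos_le1. Qed.

Lemma sin_norm_le1 (x : R) : `|sin x| <= 1.
Proof. by rewrite ler_norml sin_geN1 sin_le1. Qed.

(** Variation of constants. The primitives [S] and [C] are part of the statement because the return
    map over one period is read off from their values at 2 pi. *)
Lemma oscillator_cauchy (k : R) (f : R -> R) (A0 B0 : R) : k != 0 -> continuous f ->
  exists v v1 S C : R -> R,
    [/\ forall t : R, der v t (v1 t), forall t : R, der v1 t (- k ^+ 2 * v t + f t),
      [/\ forall t : R, der S t (sin (k * t) * f t), forall t : R, der C t (cos (k * t) * f t),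
        S 0 = 0 & C 0 = 0],
      forall t : R, v t = (cos (k * t) * (A0 - S t) + sin (k * t) * (B0 + C t)) / k &
      forall t : R, v1 t = - sin (k * t) * (A0 - S t) + cos (k * t) * (B0 + C t)].
Proof.
move=> k0 cf.
have [|S [S0 dS]] := @primitive_ex R (fun t => sin (k * t) * f t).
  move=> t; apply: continuousM; last exact: cf.
  by apply: der_continuous => x; eexists; exact: der_sin.
have [|C [C0 dC]] := @primitive_ex R (fun t => cos (k * t) * f t).
  move=> t; apply: continuousM; last exact: cf.
  by apply: der_continuous => x; eexists; exact: der_cos.
exists (fun t => (cos (k * t) * (A0 - S t) + sin (k * t) * (B0 + C t)) / k).
exists (fun t => - sin (k * t) * (A0 - S t) + cos (k * t) * (B0 + C t)), S, C.
have dA t := derB (derC A0 t) (dS t).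
have dB t := derD (derC B0 t) (dC t).
split=> // t.
  have := derM (derD (derM (der_cos k t) (dA t)) (derM (der_sin k t) (dB t))) (derC k^-1 t).
  by move/der_val; apply; field.
have := derD (derM (derN (der_sin k t)) (dA t)) (derM (der_cos k t) (dB t)).
move/der_val; apply.
transitivity (- k ^+ 2 * ((cos (k * t) * (A0 - S t) + sin (k * t) * (B0 + C t)) / k)
   + (cos (k * t) ^+ 2 + sin (k * t) ^+ 2) * f t); first by field.
by rewrite cos2Dsin2 mul1r.
Qed.

(** The difference between the solution and its translate solves the homogeneous equation with zero
    initial data, and its energy k^2 D^2 + E^2 is constant. *)
Lemma oscillator_periodic (k : R) (f v v1 : R -> R) : k != 0 ->
  (forall t : R, f (t + tpi) = f t) ->
  (forall t : R, der v t (v1 t)) -> (forall t : R, der v1 t (- k ^+ 2 * v t + f t)) ->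
  v tpi = v 0 -> v1 tpi = v1 0 ->
  (forall t : R, v (t + tpi) = v t) /\ (forall t : R, v1 (t + tpi) = v1 t).
Proof.
move=> k0 fp dv dv1 e0 e1.
pose D t := v (t + tpi) - v t; pose E t := v1 (t + tpi) - v1 t.
have dD t : der D t (E t) by exact: (derB (der_shift (dv (t + tpi))) (dv t)).
have dE t : der E t (- k ^+ 2 * D t).
  apply: der_val (derB (der_shift (dv1 (t + tpi))) (dv1 t)) _.
  by rewrite fp /D; ring.
have H t : k ^+ 2 * (D t * D t) + E t * E t = 0.
  have -> : 0 = k ^+ 2 * (D 0 * D 0) + E 0 * E 0.
    by rewrite /D /E add0r e0 e1 !subrr !mul0r mulr0 addr0.
  apply: (@der_cst _ (fun t => k ^+ 2 * (D t * D t) + E t * E t)) => {}t.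
  apply: der_val (derD (derZ _ (derM (dD t) (dD t))) (derM (dE t) (dE t))) _.
  by ring.
have k2 : 0 < k ^+ 2 by rewrite exprn_even_gt0.
have HD t : D t = 0 /\ E t = 0.
  have := H t; rewrite -!expr2 => /eqP; rewrite paddr_eq0 ?sqr_ge0//; last by rewrite mulr_ge0 ?(ltW k2) ?sqr_ge0.
  by rewrite mulf_eq0 (gt_eqF k2) !sqrf_eq0 => /andP[/eqP-> /eqP->].
by split=> t; apply/eqP; rewrite -subr_eq0; [rewrite -/(D t) (HD t).1|rewrite -/(E t) (HD t).2].
Qed.

(** The return map is a rotation of angle 2 pi k followed by a translation. For 0 < k < 1 the
    identity minus this rotation has determinant 2 - 2 cos(2 pi k) > 0, so there is a fixed
    point. *)
Lemma oscillator_exists (k : R) (f : R -> R) : 0 < k < 1 -> continuous f ->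
  (forall t : R, f (t + tpi) = f t) ->
  exists v v1 : R -> R,
    [/\ forall t : R, der v t (v1 t), forall t : R, der v1 t (- k ^+ 2 * v t + f t),
      forall t : R, v (t + tpi) = v t & forall t : R, v1 (t + tpi) = v1 t].
Proof.
move=> k01 cf fp; have /andP[k0 _] := k01.
have kn : k != 0 by rewrite gt_eqF.
(* This run with zero data only provides [S] and [C] at 2 pi, which do not depend on the initial
   data. *)
have [v [v1 [S [C [_ _ [dS dC S0 C0] _ _]]]]] := oscillator_cauchy 0 0 kn cf.
have [cs1 cs2] := (cos2pi_neq1 k01, cos2Dsin2 (k * tpi)).
set co := cos (k * tpi) in cs1 cs2; set si := sin (k * tpi) in cs2.
pose P := - S tpi; pose Q := C tpi.
pose p := co * P + si * Q; pose q := - si * P + co * Q.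
pose d := 2 - 2 * co.
have dn : d != 0 by rewrite gt_eqF// /d; lra.
have ed : (1 - co) ^+ 2 + si ^+ 2 = d.
  have -> : si ^+ 2 = 1 - co ^+ 2 by rewrite -cs2 addrAC subrr add0r.
  by rewrite /d; ring.
(* (I - rotation) (a, b) = (p, q) *)
pose a := ((1 - co) * p + si * q) / d; pose b := ((1 - co) * q - si * p) / d.
have Ea : a = co * (a + P) + si * (b + Q).
  suff : (1 - co) * a - si * b = p by rewrite /p => H; lra.
  have -> : (1 - co) * a - si * b = ((1 - co) ^+ 2 + si ^+ 2) * p / d by rewrite /a /b; field.
  by rewrite ed mulrAC mulfV// mul1r.
have Eb : b = - si * (a + P) + co * (b + Q).
  suff : si * a + (1 - co) * b = q by rewrite /q => H; lra.
  have -> : si * a + (1 - co) * b = ((1 - co) ^+ 2 + si ^+ 2) * q / d by rewrite /a /b; field.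
  by rewrite ed mulrAC mulfV// mul1r.
have [w [w1 [S' [C' [dw dw1 [dS' dC' S'0 C'0] ew ew1]]]]] := oscillator_cauchy a b kn cf.
have ES : S' tpi = S tpi.
  have := @der_cst _ (fun t => S' t - S t) _ tpi 0; rewrite S0 S'0 subrr => H.
  apply/eqP; rewrite -subr_eq0; apply/eqP/H => t.
  by apply: der_val (derB (dS' t) (dS t)) _; rewrite subrr.
have EC : C' tpi = C tpi.
  have := @der_cst _ (fun t => C' t - C t) _ tpi 0; rewrite C0 C'0 subrr => H.
  apply/eqP; rewrite -subr_eq0; apply/eqP/H => t.
  by apply: der_val (derB (dC' t) (dC t)) _; rewrite subrr.
have [||wp w1p] := oscillator_periodic kn fp dw dw1.
- rewrite !ew ES EC mulr0 cos0 sin0 S'0 C'0 mul1r mul0r addr0 subr0.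
  by rewrite -/co -/si -/P -/Q -Ea.
- rewrite !ew1 ES EC mulr0 cos0 sin0 S'0 C'0 oppr0 mul1r mul0r add0r addr0.
  by rewrite -/co -/si -/P -/Q -Eb.
by exists w, w1; split.
Qed.

Lemma oscillator_bound (k : R) : 0 < k < 1 -> exists2 K, 0 < K &
  forall (v v1 f : R -> R) b,
  (forall t : R, der v t (v1 t)) -> (forall t : R, der v1 t (- k ^+ 2 * v t + f t)) ->
  (forall t : R, v (t + tpi) = v t) -> (forall t : R, v1 (t + tpi) = v1 t) ->
  (forall t : R, `|f t| <= b) -> forall t : R, `|v t| <= K * b /\ `|v1 t| <= K * b.
Proof.
move=> k01; have /andP[k0 k1] := k01.
have cs1 := cos2pi_neq1 k01.
set co := cos (k * tpi) in cs1; pose si := sin (k * tpi).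
have cs2 : co ^+ 2 + si ^+ 2 = 1 by exact: cos2Dsin2.
have tp := tpi_gt0.
pose d := 2 - 2 * co.
have d0 : 0 < d by rewrite /d; lra.
have ed : (1 - co) ^+ 2 + si ^+ 2 = d.
  have -> : si ^+ 2 = 1 - co ^+ 2 by rewrite -cs2 addrAC subrr add0r.
  by rewrite /d; ring.
(* The inverse of the identity minus the rotation has entries bounded by 2 / d and 1 / d, applied to
   increments of size [b * tpi]. *)
pose K1 := 3 * tpi / d.
have K10 : 0 < K1 by rewrite divr_gt0// mulr_gt0.
exists (K1 / k); first by rewrite divr_gt0.
move=> v v1 f b dv dv1 vp v1p fb t0.
have b0 : 0 <= b by apply: le_trans (fb 0).
(* In a frame rotating with the free oscillation and centred at [t0], only the forcing moves (A, B);
   by periodicity of [v] the increments over a period are linear in the two values at [t0]. *)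
pose cc t := cos (k * (t - t0)); pose ss t := sin (k * (t - t0)).
have dc t : der cc t (- k * ss t).
  have := @der_shift _ (fun t => cos (k * t)) t (- t0) _ (der_cos k (t - t0)).
  by move/der_val; apply.
have ds t : der ss t (k * cc t).
  have := @der_shift _ (fun t => sin (k * t)) t (- t0) _ (der_sin k (t - t0)).
  by move/der_val; apply.
have cs t : cc t ^+ 2 + ss t ^+ 2 = 1 by exact: cos2Dsin2.
pose A t := k * (v t * cc t) - v1 t * ss t.
pose B t := k * (v t * ss t) + v1 t * cc t.
have dA t : der A t (- ss t * f t).
  apply: der_val (derB (derZ k (derM (dv t) (dc t))) (derM (dv1 t) (ds t))) _.
  by ring.
have dB t : der B t (cc t * f t).
  apply: der_val (derD (derZ k (derM (dv t) (ds t))) (derM (dv1 t) (dc t))) _.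
  by ring.
have t0le : t0 <= t0 + tpi by rewrite lerDl ltW.
have HA : `|A (t0 + tpi) - A t0| <= b * tpi.
  have := @der_bound _ A _ t0 (t0 + tpi) b t0le dA.
  rewrite [t0 + _]addrC addrK; apply=> t _.
  by rewrite normrM normrN -[b]mul1r ler_pM ?sin_norm_le1.
have HB : `|B (t0 + tpi) - B t0| <= b * tpi.
  have := @der_bound _ B _ t0 (t0 + tpi) b t0le dB.
  rewrite [t0 + _]addrC addrK; apply=> t _.
  by rewrite normrM -[b]mul1r ler_pM ?cos_norm_le1.
move: HA HB; rewrite /A /B vp v1p /cc /ss subrr mulr0 cos0 sin0.
rewrite [t0 + _]addrC addrK -/co -/si !mulr1 !mulr0 subr0 add0r.
set x := v t0; set y := v1 t0.
have sib : `|si| <= 1 by exact: sin_norm_le1.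
have cob : `|1 - co| <= 2.
  by rewrite ger0_norm ?subr_ge0 ?(ltW cs1)//; have := cos_geN1 (k * tpi); rewrite -/co; lra.
set p := k * _ - _ - _ => HA; set q := k * _ + _ - _ => HB.
have Ex : d * (k * x) = - (1 - co) * p + si * q.
  rewrite -ed.
  by rewrite /p /q; ring.
have Ey : d * y = - (1 - co) * q - si * p.
  rewrite -ed.
  by rewrite /p /q; ring.
have big u w : `|u| <= b * tpi -> `|w| <= b * tpi ->
    `| (1 - co) * u| + `|si * w| <= d * (K1 * b).
  move=> ub wb; rewrite !normrM.
  have -> : d * (K1 * b) = 2 * (b * tpi) + 1 * (b * tpi) by rewrite /K1; field; rewrite gt_eqF.
  by rewrite lerD// ler_pM.
have kx : `|k * x| <= K1 * b.
  rewrite -(ler_pM2l d0) -(gtr0_norm d0) -[in leLHS]normrM (gtr0_norm d0) Ex.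
  by rewrite (le_trans (ler_normD _ _))// mulNr normrN big.
have ky : `|y| <= K1 * b.
  rewrite -(ler_pM2l d0) -(gtr0_norm d0) -[in leLHS]normrM (gtr0_norm d0) Ey.
  by rewrite (le_trans (ler_normB _ _))// mulNr normrN big.
split.
  by rewrite mulrAC ler_pdivlMr//; move: kx; rewrite normrM (gtr0_norm k0) mulrC.
rewrite (le_trans ky)// [leRHS]mulrAC ler_pdivlMr// ler_piMr ?(ltW k1)//. exact: mulr_ge0 (ltW K10) b0.
Qed.

End Oscillator.

Section ResonantOscillator.
Variable R : realType.
Local Notation tpi := (pi *+ 2 : R).

Lemma dcos (x : R) : der (@cos R) x (- sin x).
Proof. exact: is_derive_cos. Qed.

Lemma dsin (x : R) : der (@sin R) x (cos x).
Proof. exact: is_derive_sin. Qed.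

(** One reduced time [s] serves all periodic functions at once, hence relations between several of
    them. *)
Lemma periodic_reduce (t : R) : exists2 s, 0 <= s <= tpi &
  forall f : R -> R, (forall t : R, f (t + tpi) = f t) -> f t = f s.
Proof.
have tp := tpi_gt0 R.
pose n := Num.floor (t / tpi).
have pern (f : R -> R) (m : nat) x : (forall t : R, f (t + tpi) = f t) -> f (x + m%:R * tpi) = f x.
  move=> fp; elim: m => [|m IHm]; first by rewrite mul0r addr0.
  by rewrite -[m.+1]addn1 natrD mulrDl mul1r addrA fp.
have perz (f : R -> R) (z : int) x : (forall t : R, f (t + tpi) = f t) -> f (x - z%:~R * tpi) = f x.
  move=> fp; case: z => z; last by rewrite NegzE mulrNz mulNr opprK pern.
  by rewrite -[LHS](pern f z)// subrK.
exists (t - n%:~R * tpi); last by move=> f fp; rewrite perz.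
have n1 : n%:~R <= t / tpi by exact: floor_le_tmp.
have n2 : t / tpi < n%:~R + 1 by rewrite -[1]/(1%:~R) -intrD; exact: floorD1_gt.
move: n1 n2; rewrite ler_pdivlMr// ltr_pdivrMr// mulrDl mul1r => n1 n2.
by rewrite subr_ge0 n1 lerBlDl ltW.
Qed.

(** At resonance a periodic solution exists when the forcing is orthogonal to cos and sin. The
    multipliers are chosen to cancel these two Fourier coefficients of [g], the integrals of cos^2
    and sin^2 over a period being pi. *)
Lemma tilt_exists (k0 : R) (g : R -> R) : 0 < k0 -> continuous g ->
  (forall t : R, g (t + tpi) = g t) ->
  exists (z z1 : R -> R) (l1 l2 : R),
    [/\ forall t : R, der z t (z1 t),
        forall t : R, der z1 t (- z t + (g t + k0 * (l1 * cos t + l2 * sin t))),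
        z 0 = 0 /\ z1 0 = 0,
        forall t : R, z (t + tpi) = z t & forall t : R, z1 (t + tpi) = z1 t].
Proof.
move=> k00 cg gp.
have [v [v1 [S0 [C0 [_ _ [dS0 dC0 S00 C00] _ _]]]]] := oscillator_cauchy 0 0 (oner_neq0 R) cg.
have p0 : 0 < pi :> R by exact: pi_gt0.
pose l1 := - C0 tpi / (k0 * pi); pose l2 := - S0 tpi / (k0 * pi).
pose F t := g t + k0 * (l1 * cos t + l2 * sin t).
have cF : continuous F.
  move=> t; apply: (@continuousD _ _ _ g); first exact: cg.
  apply: der_continuous => x; eexists.
  exact: (derZ k0 (derD (derZ l1 (dcos x)) (derZ l2 (dsin x)))).
have Fp t : F (t + tpi) = F t by rewrite /F gp cosD2pi sinD2pi.
have [z [z1 [S [C [dz dz1 [dS dC S_0 C_0] ez ez1]]]]] := oscillator_cauchy 0 0 (oner_neq0 R) cF.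
have ES : S tpi = 0.
  (* The last term is an explicit primitive of the multiplier's part of the integrand, so [G] is
     constant. *)
  pose G t := S t - S0 t - k0 * (l1 * (sin t * sin t / 2) + l2 * ((t - sin t * cos t) / 2)).
  have : G tpi = G 0.
    apply: der_cst => t.
    have ds2 := derM (derM (dsin t) (dsin t)) (derC 2^-1 t).
    have dt2 := derM (derB (der_id t) (derM (dsin t) (dcos t))) (derC 2^-1 t).
    apply: der_val (derB (derB (dS t) (dS0 t)) (derZ k0 (derD (derZ l1 ds2) (derZ l2 dt2)))) _.
    rewrite mul1r /F.
    have e : cos t * cos t = 1 - sin t * sin t by rewrite -!expr2 -(cos2Dsin2 t) addrK.
    by field: e.
  rewrite /G sin2pi sin0 S_0 S00 /l2 !(mul0r, subr0, addr0, mulr0, add0r, oppr0).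
  move=> H; rewrite -[RHS]H -mulr_natr; move: p0; generalize (@pi R) => p p0.
  by field; rewrite !gt_eqF.
have EC : C tpi = 0.
  pose G t := C t - C0 t - k0 * (l1 * ((t + sin t * cos t) / 2) + l2 * (sin t * sin t / 2)).
  have : G tpi = G 0.
    apply: der_cst => t.
    have ds2 := derM (derM (dsin t) (dsin t)) (derC 2^-1 t).
    have dt2 := derM (derD (der_id t) (derM (dsin t) (dcos t))) (derC 2^-1 t).
    apply: der_val (derB (derB (dC t) (dC0 t)) (derZ k0 (derD (derZ l1 dt2) (derZ l2 ds2)))) _.
    rewrite mul1r /F.
    have e : sin t * sin t = 1 - cos t * cos t by rewrite -!expr2 -(cos2Dsin2 t) addrAC subrr add0r.
    by field: e.
  rewrite /G sin2pi sin0 C_0 C00 /l1 !(mul0r, subr0, addr0, mulr0, add0r, oppr0).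
  move=> H; rewrite -[RHS]H -mulr_natr; move: p0; generalize (@pi R) => p p0.
  by field; rewrite !gt_eqF.
have z0 : z 0 = 0 by rewrite ez mulr0 S_0 C_0 sin0 !(mul0r, subr0, addr0, mulr0, add0r, oppr0).
have z10 : z1 0 = 0 by rewrite ez1 mulr0 S_0 C_0 sin0 !(mul0r, subr0, addr0, mulr0, add0r, oppr0).
have [||zp z1p] := oscillator_periodic (oner_neq0 R) Fp dz dz1.
- by rewrite z0 ez ES EC !(mul0r, subr0, addr0, mulr0, add0r, oppr0).
- by rewrite z10 ez1 ES EC !(mul0r, subr0, addr0, mulr0, add0r, oppr0).
exists z, z1, l1, l2; split=> // t.
by apply: der_val (dz1 t) _; rewrite expr1n mulN1r.
Qed.

(** Testing the equation against sin and cos isolates each multiplier; once these are bounded, the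
    zero data at 0 allow an integration over one period. For [g] = 0 the lemma is a uniqueness
    statement. *)
Lemma tilt_bound (k0 : R) : 0 < k0 -> exists2 K, 0 < K &
  forall (z z1 g : R -> R) l1 l2 b,
  (forall t : R, der z t (z1 t)) ->
  (forall t : R, der z1 t (- z t + (g t + k0 * (l1 * cos t + l2 * sin t)))) ->
  z 0 = 0 -> z1 0 = 0 ->
  (forall t : R, z (t + tpi) = z t) -> (forall t : R, z1 (t + tpi) = z1 t) ->
  (forall t, `|g t| <= b) ->
  [/\ `|l1| <= K * b, `|l2| <= K * b & forall t, `|z t| <= K * b /\ `|z1 t| <= K * b].
Proof.
move=> k00; have tp := tpi_gt0 R.
(* Each multiplier is at most 2 b / k0, so the total forcing is at most 5 b; integrated over a
   period it bounds A and B by 5 b 2 pi, and two such terms make up z. *)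
exists (2 / k0 + 10 * tpi); first by rewrite addr_gt0 ?divr_gt0 ?mulr_gt0.
move=> z z1 g l1 l2 b dz dz1 z0 z10 zp z1p gb.
have b0 : 0 <= b by apply: le_trans (gb 0).
pose F t := g t + k0 * (l1 * cos t + l2 * sin t).
pose A t := z t * cos t - z1 t * sin t; pose B t := z t * sin t + z1 t * cos t.
have dA t : der A t (- sin t * F t).
  apply: der_val (derB (derM (dz t) (dcos t)) (derM (dz1 t) (dsin t))) _.
  by rewrite /F; ring.
have dB t : der B t (cos t * F t).
  apply: der_val (derD (derM (dz t) (dsin t)) (derM (dz1 t) (dcos t))) _.
  by rewrite /F; ring.
have A0 : A 0 = 0 by rewrite /A z0 z10 !mul0r subrr.
have B0 : B 0 = 0 by rewrite /B z0 z10 !mul0r addr0.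
have zT : z tpi = 0 by rewrite -[tpi]add0r zp.
have z1T : z1 tpi = 0 by rewrite -[tpi]add0r z1p.
have Hl2 : `|l2| <= 2 / k0 * b.
  pose G t := A t + k0 * (l1 * (sin t * sin t / 2) + l2 * ((t - sin t * cos t) / 2)).
  have dG t : der G t (- sin t * g t).
    have ds2 := derM (derM (dsin t) (dsin t)) (derC 2^-1 t).
    have dt2 := derM (derB (der_id t) (derM (dsin t) (dcos t))) (derC 2^-1 t).
    apply: der_val (derD (dA t) (derZ k0 (derD (derZ l1 ds2) (derZ l2 dt2)))) _.
    rewrite /F.
    have e : cos t * cos t = 1 - sin t * sin t by rewrite -!expr2 -(cos2Dsin2 t) addrK.
    by field: e.
  have := @der_bound _ G _ 0 tpi b (ltW tp) dG.
  rewrite /G /A zT z1T z0 z10 sin2pi sin0 !(mul0r, subr0, addr0, mulr0, add0r, oppr0) => H.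
  have {}H : `|k0 * (l2 * (tpi / 2))| <= b * tpi.
    by apply: H => t _; rewrite normrM normrN -[b]mul1r ler_pM ?sin_norm_le1.
  rewrite -(ler_pM2r tp) mulrAC; rewrite -(ler_pM2l k00).
  have -> : k0 * (2 / k0 * tpi * b) = 2 * (b * tpi) by field; rewrite gt_eqF.
  move: H; rewrite !normrM (gtr0_norm k00) (gtr0_norm (_ : 0 < 2^-1)) ?invr_gt0//.
  by rewrite (gtr0_norm tp); lra.
have Hl1 : `|l1| <= 2 / k0 * b.
  pose G t := B t - k0 * (l1 * ((t + sin t * cos t) / 2) + l2 * (sin t * sin t / 2)).
  have dG t : der G t (cos t * g t).
    have ds2 := derM (derM (dsin t) (dsin t)) (derC 2^-1 t).
    have dt2 := derM (derD (der_id t) (derM (dsin t) (dcos t))) (derC 2^-1 t).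
    apply: der_val (derB (dB t) (derZ k0 (derD (derZ l1 dt2) (derZ l2 ds2)))) _.
    rewrite /F.
    have e : sin t * sin t = 1 - cos t * cos t by rewrite -!expr2 -(cos2Dsin2 t) addrAC subrr add0r.
    by field: e.
  have := @der_bound _ G _ 0 tpi b (ltW tp) dG.
  rewrite /G /B zT z1T z0 z10 sin2pi sin0 !(mul0r, subr0, addr0, mulr0, add0r, oppr0) normrN => H.
  have {}H : `|k0 * (l1 * (tpi / 2))| <= b * tpi.
    by apply: H => t _; rewrite normrM -[b]mul1r ler_pM ?cos_norm_le1.
  rewrite -(ler_pM2r tp) mulrAC; rewrite -(ler_pM2l k00).
  have -> : k0 * (2 / k0 * tpi * b) = 2 * (b * tpi) by field; rewrite gt_eqF.
  move: H; rewrite !normrM (gtr0_norm k00) (gtr0_norm (_ : 0 < 2^-1)) ?invr_gt0//.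
  by rewrite (gtr0_norm tp); lra.
have tb : 0 <= tpi * b by rewrite mulr_ge0// ltW.
have kb : 0 <= 2 / k0 * b by rewrite mulr_ge0// divr_ge0// ltW.
have FB t : `|F t| <= 5 * b.
  have H1 : `|l1 * cos t| <= 2 / k0 * b.
    by rewrite normrM -[leRHS]mulr1 ler_pM ?cos_norm_le1.
  have H2 : `|l2 * sin t| <= 2 / k0 * b.
    by rewrite normrM -[leRHS]mulr1 ler_pM ?sin_norm_le1.
  rewrite (le_trans (ler_normD _ _))// normrM (gtr0_norm k00).
  have H3 : `|l1 * cos t + l2 * sin t| <= 2 * (2 / k0 * b).
    by rewrite (le_trans (ler_normD _ _))//; lra.
  have H4 : k0 * `|l1 * cos t + l2 * sin t| <= k0 * (2 * (2 / k0 * b)) by rewrite ler_wpM2l// ltW.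
  have e4 : k0 * (2 * (2 / k0 * b)) = 4 * b by field; rewrite gt_eqF.
  by have := gb t; lra.
have bnd (G dG : R -> R) s : (forall t, der G t (dG t)) -> G 0 = 0 -> 0 <= s <= tpi ->
    (forall t, `|dG t| <= 5 * b) -> `|G s| <= 5 * (tpi * b).
  move=> dG' G0 /andP[s0 s1] H.
  have := @der_bound _ G dG 0 s (5 * b) s0 dG' (fun t _ => H t).
  rewrite G0 !subr0 => /le_trans; apply.
  by rewrite -mulrA ler_pM2l// mulrC ler_wpM2r.
have AB s : 0 <= s <= tpi -> `|A s| <= 5 * (tpi * b) /\ `|B s| <= 5 * (tpi * b).
  move=> s01; split.
    apply: (bnd A _ s dA) => // t.
    by rewrite normrM normrN -[leRHS]mul1r ler_pM ?sin_norm_le1.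
  apply: (bnd B _ s dB) => // t.
  by rewrite normrM -[leRHS]mul1r ler_pM ?cos_norm_le1.
rewrite mulrDl; split; [lra|lra|].
move=> t; have [s s01 ts] := periodic_reduce t; rewrite !ts//.
have [As Bs] := AB s s01.
have prod x y : `|x| <= 1 -> `|y| <= 5 * (tpi * b) -> `|x * y| <= 5 * (tpi * b).
  by move=> x1 y1; rewrite normrM -[leRHS]mul1r ler_pM.
have e : cos s * cos s = 1 - sin s * sin s by rewrite -!expr2 -(cos2Dsin2 s) addrK.
have -> : z s = cos s * A s + sin s * B s by rewrite /A /B; ring: e.
have -> : z1 s = - sin s * A s + cos s * B s by rewrite /A /B; ring: e.
have h1 := prod _ _ (cos_norm_le1 s) As; have h2 := prod _ _ (sin_norm_le1 s) Bs.
have h3 := prod _ _ (sin_norm_le1 s) As; have h4 := prod _ _ (cos_norm_le1 s) Bs.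
by split; rewrite (le_trans (ler_normD _ _))// ?mulNr ?normrN; lra.
Qed.

End ResonantOscillator.

(** * Existence and uniqueness of the orbit *)

Section Perturbation.
Variables (R : realType) (b : base R).
Local Notation u0 := (bu b).
Local Notation rad := (bu b)^-1.
Local Notation tpi := (pi *+ 2 : R).

Definition near_circle (t rho x1 x2 x3 : R) :=
  [/\ `|x1 - rad * cos t| <= rho, `|x2 - rad * sin t| <= rho & `|x3| <= rho].

(* [P 0] is the perturbing potential and [P 1], [P 2], [P 3] its partial
   derivatives, controlled near the circle of radius [rad]. *)
Definition pert (B rho : R) (P : nat -> R -> R -> R -> R) :=
  forall t x1 x2 x3 y1 y2 y3 k, near_circle t rho x1 x2 x3 -> near_circle t rho y1 y2 y3 ->
    `|x1 - y1| <= k -> `|x2 - y2| <= k -> `|x3 - y3| <= k ->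
  [/\ forall j, `|P j y1 y2 y3| <= B,
      forall j, `|P j x1 x2 x3 - P j y1 y2 y3| <= B * k &
      `|P 0%N x1 x2 x3 - P 0%N y1 y2 y3 - (P 1%N y1 y2 y3 * (x1 - y1)
         + P 2 y1 y2 y3 * (x2 - y2) + P 3 y1 y2 y3 * (x3 - y3))| <= B * k ^+ 2].

Definition pos1 (t v : R) := cos t / (u0 + v).
Definition pos2 (t v : R) := sin t / (u0 + v).
Definition pos3 (v z : R) := z / (u0 + v).

Definition force_at eps (P : nat -> R -> R -> R -> R) t v z j :=
  eps * P j (pos1 t v) (pos2 t v) (pos3 v z).

Definition state eps P (t v v1 z z1 l1 l2 : R) : nat -> R := nth 0
  [:: v; v1; z; z1; l1 * cos t + l2 * sin t; l2 * cos t - l1 * sin t;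
      force_at eps P t v z 0;
      force_at eps P t v z 1 * cos t + force_at eps P t v z 2 * sin t;
      force_at eps P t v z 2 * cos t - force_at eps P t v z 1 * sin t;
      force_at eps P t v z 3].

Lemma norm_comb (a d e f k : R) : `|a| <= k -> `|d| <= k -> `|e| <= 1 -> `|f| <= 1 ->
  `|a * e + d * f| <= 2 * k.
Proof.
move=> ak dk e1 f1; rewrite (le_trans (ler_normD _ _))// !normrM.
have : `|a| * `|e| <= k * 1 by rewrite ler_pM.
have : `|d| * `|f| <= k * 1 by rewrite ler_pM.
by lra.
Qed.

Lemma rotate_bound (a d t k : R) : `|a| <= k -> `|d| <= k ->
  `|a * cos t + d * sin t| <= 2 * k /\ `|d * cos t - a * sin t| <= 2 * k.
Proof.
move=> ak dk; split; first by rewrite norm_comb ?cos_norm_le1 ?sin_norm_le1.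
by rewrite -mulrN norm_comb ?normrN ?cos_norm_le1 ?sin_norm_le1.
Qed.

Lemma near_circleW (t r s x1 x2 x3 : R) : r <= s -> near_circle t r x1 x2 x3 -> near_circle t s x1 x2 x3.
Proof. by move=> rs [h1 h2 h3]; split; apply: le_trans rs. Qed.

(** The unknowns (below 6) and the forces (from 6 on) are compared separately, since only the latter
    carry a factor eps. The 2 comes from rotating pairs of components into the moving frame. *)
Lemma state_cmp eps P P' (t v v1 z z1 l1 l2 v' v1' z' z1' l1' l2' k ke : R) :
  `|v - v'| <= k -> `|v1 - v1'| <= k -> `|z - z'| <= k -> `|z1 - z1'| <= k ->
  `|l1 - l1'| <= k -> `|l2 - l2'| <= k ->
  (forall j, `|force_at eps P t v z j - force_at eps P' t v' z' j| <= ke) ->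
  (forall i, (i < 6)%N -> `|state eps P t v v1 z z1 l1 l2 i - state eps P' t v' v1' z' z1' l1' l2' i| <= 2 * k) /\
  (forall i, (6 <= i)%N -> `|state eps P t v v1 z z1 l1 l2 i - state eps P' t v' v1' z' z1' l1' l2' i| <= 2 * ke).
Proof.
move=> hv hv1 hz hz1 hl1 hl2 he.
have k0 : 0 <= k by apply: le_trans hv.
have ke0 : 0 <= ke by apply: le_trans (he 0%N).
have kk x : x <= k -> x <= 2 * k by move=> ?; lra.
have [r1 r2] := rotate_bound t hl1 hl2.
have [r3 r4] := rotate_bound t (he 1%N) (he 2).
rewrite /state; split=> [[|[|[|[|[|[|[|i]]]]]]]|[|[|[|[|[|[|[|[|[|[|i]]]]]]]]]]]//= _;
  try exact: kk.
- by rewrite (_ : _ - _ = (l1 - l1') * cos t + (l2 - l2') * sin t)//; ring.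
- by rewrite (_ : _ - _ = (l2 - l2') * cos t - (l1 - l1') * sin t)//; ring.
- by have := he 0%N; lra.
- set a := force_at _ _ _ _ _ 1 in r3 r4 *; set d := force_at _ _ _ _ _ 2 in r3 r4 *.
  set a' := force_at _ _ _ _ _ 1 in r3 r4 *; set d' := force_at _ _ _ _ _ 2 in r3 r4 *.
  by rewrite (_ : _ - _ = (a - a') * cos t + (d - d') * sin t)//; ring.
- set a := force_at _ _ _ _ _ 1 in r3 r4 *; set d := force_at _ _ _ _ _ 2 in r3 r4 *.
  set a' := force_at _ _ _ _ _ 1 in r3 r4 *; set d' := force_at _ _ _ _ _ 2 in r3 r4 *.
  by rewrite (_ : _ - _ = (d - d') * cos t - (a - a') * sin t)//; ring.
- by have := he 3; lra.
- by rewrite nth_nil subrr normr0 mulr_ge0.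
Qed.

(** For |v| <= u0 / 2 the inverse 1 / (u0 + v) is at most 2 / u0 and has Lipschitz constant 4 /
    u0^2; for z / (u0 + v) with |z| <= u0 this gives 2 / u0 + 4 / u0. *)
Definition pos_lip := 4 / u0 ^+ 2 + 6 / u0.

Lemma pos_lip_gt0 : 0 < pos_lip.
Proof. by rewrite addr_gt0 ?divr_gt0 ?exprn_gt0 ?bu_gt0. Qed.

Lemma pos_cmp (t v z v' z' k : R) : `|v| <= u0 / 2 -> `|v'| <= u0 / 2 -> `|z'| <= u0 ->
  `|v - v'| <= k -> `|z - z'| <= k ->
  [/\ `|pos1 t v - pos1 t v'| <= pos_lip * k, `|pos2 t v - pos2 t v'| <= pos_lip * k &
      `|pos3 v z - pos3 v' z'| <= pos_lip * k].
Proof.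
move=> hv hv' hz' hk hz; have u00 := bu_gt0 b.
have k0 : 0 <= k by apply: le_trans hk.
have [U U'] : u0 / 2 <= u0 + v /\ u0 / 2 <= u0 + v'.
  by move/ler_normlP: hv => [? ?]; move/ler_normlP: hv' => [? ?]; split; lra.
have U0 : 0 < u0 + v by lra.
have U'0 : 0 < u0 + v' by lra.
have inv_le x : u0 / 2 <= x -> x^-1 <= 2 / u0.
  move=> hx; have x0 : 0 < x by lra.
  by rewrite -[leRHS]invf_div lef_pV2 ?posrE// divr_gt0.
have dinv : `|(u0 + v)^-1 - (u0 + v')^-1| <= 4 / u0 ^+ 2 * k.
  rewrite (_ : _ - _ = (v' - v) * ((u0 + v)^-1 * (u0 + v')^-1)); last first.
    by field; rewrite !gt_eqF.
  rewrite normrM mulrC distrC ler_pM// normrM !gtr0_norm ?invr_gt0//.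
  rewrite (_ : 4 / u0 ^+ 2 = 2 / u0 * (2 / u0)); last by field; rewrite gt_eqF.
  by rewrite ler_pM ?inv_le// invr_ge0 ltW.
have u6 : 0 <= 6 / u0 * k by rewrite mulr_ge0// divr_ge0// ltW.
have sm (a : R) : `|a| <= 1 -> `|a / (u0 + v) - a / (u0 + v')| <= pos_lip * k.
  move=> a1; rewrite -mulrBr normrM.
  have : `|a| * `|(u0 + v)^-1 - (u0 + v')^-1| <= 1 * (4 / u0 ^+ 2 * k) by rewrite ler_pM.
  by rewrite /pos_lip mulrDl; lra.
split; [exact/sm/cos_norm_le1|exact/sm/sin_norm_le1|].
rewrite /pos3 (_ : _ - _ = (z - z') / (u0 + v) + z' * ((u0 + v)^-1 - (u0 + v')^-1)); last by ring.
rewrite (le_trans (ler_normD _ _))// !normrM.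
have h1 : `|z - z'| * `|(u0 + v)^-1| <= k * (2 / u0).
  by rewrite ler_pM// gtr0_norm ?invr_gt0// inv_le.
have h2 : `|z'| * `|(u0 + v)^-1 - (u0 + v')^-1| <= u0 * (4 / u0 ^+ 2 * k) by rewrite ler_pM.
have e : u0 * (4 / u0 ^+ 2 * k) = 4 / u0 * k by field; rewrite gt_eqF.
have u2 : 0 <= 4 / u0 ^+ 2 * k by rewrite mulr_ge0// divr_ge0// exprn_ge0 ?ltW.
rewrite /pos_lip mulrDl; rewrite e in h2.
have : 6 / u0 * k = k * (2 / u0) + 4 / u0 * k by field; rewrite gt_eqF.
by lra.
Qed.

Lemma pos_near (t v z k : R) : `|v| <= u0 / 2 -> `|v| <= k -> `|z| <= k ->
  near_circle t (pos_lip * k) (pos1 t v) (pos2 t v) (pos3 v z).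
Proof.
move=> v2 vk zk; have u00 := bu_gt0 b.
have h0 : `|0 : R| <= u0 / 2 by rewrite normr0 divr_ge0// ltW.
have h1 : `|0 : R| <= u0 by rewrite normr0 ltW.
have [] := @pos_cmp t v z 0 0 k v2 h0 h1; rewrite ?subr0//.
by rewrite /pos1 /pos2 /pos3 !addr0 mul0r subr0 => *; split; rewrite // [rad * _]mulrC.
Qed.

Lemma force_cmp (B rho : R) P (eps t v z v' z' k : R) : pert B rho P ->
  0 <= B ->
  `|v| <= u0 / 2 -> `|v'| <= u0 / 2 -> `|z'| <= u0 ->
  pos_lip * `|v| <= rho -> pos_lip * `|z| <= rho ->
  pos_lip * `|v'| <= rho -> pos_lip * `|z'| <= rho ->
  `|v - v'| <= k -> `|z - z'| <= k ->
  (forall j, `|force_at eps P t v z j| <= `|eps| * B) /\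
  forall j, `|force_at eps P t v z j - force_at eps P t v' z' j| <= `|eps| * (B * (pos_lip * k)).
Proof.
move=> Pp B0 hv hv' hz' a1 a2 a3 a4 hk hz.
have pl := pos_lip_gt0.
have near w y : `|w| <= u0 / 2 -> pos_lip * `|w| <= rho -> pos_lip * `|y| <= rho ->
    near_circle t rho (pos1 t w) (pos2 t w) (pos3 w y).
  move=> w2 wr yr; have := @pos_near t w y (rho / pos_lip) w2.
  by rewrite (mulrC pos_lip (rho / _)) divfK ?gt_eqF//; apply; rewrite ler_pdivlMr// mulrC.
have n1 := near v z hv a1 a2; have n2 := near v' z' hv' a3 a4.
have [p1 p2 p3] := pos_cmp t hv hv' hz' hk hz.
have [_ H _] := Pp _ _ _ _ _ _ _ _ n1 n2 p1 p2 p3.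
have [H' _ _] := Pp _ _ _ _ _ _ _ 0 n1 n1 ltac:(by rewrite subrr normr0)
   ltac:(by rewrite subrr normr0) ltac:(by rewrite subrr normr0).
split=> j; first by rewrite normrM ler_wpM2l.
by rewrite /force_at -mulrBr normrM ler_wpM2l.
Qed.

End Perturbation.

(** * The linear problem with multipliers, and Lipschitz dependence on the potential *)

Section AuxiliaryProblem.
Variables (R : realType) (b : base R).
Local Notation u0 := (bu b).
Local Notation tpi := (pi *+ 2 : R).

Record orbit := Orbit { ov : R -> R; ov1 : R -> R; oz : R -> R; oz1 : R -> R; ol1 : R; ol2 : R }.

Definition osub (o o' : orbit) := Orbit (fun t => ov o t - ov o' t) (fun t => ov1 o t - ov1 o' t)
  (fun t => oz o t - oz o' t) (fun t => oz1 o t - oz1 o' t) (ol1 o - ol1 o') (ol2 o - ol2 o').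

Definition obounded (k : R) (o : orbit) :=
  [/\ forall t, [/\ `|ov o t| <= k, `|ov1 o t| <= k, `|oz o t| <= k & `|oz1 o t| <= k],
      `|ol1 o| <= k & `|ol2 o| <= k].

(** The two conditions at 0 remove the kernel spanned by cos and sin, and the two multipliers absorb
    the resonant part of [g]; [lin_sub] and [lin_bound] then make the solution unique. *)
Record lin (f g : R -> R) (o : orbit) : Prop := Lin {
  lin_v : forall t, der (ov o) t (ov1 o t);
  lin_v1 : forall t, der (ov1 o) t (- bk b ^+ 2 * ov o t + f t);
  lin_z : forall t, der (oz o) t (oz1 o t);
  lin_z1 : forall t, der (oz1 o) t (- oz o t + (g t + bk0 b * (ol1 o * cos t + ol2 o * sin t)));
  lin_z0 : oz o 0 = 0; lin_z10 : oz1 o 0 = 0;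
  lin_vp : forall t, ov o (t + tpi) = ov o t; lin_v1p : forall t, ov1 o (t + tpi) = ov1 o t;
  lin_zp : forall t, oz o (t + tpi) = oz o t; lin_z1p : forall t, oz1 o (t + tpi) = oz1 o t }.

Lemma bk0_gt0 : 0 < bk0 b.
Proof. by rewrite invr_gt0 mulr_gt0 ?exprn_gt0 ?bl_gt0 ?bu_gt0. Qed.

Lemma lin_exists (f g : R -> R) : continuous f -> continuous g ->
  (forall t, f (t + tpi) = f t) -> (forall t, g (t + tpi) = g t) -> exists o, lin f g o.
Proof.
move=> cf cg fp gp.
have [v [v1 [h1 h2 h3 h4]]] := oscillator_exists (bk_itv b) cf fp.
have [z [z1 [l1 [l2 [h5 h6 [h7 h8] h9 h10]]]]] := tilt_exists bk0_gt0 cg gp.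
by exists (Orbit v v1 z z1 l1 l2).
Qed.

Lemma lin_sub f g f' g' o o' : lin f g o -> lin f' g' o' ->
  lin (fun t => f t - f' t) (fun t => g t - g' t) (osub o o').
Proof.
case=> a1 a2 a3 a4 a5 a6 a7 a8 a9 a10; case=> b1 b2 b3 b4 b5 b6 b7 b8 b9 b10.
split=> [t|t|t|t||||||] /=.
- exact: derB.
- by apply: der_val (derB (a2 t) (b2 t)) _; ring.
- exact: derB.
- by apply: der_val (derB (a4 t) (b4 t)) _; ring.
- by rewrite a5 b5 subrr.
- by rewrite a6 b6 subrr.
- by move=> t; rewrite a7 b7.
- by move=> t; rewrite a8 b8.
- by move=> t; rewrite a9 b9.
- by move=> t; rewrite a10 b10.
Qed.

Lemma lin_bound : exists2 K : R, 0 < K & forall f g o (k : R), lin f g o ->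
  (forall t, `|f t| <= k) -> (forall t, `|g t| <= k) -> obounded (K * k) o.
Proof.
have [K K0 HK] := oscillator_bound (bk_itv b).
have [L L0 HL] := tilt_bound bk0_gt0.
exists (K + L); first exact: addr_gt0.
move=> f g o k [a1 a2 a3 a4 a5 a6 a7 a8 a9 a10] fk gk.
have k0 : 0 <= k by apply: le_trans (fk 0).
have Kk : 0 <= K * k by rewrite mulr_ge0// ltW.
have Lk : 0 <= L * k by rewrite mulr_ge0// ltW.
have [l1 l2 zz] := HL _ _ _ _ _ _ a3 a4 a5 a6 a9 a10 gk.
rewrite mulrDl; split; [|lra|lra] => t.
have [v1 v2] := HK _ _ _ _ a1 a2 a7 a8 fk t; have [z1 z2] := zz t.
by split; lra.
Qed.

(** The bound for [g] = 0 forces the inclination and both multipliers to vanish. This is how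
    symmetry disposes of them in the plane. *)
Lemma lin_flat f g o : lin f g o -> (forall t, g t = 0) ->
  [/\ forall t, oz o t = 0, forall t, oz1 o t = 0, ol1 o = 0 & ol2 o = 0].
Proof.
have [L L0 HL] := tilt_bound bk0_gt0.
move=> [_ _ a3 a4 a5 a6 _ _ a9 a10] g0.
have [|l1 l2 zz] := HL _ _ _ _ _ 0 a3 a4 a5 a6 a9 a10; first by move=> t; rewrite g0 normr0.
move: l1 l2; rewrite mulr0 !normr_le0 => /eqP-> /eqP->; split=> // t.
  by have [] := zz t; rewrite mulr0 normr_le0 => /eqP.
by have [_] := zz t; rewrite mulr0 normr_le0 => /eqP.
Qed.

Definition ost eps P (o : orbit) t :=
  state b eps P t (ov o t) (ov1 o t) (oz o t) (oz1 o t) (ol1 o) (ol2 o).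

Definition is_orbit eps P k o :=
  lin (fun t => sG1 b (ost eps P o t)) (fun t => sG2 b (ost eps P o t)) o /\ obounded k o.

(** The key to the contraction: near the circle the remainders have an arbitrarily small Lipschitz
    constant [d] in the unknowns and a fixed one [C] in the forces, because their differentials
    satisfy [depends4]. *)
Lemma forcing_lip : exists2 C : R, 0 <= C & forall d : R, 0 < d -> exists2 r : R, 0 < r &
  forall X Y (k ke : R), ball0 r X -> ball0 r Y -> 0 <= k -> 0 <= ke ->
  (forall i, (i < 6)%N -> `|X i - Y i| <= k) -> (forall i, (6 <= i)%N -> `|X i - Y i| <= ke) ->
  `|sG1 b X - sG1 b Y| <= d * k + C * ke /\ `|sG2 b X - sG2 b Y| <= d * k + C * ke.
Proof.
have split_lip G L : sdiff G 0 L -> depends4 L -> exists2 C : R, 0 <= C & forall d : R, 0 < d ->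
    exists2 r : R, 0 < r & forall X Y (k ke : R), ball0 r X -> ball0 r Y -> 0 <= k -> 0 <= ke ->
    (forall i, (i < 6)%N -> `|X i - Y i| <= k) -> (forall i, (6 <= i)%N -> `|X i - Y i| <= ke) ->
    `|G X - G Y : R| <= d * k + C * ke.
  move=> [_ [C C0 LC] HG] L4; exists (C + 1); first by rewrite addr_ge0.
  move=> d d0; have d'0 : 0 < Num.min d 1 by rewrite lt_min d0 ltr01.
  have [r r0 H] := HG _ d'0; exists r => // X Y k ke Xr Yr k0 ke0 lo hi.
  have XY : close (k + ke) X Y.
    move=> i; have [i6|i6] := ltnP i 6.
      by rewrite (le_trans (lo i i6))// lerDl.
    by rewrite (le_trans (hi i i6))// lerDr.
  have {}H := H _ _ _ Xr Yr XY.
  (* The differential does not notice the replacement of the first six coordinates, so its increment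
     is governed by [ke] alone. *)
  pose X' i := if (i < 6)%N then Y i else X i.
  have LX : L X = L X' by apply: L4.
  have X'Y : close ke X' Y.
    move=> i; rewrite /X'; case: ltnP => i6; first by rewrite subrr normr0.
    exact: hi.
  have {}LC := LC _ _ _ X'Y.
  have d1 : Num.min d 1 <= d by rewrite ge_min lexx.
  have d2 : Num.min d 1 <= 1 by rewrite ge_min lexx orbT.
  have h1 : Num.min d 1 * k <= d * k by rewrite ler_wpM2r.
  have h2 : Num.min d 1 * ke <= 1 * ke by rewrite ler_wpM2r.
  rewrite -(subrK (L X - L Y) (G X - G Y)) (le_trans (ler_normD _ _))//.
  by rewrite {2}LX; move: H; rewrite mulrDr; lra.
have [L1 s1 d1] := sdiff_G1 b; have [L2 s2 d2] := sdiff_G2 b.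
have [C1 C10 H1] := split_lip _ _ s1 d1; have [C2 C20 H2] := split_lip _ _ s2 d2.
exists (C1 + C2); first by rewrite addr_ge0.
move=> d d0; have [r1 r10 {}H1] := H1 d d0; have [r2 r20 {}H2] := H2 d d0.
exists (Num.min r1 r2); first by rewrite lt_min r10.
have m1 : Num.min r1 r2 <= r1 by rewrite ge_min lexx.
have m2 : Num.min r1 r2 <= r2 by rewrite ge_min lexx orbT.
move=> X Y k ke Xr Yr k0 ke0 lo hi.
have := H1 _ _ _ _ (ball0W m1 Xr) (ball0W m1 Yr) k0 ke0 lo hi.
have := H2 _ _ _ _ (ball0W m2 Xr) (ball0W m2 Yr) k0 ke0 lo hi.
have : 0 <= C1 * ke by rewrite mulr_ge0.
have : 0 <= C2 * ke by rewrite mulr_ge0.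
by rewrite [(C1 + C2) * _]mulrDl; split; lra.
Qed.

Lemma state0 eps t : state b eps (fun _ _ _ _ => 0) t 0 0 0 0 0 0 = fun=> 0.
Proof.
apply/funext => i; rewrite /state /force_at !(mulr0, mul0r, addr0, subr0).
do 10?[case: i => [|i] //]; by rewrite /= nth_nil.
Qed.

(* Smallness of an orbit under which all its points stay in the region where the
   perturbation is controlled. *)
Definition small (rho k : R) := [/\ 0 <= k, k <= u0 / 2 & pos_lip b * k <= rho].

Lemma smallW (rho k k' : R) : 0 <= k' -> k' <= k -> small rho k -> small rho k'.
Proof.
move=> k'0 kk' [_ h1 h2]; split=> //; first exact: le_trans kk' h1.
by rewrite (le_trans _ h2)// ler_wpM2l// ltW ?pos_lip_gt0.
Qed.

Lemma ost_cmp (B rho : R) P P' eps o o' t (k kk d : R) : pert b B rho P -> 0 <= B ->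
  small rho kk -> obounded kk o -> obounded kk o' -> obounded k (osub o o') ->
  (forall j x1 x2 x3, near_circle b t rho x1 x2 x3 -> `|P j x1 x2 x3 - P' j x1 x2 x3| <= d) ->
  (forall i, (i < 6)%N -> `|ost eps P o t i - ost eps P' o' t i| <= 2 * k) /\
  (forall i, (6 <= i)%N -> `|ost eps P o t i - ost eps P' o' t i| <=
     2 * (`|eps| * (B * (pos_lip b * k) + d))).
Proof.
move=> Pp B0 [kk0 kku kkr] [p1 p2 p3] [q1 q2 q3] [d1 d2 d3] PP.
have pl := pos_lip_gt0 b; have u00 := bu_gt0 b.
have [a1 a2 a3 a4] := p1 t; have [b1 b2 b3 b4] := q1 t; have [c1 c2 c3 c4] := d1 t.
have le_u x : x <= kk -> x <= u0 / 2 by move=> ?; lra.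
have le_r x : x <= kk -> pos_lip b * x <= rho.
  by move=> ?; rewrite (le_trans _ kkr)// ler_wpM2l// ltW.
have u1 : `|oz o' t| <= u0 by have := le_u _ b3; lra.
have [_ F] := force_cmp eps t Pp B0 (le_u _ a1) (le_u _ b1) u1 (le_r _ a1) (le_r _ a3)
  (le_r _ b1) (le_r _ b3) c1 c3.
apply: state_cmp => // j.
rewrite -(subrK (force_at b eps P t (ov o' t) (oz o' t) j) (force_at b eps P t (ov o t) (oz o t) j)).
rewrite -addrA (le_trans (ler_normD _ _))// mulrDr lerD// /force_at -mulrBr normrM ler_wpM2l//.
apply: PP; apply: near_circleW kkr _.
by apply: pos_near; [exact: le_u| |].
Qed.

Lemma ost_bound (B rho : R) P eps o t (kk : R) : pert b B rho P -> 0 <= B ->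
  small rho kk -> obounded kk o ->
  (forall i, (i < 6)%N -> `|ost eps P o t i| <= 2 * kk) /\
  (forall i, (6 <= i)%N -> `|ost eps P o t i| <= 2 * (`|eps| * B)).
Proof.
move=> Pp B0 [kk0 kku kkr] [p1 p2 p3].
have pl := pos_lip_gt0 b; have u00 := bu_gt0 b.
have [a1 a2 a3 a4] := p1 t.
have le_r x : x <= kk -> pos_lip b * x <= rho.
  by move=> ?; rewrite (le_trans _ kkr)// ler_wpM2l// ltW.
have u1 : `|oz o t| <= u0 by lra.
have u2 : `|ov o t| <= u0 / 2 by lra.
have z0 : `|ov o t - ov o t| <= 0 by rewrite subrr normr0.
have z1 : `|oz o t - oz o t| <= 0 by rewrite subrr normr0.
have [F _] := force_cmp eps t Pp B0 u2 u2 u1 (le_r _ a1) (le_r _ a3)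
  (le_r _ a1) (le_r _ a3) z0 z1.
(* Comparison with the zero orbit in the zero potential, whose state vanishes. *)
have := @state_cmp R b eps P (fun _ _ _ _ => 0) t (ov o t) (ov1 o t) (oz o t) (oz1 o t)
  (ol1 o) (ol2 o) 0 0 0 0 0 0 kk (`|eps| * B).
rewrite !subr0 state0 => /(_ a1 a2 a3 a4 p2 p3) [|h1 h2].
  by move=> j; rewrite [X in _ - X]mulr0 subr0.
by split=> i /[dup] i6; [move=> /h1|move=> /h2]; rewrite subr0.
Qed.

Lemma osub_bounded (k k' : R) o o' : obounded k o -> obounded k' o' -> obounded (k + k') (osub o o').
Proof.
move=> [h1 h2 h3] [g1 g2 g3].
have tri (x y : R) : `|x| <= k -> `|y| <= k' -> `|x - y| <= k + k'.
  by move=> *; rewrite (le_trans (ler_normB _ _))// lerD.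
split=> [t||]; [|exact: tri|exact: tri].
by have [? ? ? ?] := h1 t; have [? ? ? ?] := g1 t; split; apply: tri.
Qed.

Lemma obounded_self (e : R) o (B : R) : 0 <= e -> obounded B o ->
  (forall k : R, obounded k o -> obounded (k / 2 + e) o) -> obounded (2 * e) o.
Proof.
move=> e0 oB H.
(* All components at all times form one family of reals, to which [self_bound] applies. *)
pose D (p : R * nat) := nth 0 [:: ov o p.1; ov1 o p.1; oz o p.1; oz1 o p.1; ol1 o; ol2 o] p.2.
have DP k : 0 <= k -> obounded k o <-> (forall p, `|D p| <= k).
  move=> k0; split=> [[h1 h2 h3] [t i]|h].
    rewrite /D; have [? ? ? ?] := h1 t.
    do 6?[case: i => [|i] //]; by rewrite /= nth_nil normr0.
  by split=> [t||]; [split; [exact: (h (t, 0%N))|exact: (h (t, 1%N))|exact: (h (t, 2))|exact: (h (t, 3))]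
   |exact: (h (0, 4))|exact: (h (0, 5))].
have ge0 k p : `|D p| <= k -> 0 <= k by apply: le_trans.
have B0 : 0 <= B by case: oB => _ + _; apply: le_trans.
have e2 : 0 <= 2 * e by rewrite mulr_ge0.
apply/(DP _ e2); apply: (self_bound e0 (proj1 (DP B B0) oB)) => k Dk.
have k0 : 0 <= k by apply: ge0 (Dk (0, 0%N)).
have k2 : 0 <= k / 2 + e by rewrite addr_ge0// divr_ge0.
by apply/(DP _ k2); apply: H; apply/DP.
Qed.

(** The difference of two orbits solves the linear problem with the difference of their forcings; by
    [forcing_lip] this improves any bound k to k / 2 plus a multiple of eps d. For d = 0 it is the
    uniqueness of the orbit. *)
Lemma orbit_diff (B rho : R) : 0 <= B -> 0 < rho -> exists k0 e0 C : R, [/\ 0 < k0, 0 < e0, 0 <= C &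
  forall P P' eps o o' (d : R), pert b B rho P -> `|eps| <= e0 -> 0 <= d ->
   is_orbit eps P k0 o -> is_orbit eps P' k0 o' -> pert b B rho P' ->
  (forall j t x1 x2 x3, near_circle b t rho x1 x2 x3 -> `|P j x1 x2 x3 - P' j x1 x2 x3| <= d) ->
  obounded (C * (`|eps| * d)) (osub o o')].
Proof.
move=> B0 rho0.
have [K K0 HK] := lin_bound; have [C C0 HC] := forcing_lip.
have pl := pos_lip_gt0 b; have u00 := bu_gt0 b.
(* After the factor 2 of [state_cmp] and the factor [K] of the linear solver, the unknowns
   contribute k / 4; a small eps makes the forces contribute at most another k / 4. *)
have [|r r0 Hr] := HC (8 * K)^-1; first by rewrite invr_gt0 mulr_gt0.
pose k0 := Num.min (Num.min (u0 / 2) (rho / pos_lip b)) (r / 2).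
have k00 : 0 < k0 by rewrite !lt_min !divr_gt0.
have k0s : small rho k0.
  split; [exact: ltW|by rewrite !ge_min lexx|].
  by rewrite mulrC -ler_pdivlMr// !ge_min lexx orbT.
have k0r : 2 * k0 <= r by rewrite mulrC -ler_pdivlMr// !ge_min lexx orbT.
(* The bounds on eps in terms of [M] make the force part contract and keep all states in the ball of
   radius [r]; the 1 makes [M] positive. *)
pose M := 8 * K * C * (B * pos_lip b) + 2 * B + 1.
have KC : 0 <= 8 * K * C * (B * pos_lip b) by rewrite !mulr_ge0// ltW.
have M0 : 0 < M by rewrite /M; lra.
pose e0 := Num.min (M^-1) (r / M).
have e00 : 0 < e0 by rewrite lt_min invr_gt0 divr_gt0 ?M0.
exists k0, e0, (2 * (2 * K * C)); split=> //; first by rewrite !mulr_ge0// ltW.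
move=> P P' eps o o' d Pp epse d0 [l1 b1] [l2 b2] Pp' PP.
have epsM : `|eps| * M <= 1 by rewrite -ler_pdivlMr// div1r (le_trans epse)// ge_min lexx.
have epsM2 : `|eps| * M <= r by rewrite -ler_pdivlMr// (le_trans epse)// ge_min lexx orbT.
have MB : `|eps| * (2 * B) <= `|eps| * M by rewrite ler_wpM2l// /M; lra.
have MC : `|eps| * (8 * K * C * (B * pos_lip b)) <= `|eps| * M by rewrite ler_wpM2l// /M; lra.
have ed0 : 0 <= `|eps| * d by rewrite mulr_ge0.
have inball Q oo t : pert b B rho Q -> obounded k0 oo -> ball0 r (ost eps Q oo t).
  move=> Qp obb i; have [lo hi] := ost_bound eps t Qp B0 k0s obb.
  have [i6|i6] := ltnP i 6; first by rewrite (le_trans (lo i i6)).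
  by rewrite (le_trans (hi i i6))//; lra.
rewrite -mulrA; apply: (@obounded_self _ _ (k0 + k0)).
- by rewrite !mulr_ge0// ltW.
- exact: osub_bounded.
move=> k obk.
have kk0 : 0 <= k by case: obk => _ + _; apply: le_trans.
have lsub := lin_sub l1 l2; have kk2 : 0 <= 2 * k by rewrite mulr_ge0.
have bd t : `|sG1 b (ost eps P o t) - sG1 b (ost eps P' o' t)| <= (k / 2 + 2 * K * C * (`|eps| * d)) / K /\
   `|sG2 b (ost eps P o t) - sG2 b (ost eps P' o' t)| <= (k / 2 + 2 * K * C * (`|eps| * d)) / K.
  have [lo hi] := ost_cmp eps Pp B0 k0s b1 b2 obk (fun j => PP j t).
  have ke0 : 0 <= 2 * (`|eps| * (B * (pos_lip b * k) + d)).
    by rewrite !mulr_ge0// addr_ge0// !mulr_ge0// ltW.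
  have [h1 h2] := Hr _ _ _ _ (inball _ _ t Pp b1) (inball _ _ t Pp' b2)
    kk2 ke0 lo hi.
  have E : (8 * K)^-1 * (2 * k) + C * (2 * (`|eps| * (B * (pos_lip b * k) + d))) <=
      (k / 2 + 2 * K * C * (`|eps| * d)) / K.
    rewrite ler_pdivlMr//.
    have -> : ((8 * K)^-1 * (2 * k) + C * (2 * (`|eps| * (B * (pos_lip b * k) + d)))) * K =
       k / 4 + (`|eps| * (8 * K * C * (B * pos_lip b))) * k / 4 + 2 * K * C * (`|eps| * d).
      by field; rewrite gt_eqF.
    have : (`|eps| * (8 * K * C * (B * pos_lip b))) * k <= 1 * k by rewrite ler_wpM2r//; lra.
    by lra.
  by split; [apply: le_trans h1 E|apply: le_trans h2 E].
have := HK _ _ _ _ lsub (fun t => (bd t).1) (fun t => (bd t).2).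
by rewrite mulrC divfK ?gt_eqF.
Qed.

End AuxiliaryProblem.

(** * The fixed point that produces the orbit *)

Section OrbitExistence.
Variables (R : realType) (b : base R).
Local Notation u0 := (bu b).
Local Notation tpi := (pi *+ 2 : R).

Lemma continuous_seq (X : R -> nat -> R) n (G : (nat -> R) -> R) C r :
  (forall i, continuous (fun t => X t i)) -> (forall t i, (n <= i)%N -> X t i = 0) ->
  0 <= C -> (forall t, ball0 r (X t)) ->
  (forall Y Z k, ball0 r Y -> ball0 r Z -> close k Y Z -> `|G Y - G Z| <= C * k) ->
  continuous (fun t => G (X t)).
Proof.
move=> cX X0 C0 Xr GC t; apply/cvgrPdist_le => e e0.
have d0 : 0 < e / (C + 1) by rewrite divr_gt0// ltr_wpDl.
have H : \forall s \near t, forall i : 'I_n, `|X t i - X s i| <= e / (C + 1).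
  apply: (@filter_forall _ _ (fun (i : 'I_n) s => `|X t i - X s i| <= e / (C + 1)) _ (nbhs_filter t)) => i.
  by have /cvgrPdist_le/(_ _ d0) := cX i t.
near=> s.
have cl : close (e / (C + 1)) (X t) (X s).
  move=> i; have [i_n|i_n] := ltnP i n; last by rewrite !X0// subrr normr0 ltW.
  have Hs : forall i : 'I_n, `|X t i - X s i| <= e / (C + 1) by near: s; exact: H.
  exact: (Hs (Ordinal i_n)).
apply: le_trans (GC _ _ _ (Xr t) (Xr s) cl) _.
rewrite mulrCA ger_pMr// ler_pdivrMr ?mul1r ?lerDl// ltr_wpDl//.
Unshelve. all: by end_near. Qed.

(** [pert] controls the potential only near the point of the circle at the same angle. An orbit
    within rho / 2 leaves room for the positions at nearby angles, still within rho of the point at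
    angle [t]. *)
Lemma force_continuous (B rho eps : R) P (v z : R -> R) (k : R) j : pert b B rho P -> 0 <= B ->
  0 < rho -> small b (rho / 2) k ->
  (forall t, exists a, der v t a) -> (forall t, exists a, der z t a) ->
  (forall t, `|v t| <= k) -> (forall t, `|z t| <= k) ->
  continuous (fun t => force_at b eps P t (v t) (z t) j).
Proof.
move=> Pp B0 rho0 [k0 ku kr] dv dz vk zk.
have u00 := bu_gt0 b.
have vu t : `|v t| <= u0 / 2 by rewrite (le_trans (vk t)).
have U0 t : u0 + v t != 0.
  by rewrite gt_eqF//; have /ler_normlP[] := vu t; lra.
have cinv : continuous (fun t => (u0 + v t)^-1).
  apply: der_continuous => t; have [a va] := dv t; eexists.
  exact: (@derV _ (fun t => u0 + v t) _ _ (U0 t) (derD (derC u0 t) va)).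
have c1 : continuous (fun t => pos1 b t (v t)).
  move=> t; apply: (@continuousM _ _ (@cos R)); [exact: continuous_cos|exact: cinv].
have c2 : continuous (fun t => pos2 b t (v t)).
  move=> t; apply: (@continuousM _ _ (@sin R)); [exact: continuous_sin|exact: cinv].
have c3 : continuous (fun t => pos3 b (v t) (z t)).
  by move=> t; apply: (@continuousM _ _ z); [exact: der_continuous|exact: cinv].
move=> t; apply/cvgrPdist_le => e e0.
pose M := `|eps| * B + 1.
have M0 : 0 < M by rewrite ltr_wpDl// mulr_ge0.
pose d := Num.min (rho / 2) (e / M).
have d0 : 0 < d by rewrite lt_min !divr_gt0.
have /cvgrPdist_le/(_ _ d0) H1 := c1 t.
have /cvgrPdist_le/(_ _ d0) H2 := c2 t.
have /cvgrPdist_le/(_ _ d0) H3 := c3 t.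
near=> s.
have E1 : `|pos1 b t (v t) - pos1 b s (v s)| <= d by near: s; exact: H1.
have E2 : `|pos2 b t (v t) - pos2 b s (v s)| <= d by near: s; exact: H2.
have E3 : `|pos3 b (v t) (z t) - pos3 b (v s) (z s)| <= d by near: s; exact: H3.
have dr : d <= rho / 2 by rewrite ge_min lexx.
have n1 : near_circle b t (rho / 2) (pos1 b t (v t)) (pos2 b t (v t)) (pos3 b (v t) (z t)).
  by apply: near_circleW kr _; apply: pos_near.
have n2 : near_circle b t rho (pos1 b s (v s)) (pos2 b s (v s)) (pos3 b (v s) (z s)).
  have tri (x y w : R) : `|y - x| <= d -> `|y - w| <= rho / 2 -> `|x - w| <= rho.
    rewrite distrC => xy yw; rewrite -(subrK y x) -addrA (le_trans (ler_normD _ _))//.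
    by lra.
  case: n1 => h1 h2 h3; split; [exact: tri E1 h1|exact: tri E2 h2|].
  by rewrite -[pos3 _ _ _]subr0; apply: tri E3 _; rewrite subr0.
have n1' := near_circleW (_ : rho / 2 <= rho) n1.
have [_ F _] := Pp _ _ _ _ _ _ _ _ (n1' ltac:(lra)) n2 E1 E2 E3.
rewrite /force_at -mulrBr normrM (le_trans (ler_wpM2l (normr_ge0 _) (F j)))//.
have dM : d * M <= e by rewrite -ler_pdivlMr// ge_min lexx orbT.
have : 0 <= d by exact: ltW.
by move: dM; rewrite /M; lra.
Unshelve. all: by end_near. Qed.

Lemma sdiff_lip_ball (G : (nat -> R) -> R) v L : sdiff G v L -> exists C r : R, [/\ 0 <= C, 0 < r &
  forall r' : R, r' <= r -> forall X Y (k : R), ball0 r' X -> ball0 r' Y ->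
    close k X Y -> `|G X - G Y| <= C * k].
Proof.
move=> /sdiff_lip[C [r [C0 r0 H]]]; exists C, r; split=> // r' rr' X Y k Xr Yr.
by apply: H; exact: ball0W Xr || exact: ball0W Yr.
Qed.

Lemma ost_continuous (B rho eps : R) P (k : R) o i : pert b B rho P -> 0 <= B ->
  0 < rho -> small b (rho / 2) k -> obounded k o ->
  (forall t, exists a, der (ov o) t a) -> (forall t, exists a, der (ov1 o) t a) ->
  (forall t, exists a, der (oz o) t a) -> (forall t, exists a, der (oz1 o) t a) ->
  continuous (fun t => ost b eps P o t i).
Proof.
move=> Pp B0 rho0 sk [ok _ _] dv dv1 dz dz1.
have vk t : `|ov o t| <= k by have [] := ok t.
have zk t : `|oz o t| <= k by have [] := ok t.
have cF j : continuous (fun t => force_at b eps P t (ov o t) (oz o t) j).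
  exact: (force_continuous Pp B0 rho0 sk dv dz vk zk).
have cc : continuous (@cos R) by exact: continuous_cos.
have cs : continuous (@sin R) by exact: continuous_sin.
have cD (f g : R -> R) : continuous f -> continuous g -> continuous (fun t => f t + g t).
  by move=> cf cg t; apply: (@continuousD _ _ _ f g); [exact: cf|exact: cg].
have cB (f g : R -> R) : continuous f -> continuous g -> continuous (fun t => f t - g t).
  by move=> cf cg t; apply: (@continuousB _ _ _ f g); [exact: cf|exact: cg].
have cM (f g : R -> R) : continuous f -> continuous g -> continuous (fun t => f t * g t).
  by move=> cf cg t; apply: (@continuousM _ _ f g); [exact: cf|exact: cg].
have cst (a : R) : continuous (fun _ : R => a) by move=> t; exact: cvg_cst.
rewrite /ost /state.
case: i => [|[|[|[|[|[|[|[|[|[|i]]]]]]]]]] /=; try exact: der_continuous.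
- by apply: cD; apply: cM.
- by apply: cB; apply: cM.
- exact: cF.
- by apply: cD; apply: cM => //; exact: cF.
- by apply: cB; apply: cM => //; exact: cF.
- exact: cF.
- rewrite (_ : (fun t => _) = fun=> 0); first exact: cst.
  by apply/funext => t; rewrite nth_nil.
Qed.

Lemma sG2_flat X : X 2 = 0 -> X 3 = 0 -> X 4 = 0 -> X 5 = 0 -> X 9 = 0 -> sG2 b X = 0.
Proof.
move=> X2 X3 X4 X5 X9; rewrite /sG2 /sFz X2 X3 X4 X5 X9.
by rewrite !(mul0r, mulr0, addr0, subr0, oppr0, add0r).
Qed.

(** The iteration acts on pairs of forcings: solve the linear problem, then evaluate the remainders
    along the solution. On forcings, continuity and periodicity pass to uniform limits, whereas
    differentiability of orbits is recovered from the solver. *)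
Lemma orbit_exists (B rho : R) : 0 <= B -> 0 < rho -> exists e0 C : R, [/\ 0 < e0, 0 <= C &
  forall P eps, pert b B rho P -> `|eps| <= e0 ->
  exists2 o, is_orbit b eps P (C * `|eps|) o &
    (forall x1 x2 x3, P 3 x1 x2 x3 = 0) ->
      [/\ forall t, oz o t = 0, forall t, oz1 o t = 0, ol1 o = 0 & ol2 o = 0]].
Proof.
move=> B0 rho0.
have [K K0 HK] := lin_bound b; have [C C0 HC] := forcing_lip b.
have pl := pos_lip_gt0 b; have u00 := bu_gt0 b.
have [|r r0 Hr] := HC (8 * K)^-1; first by rewrite invr_gt0 mulr_gt0.
have [L1 s1 _] := sdiff_G1 b; have [L2 s2 _] := sdiff_G2 b.
have G10 : sG1 b (fun=> 0) = 0 by case: s1.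
have G20 : sG2 b (fun=> 0) = 0 by case: s2.
have [Cx1 [r1 [Cx10 r10 H1]]] := sdiff_lip_ball s1.
have [Cx2 [r2 [Cx20 r20 H2]]] := sdiff_lip_ball s2.
pose rm := Num.min r (Num.min r1 r2).
have rm0 : 0 < rm by rewrite !lt_min r0 r10.
have rmr : rm <= r by rewrite ge_min lexx.
have rmr1 : rm <= r1 by rewrite !ge_min lexx orbT.
have rmr2 : rm <= r2 by rewrite !ge_min lexx !orbT.
pose k0 := Num.min (Num.min (u0 / 2) (rho / 2 / pos_lip b)) (rm / 2).
have k00 : 0 < k0 by rewrite !lt_min !divr_gt0.
have k0s : small b (rho / 2) k0.
  split; [exact: ltW|by rewrite !ge_min lexx|].
  by rewrite mulrC -ler_pdivlMr// !ge_min lexx orbT.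
have k0r : 2 * k0 <= rm by rewrite mulrC -ler_pdivlMr// !ge_min lexx orbT.
pose M := 8 * K * C * (B * pos_lip b) + 2 * B + 4 * K * C * B + 1.
have KC : 0 <= 8 * K * C * (B * pos_lip b) by rewrite !mulr_ge0// ltW.
have KC' : 0 <= 4 * K * C * B by rewrite !mulr_ge0// ltW.
have M0 : 0 < M by rewrite /M; lra.
pose e0 := Num.min (M^-1) (Num.min (rm / M) (k0 / M)).
have e00 : 0 < e0 by rewrite !lt_min invr_gt0 !divr_gt0 ?M0.
exists e0, (4 * K * C * B); split=> //.
move=> P eps Pp epse.
have epsM : `|eps| * M <= 1 by rewrite -ler_pdivlMr// div1r (le_trans epse)// ge_min lexx.
have epsM2 : `|eps| * M <= rm.
  by rewrite -ler_pdivlMr// (le_trans epse)// !ge_min lexx orbT.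
have epsM3 : `|eps| * M <= k0.
  by rewrite -ler_pdivlMr// (le_trans epse)// !ge_min lexx !orbT.
have MB : `|eps| * (2 * B) <= `|eps| * M by rewrite ler_wpM2l// /M; lra.
have MC : `|eps| * (8 * K * C * (B * pos_lip b)) <= `|eps| * M by rewrite ler_wpM2l// /M; lra.
have MK : `|eps| * (4 * K * C * B) <= `|eps| * M by rewrite ler_wpM2l// /M; lra.
(* Radius of the ball of forcings: with zero forcing the state has only force components, at most
   [2 * (|eps| * B)], so the first iterate is at most [rr / 2]. *)
pose rr := 4 * C * B * `|eps|.
have rr0 : 0 <= rr by rewrite !mulr_ge0.
have Krr : K * rr <= k0 by rewrite (_ : K * rr = `|eps| * (4 * K * C * B)) ?/rr; [lra|ring].
have Krr0 : 0 <= K * rr by rewrite mulr_ge0// ltW.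
have sK : small b (rho / 2) (K * rr) by apply: smallW Krr0 Krr k0s.
have sK' : small b rho (K * rr).
  by case: sK => h1 h2 h3; split=> //; lra.
pose flat := forall x1 x2 x3, P 3 x1 x2 x3 = 0.
pose f (Y : bool * R -> R) t := Y (true, t); pose g (Y : bool * R -> R) t := Y (false, t).
(* The last clause carries the planar symmetry through the iteration to the fixed point. *)
pose adm Y := [/\ continuous (f Y), continuous (g Y),
  forall t, f Y (t + tpi) = f Y t, forall t, g Y (t + tpi) = g Y t & flat -> forall t, g Y t = 0].
(* The linear solver as a function of the forcing; outside [adm] its value is arbitrary. *)
have /choice[op Hop] : forall Y, exists o, adm Y -> lin b (f Y) (g Y) o.
  move=> Y; have [[a1 a2 a3 a4 _]|nY] := pselect (adm Y).
    have [w lw] := lin_exists b a1 a2 a3 a4.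
    by exists w.
  by exists (Orbit (fun=> 0) (fun=> 0) (fun=> 0) (fun=> 0) 0 0).
pose T Y (p : bool * R) := if p.1 then sG1 b (ost b eps P (op Y) p.2)
   else sG2 b (ost b eps P (op Y) p.2).
have opb Y : adm Y -> (forall p, `|Y p| <= rr) -> obounded (K * rr) (op Y).
  by move=> aY Yr; apply: HK (Hop _ aY) _ _ => t; apply: Yr.
have inball Y t : adm Y -> (forall p, `|Y p| <= rr) -> ball0 rm (ost b eps P (op Y) t).
  move=> aY Yr i; have [lo hi] := ost_bound eps t Pp B0 sK' (opb _ aY Yr).
  have [i6|i6] := ltnP i 6; first by rewrite (le_trans (lo i i6)) //; lra.
  by rewrite (le_trans (hi i i6))//; lra.
have a0 : adm (fun=> 0).
  by split=> // t; exact: cvg_cst.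
have [| | | | |Y [aY Yr YT]] := @fixed_point R (bool * R) adm T rr rr0.
- move=> Y H.
  have lim_cont h : (forall Z, adm Z -> continuous (fun t => Z (h, t))) ->
      continuous (fun t => Y (h, t)).
    move=> ch t; apply/cvgrPdist_le => e e0'.
    have [|Z aZ ZY] := H (e / 3); first by rewrite divr_gt0.
    have e3 : 0 < e / 3 by rewrite divr_gt0.
    have /cvgrPdist_le/(_ _ e3) HZ := ch Z aZ t.
    near=> s.
    have Hs : `|Z (h, t) - Z (h, s)| <= e / 3 by near: s; exact: HZ.
    have hs := ZY (h, s); have := ZY (h, t); rewrite distrC => ht.
    rewrite (_ : _ - _ = (Y (h, t) - Z (h, t)) + (Z (h, t) - Z (h, s)) + (Z (h, s) - Y (h, s))); last by ring.
    rewrite (le_trans (ler_normD _ _))// (le_trans (lerD (ler_normD _ _) (lexx _)))//.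
    by lra.
  have lim_eq p q : (forall Z, adm Z -> Z p = Z q) -> Y p = Y q.
    move=> pq; apply/eqP; rewrite -subr_eq0 -normr_le0; apply/ler_addgt0Pr => e e0'.
    have [|Z aZ ZY] := H (e / 2); first by rewrite divr_gt0.
    rewrite add0r (_ : _ - _ = (Z q - Y q) - (Z p - Y p)); last by rewrite (pq _ aZ); ring.
    by rewrite (le_trans (ler_normB _ _))//; have := ZY q; have := ZY p; lra.
  split; [by apply: lim_cont => Z []|by apply: lim_cont => Z []
         |by move=> t; apply: lim_eq => Z [_ _ per _ _]; exact: per
         |by move=> t; apply: lim_eq => Z [_ _ _ per _]; exact: per|].
  move=> fl t; apply/eqP; rewrite -normr_le0; apply/ler_addgt0Pr => e e0'.
  have [Z [_ _ _ _ Zfl] ZY] := H e e0'.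
  by have := ZY (false, t); rewrite [Z _](Zfl fl) sub0r normrN add0r.
- exact: a0.
- move=> Y aY Yr; have lY := Hop _ aY.
  have dv t : exists a, der (ov (op Y)) t a by eexists; exact: (lin_v lY).
  have dv1 t : exists a, der (ov1 (op Y)) t a by eexists; exact: (lin_v1 lY).
  have dz t : exists a, der (oz (op Y)) t a by eexists; exact: (lin_z lY).
  have dz1 t : exists a, der (oz1 (op Y)) t a by eexists; exact: (lin_z1 lY).
  have co i : continuous (fun t => ost b eps P (op Y) t i).
    exact: (ost_continuous Pp B0 rho0 sK (opb _ aY Yr) dv dv1 dz dz1).
  have big t i : (10 <= i)%N -> ost b eps P (op Y) t i = 0.
    by move=> i10; rewrite /ost /state nth_default.
  have per t : ost b eps P (op Y) (t + tpi) = ost b eps P (op Y) t.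
    rewrite /ost /state /force_at /pos1 /pos2 (lin_vp lY) (lin_v1p lY) (lin_zp lY) (lin_z1p lY).
    by rewrite cosD2pi sinD2pi.
  split.
  + exact: (continuous_seq co big Cx10 (fun t => inball _ t aY Yr) (H1 _ rmr1)).
  + exact: (continuous_seq co big Cx20 (fun t => inball _ t aY Yr) (H2 _ rmr2)).
  + by move=> t; rewrite /f /T /= per.
  + by move=> t; rewrite /g /T /= per.
  + move=> fl t; rewrite /g /T /=.
    have [g1 g2 g3 g4] := lin_flat lY (let: And5 _ _ _ _ hfl := aY in hfl fl).
    by apply: sG2_flat; rewrite /ost /state /= ?g1 ?g2 ?g3 ?g4 /force_at ?fl ?mul0r ?mulr0 ?addr0 ?subr0.
- case=> [h t].
  have lY := Hop _ a0.
  have ob0 : obounded 0 (op (fun=> 0)).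
    by have := HK _ _ _ 0 lY; rewrite mulr0; apply=> s; rewrite /f /g normr0.
  have s0 : small b rho 0.
    by split=> //; [rewrite divr_ge0// ltW|rewrite mulr0 ltW].
  have [lo hi] := ost_bound eps t Pp B0 s0 ob0.
  have eB : 0 <= 2 * (`|eps| * B) by rewrite !mulr_ge0.
  have b00 : ball0 r (fun=> 0) by move=> i; rewrite normr0 ltW.
  have r0b : forall p : bool * R, `|0 : R| <= rr by move=> _; rewrite normr0.
  have inb := ball0W rmr (inball _ t a0 r0b).
  have [||h1 h2] := Hr _ _ _ _ inb b00 (lexx 0) eB.
  + by move=> i /lo; rewrite subr0 mulr0.
  + by move=> i /hi; rewrite subr0.
  move: h1 h2; rewrite G10 G20 !subr0 mulr0 add0r.
  have -> : C * (2 * (`|eps| * B)) = rr / 2 by rewrite /rr; field.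
  by rewrite /T; case: h.
- move=> Y Z k aY aZ Yr Zr YZ [h t].
  have kk0 : 0 <= k by apply: le_trans (YZ (true, 0)).
  have obs : obounded (K * k) (osub (op Y) (op Z)).
    by apply: HK (lin_sub (Hop _ aY) (Hop _ aZ)) _ _ => s; apply: YZ.
  have Kk0 : 0 <= K * k by rewrite mulr_ge0// ltW.
  have [|lo hi] := @ost_cmp R b B rho P P eps _ _ t _ _ 0 Pp B0 sK' (opb _ aY Yr) (opb _ aZ Zr) obs.
    by move=> *; rewrite subrr normr0.
  have [||h1 h2] := Hr _ _ _ _ (ball0W rmr (inball _ t aY Yr)) (ball0W rmr (inball _ t aZ Zr)) _ _ lo hi.
  + by rewrite mulr_ge0.
  + by rewrite !mulr_ge0// addr_ge0// !mulr_ge0// ltW.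
  have E : (8 * K)^-1 * (2 * (K * k)) + C * (2 * (`|eps| * (B * (pos_lip b * (K * k)) + 0))) <= k / 2.
    have -> : (8 * K)^-1 * (2 * (K * k)) + C * (2 * (`|eps| * (B * (pos_lip b * (K * k)) + 0))) =
       k / 4 + (`|eps| * (8 * K * C * (B * pos_lip b))) * k / 4 by field; rewrite gt_eqF.
    have : (`|eps| * (8 * K * C * (B * pos_lip b))) * k <= 1 * k by rewrite ler_wpM2r//; lra.
    by lra.
  by rewrite /T; case: h => /=; [apply: le_trans h1 E|apply: le_trans h2 E].
have lY := Hop _ aY.
exists (op Y); last by move=> fl; apply: (lin_flat lY); case: aY => _ _ _ _; apply.
split; last by rewrite (_ : _ * _ = K * rr); [exact: opb|rewrite /rr; ring].
have -> : (fun t => sG1 b (ost b eps P (op Y) t)) = f Y.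
  by apply/funext => t; rewrite -[RHS]YT.
have -> : (fun t => sG2 b (ost b eps P (op Y) t)) = g Y.
  by apply/funext => t; rewrite -[RHS]YT.
exact: lY.
Unshelve. all: by end_near. Qed.

End OrbitExistence.

(** * From the orbit to the motion in time *)

Section Motion.
Variables (R : realType) (b : base R).
Local Notation u0 := (bu b).
Local Notation c := (bc b).
Local Notation m := (bm b).
Local Notation al := (bal b).
Local Notation h := (bh b).
Local Notation tpi := (pi *+ 2 : R).

Lemma der_quad (f : R -> R) (t d C : R) : 0 < d ->
  (forall s, `|s - t| <= d -> `|f s - f t| <= C * (s - t) ^+ 2) -> der f t 0.
Proof.
move=> d0 H; apply/is_derive1_caratheodory.
have C0 : 0 <= C.
  have := H (t + d); rewrite addrC addKr gtr0_norm// => /(_ (lexx _)).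
  by move=> /(le_trans (normr_ge0 _)); rewrite pmulr_lge0// exprn_gt0.
exists (fun s => (f s - f t) / (s - t)); split; last by rewrite !subrr mul0r.
  move=> z; have [->|zt] := eqVneq z t; first by rewrite !subrr mulr0.
  by rewrite divfK// subr_eq0.
apply/cvgrPdist_le => e e0.
have d'0 : 0 < Num.min d (e / (C + 1)).
  by rewrite lt_min d0 divr_gt0// ltr_wpDl.
near=> s.
have st : `|t - s| <= Num.min d (e / (C + 1)).
  near: s; have /cvgrPdist_le := @cvg_id _ (nbhs t); exact.
rewrite /= subrr mul0r sub0r normrN.
have [->|nst] := eqVneq s t; first by rewrite subrr mul0r normr0 ltW.
have pos : 0 < `|s - t| by rewrite normr_gt0 subr_eq0.
rewrite normrM normfV ler_pdivrMr//.
have st1 : `|s - t| <= d by rewrite distrC (le_trans st)// ge_min lexx.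
have st2 : `|s - t| <= e / (C + 1) by rewrite distrC (le_trans st)// ge_min lexx orbT.
apply: (le_trans (H s st1)).
rewrite -(real_normK (num_real _)) expr2 mulrA ler_wpM2r//.
rewrite (le_trans (ler_wpM2l C0 st2))// mulrCA ger_pMr// ler_pdivrMr ?mul1r ?lerDl//.
by rewrite ltr_wpDl.
Unshelve. all: by end_near. Qed.

(** [P] is known only through the estimates of [pert]. Along a Lipschitz curve the Taylor remainder
    is quadratic in time, so it has derivative zero and the chain rule follows. *)
Lemma pert_chain (B rho L : R) P t (x1 x2 x3 : R -> R) (a1 a2 a3 : R) :
  pert b B rho P -> 0 < rho -> 0 <= L -> 0 <= B ->
  near_circle b t (rho / 2) (x1 t) (x2 t) (x3 t) ->
  (forall s, [/\ `|x1 s - x1 t| <= L * `|s - t|, `|x2 s - x2 t| <= L * `|s - t| &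
     `|x3 s - x3 t| <= L * `|s - t|]) ->
  der x1 t a1 -> der x2 t a2 -> der x3 t a3 ->
  der (fun s => P 0%N (x1 s) (x2 s) (x3 s)) t
    (P 1%N (x1 t) (x2 t) (x3 t) * a1 + P 2 (x1 t) (x2 t) (x3 t) * a2 + P 3 (x1 t) (x2 t) (x3 t) * a3).
Proof.
move=> Pp rho0 L0 B0 nt Lx d1 d2 d3.
set p1 := P 1%N _ _ _; set p2 := P 2 _ _ _; set p3 := P 3 _ _ _.
pose E s := P 0%N (x1 s) (x2 s) (x3 s) - (p1 * x1 s + p2 * x2 s + p3 * x3 s).
have dE : der E t 0.
  apply: (@der_quad _ _ (rho / 2 / (L + 1)) (B * L ^+ 2)).
    by rewrite !divr_gt0// ltr_wpDl.
  move=> s st; have [l1 l2 l3] := Lx s.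
  have Ls : L * `|s - t| <= rho / 2.
    rewrite (le_trans (ler_wpM2l L0 st))// mulrCA ger_pMr ?divr_gt0//.
    by rewrite ler_pdivrMr ?mul1r ?lerDl// ltr_wpDl.
  have nt' : near_circle b t rho (x1 t) (x2 t) (x3 t) by apply: near_circleW nt; lra.
  have ns : near_circle b t rho (x1 s) (x2 s) (x3 s).
    have tri (x y w : R) : `|x - y| <= rho / 2 -> `|y - w| <= rho / 2 -> `|x - w| <= rho.
      move=> xy yw; rewrite -(subrK y x) -addrA (le_trans (ler_normD _ _))//; lra.
    case: nt => n1 n2 n3; split; [exact: tri (le_trans l1 Ls) n1|exact: tri (le_trans l2 Ls) n2|].
    by rewrite -[x3 s]subr0; apply: tri (le_trans l3 Ls) _; rewrite subr0.
  have [_ _ H] := Pp _ _ _ _ _ _ _ _ ns nt' l1 l2 l3.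
  move: H; rewrite exprMn (real_normK (num_real _)) mulrA => H; apply: le_trans H.
  by rewrite le_eqVlt; apply/orP; left; apply/eqP; congr (`|_|); rewrite /E /p1 /p2 /p3; ring.
have := derD dE (derD (derD (derZ p1 d1) (derZ p2 d2)) (derZ p3 d3)).
have -> : (fun y => E y + (p1 * x1 y + p2 * x2 y + p3 * x3 y)) =
  (fun s => P 0%N (x1 s) (x2 s) (x3 s)) by apply/funext => s; rewrite /E subrK.
by move/der_val; apply; rewrite add0r.
Qed.

Lemma state_pos : exists2 r : R, 0 < r & forall X, ball0 r X ->
  [/\ u0 / 2 <= sU b X, 0 < sW b X, 0 < sN b X & 0 < sQ b X].
Proof.
have u00 := bu_gt0 b; have W0 := bW_gt0 b; have l0 := bl_gt0 b.
have n0 : 0 < (bl b * u0) ^+ 2 by rewrite exprn_gt0// mulr_gt0.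
have q0 : 0 < u0 ^+ 2 by rewrite exprn_gt0.
have near f v L : sdiff f v L -> 0 < v ->
    exists2 r : R, 0 < r & forall X, ball0 r X -> v / 2 <= f X.
  move=> sf v0; have [|r r0 H] := sdiff_near sf (e := v / 2); first by rewrite divr_gt0.
  by exists r => // X /H /ler_normlP[]; lra.
have [r1 r10 H1] := near _ _ _ (sdiff_U b) u00.
have [r2 r20 H2] := near _ _ _ (sdiff_W b) W0.
have [r3 r30 H3] := near _ _ _ (sdiff_N b) n0.
have [r4 r40 H4] := near _ _ _ (sdiff_Q b) q0.
exists (Num.min (Num.min r1 r2) (Num.min r3 r4)); first by rewrite !lt_min r10 r20 r30.
have W s X : ball0 (Num.min (Num.min r1 r2) (Num.min r3 r4)) X ->
    Num.min (Num.min r1 r2) (Num.min r3 r4) <= s -> ball0 s X by move=> h1 h2; apply: ball0W h2 h1.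
move=> X Xr; split.
- by apply: H1; apply: W Xr _; rewrite !ge_min lexx.
- by apply: lt_le_trans (H2 _ _); [rewrite divr_gt0|apply: W Xr _; rewrite !ge_min lexx ?orbT].
- by apply: lt_le_trans (H3 _ _); [rewrite divr_gt0|apply: W Xr _; rewrite !ge_min lexx ?orbT].
- by apply: lt_le_trans (H4 _ _); [rewrite divr_gt0|apply: W Xr _; rewrite !ge_min lexx ?orbT].
Qed.

Section Along.
Variables (B rho eps k : R) (P : nat -> R -> R -> R -> R) (o : orbit R).
Hypotheses (Pp : pert b B rho P) (B0 : 0 <= B) (rho0 : 0 < rho).
Hypotheses (sk : small b (rho / 2) k) (or : is_orbit b eps P k o).
Hypothesis pos : forall t, [/\ u0 / 2 <= sU b (ost b eps P o t), 0 < sW b (ost b eps P o t),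
  0 < sN b (ost b eps P o t) & 0 < sQ b (ost b eps P o t)].

Local Notation X := (ost b eps P o).
Definition px1 t := pos1 b t (ov o t).
Definition px2 t := pos2 b t (ov o t).
Definition px3 t := pos3 b (ov o t) (oz o t).
Definition pm1 t := - sL b (X t) * (sin t * sU b (X t) + cos t * ov1 o t).
Definition pm2 t := sL b (X t) * (cos t * sU b (X t) - sin t * ov1 o t).
Definition pm3 t := sL b (X t) * sZ b (X t).

Let UE t : sU b (X t) = u0 + ov o t. Proof. by []. Qed.
Let ZE t : sZ b (X t) = oz1 o t * (u0 + ov o t) - oz o t * ov1 o t. Proof. by []. Qed.

Lemma oU_gt0 t : 0 < sU b (X t).
Proof. by have [h1 _ _ _] := pos t; rewrite (lt_le_trans _ h1)// divr_gt0// bu_gt0. Qed.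

Lemma oL2_gt0 t : 0 < sL2 b (X t).
Proof. by have [_ _ n q] := pos t; rewrite divr_gt0. Qed.

Lemma oL_gt0 t : 0 < sL b (X t).
Proof. by rewrite sqrtr_gt0 oL2_gt0. Qed.

Lemma oL_sqr t : sL b (X t) * sL b (X t) = sL2 b (X t).
Proof. by rewrite -expr2 sqr_sqrtr// ltW// oL2_gt0. Qed.

Lemma oM_gt0 t : 0 < sM b (X t).
Proof. by rewrite !mulr_gt0 ?oL_gt0 ?oU_gt0. Qed.

Lemma oS_gt0 t : 0 < sS (X t).
Proof. by rewrite invr_gt0 sqrtr_gt0 ltr_pwDl// -expr2 sqr_ge0. Qed.

Lemma oS_sqr t : sS (X t) * sS (X t) * (1 + oz o t * oz o t) = 1.
Proof.
have p : 0 < 1 + oz o t * oz o t by rewrite ltr_pwDl// -expr2 sqr_ge0.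
rewrite -expr2 /sS exprVn sqr_sqrtr ?(ltW p)// mulVf// gt_eqF//.
Qed.

Lemma der_U t : der (fun s => u0 + ov o s) t (ov1 o t).
Proof. by apply: der_val (derD (derC u0 t) (lin_v or.1 t)) _; rewrite add0r. Qed.

Let Un t : u0 + ov o t != 0. Proof. by rewrite -UE gt_eqF ?oU_gt0. Qed.
Let Ln t : sL b (X t) != 0. Proof. by rewrite gt_eqF ?oL_gt0. Qed.
Let L2n t : sL2 b (X t) != 0. Proof. by rewrite gt_eqF ?oL2_gt0. Qed.
Let cn : c != 0. Proof. by rewrite gt_eqF// bc_gt0. Qed.

Lemma der_px1 t : der px1 t (pm1 t / sM b (X t)).
Proof.
have := derM (dcos t) (@derV _ (fun s => u0 + ov o s) _ _ (Un t) (der_U t)).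
by move/der_val; apply; rewrite /pm1 /sM UE; field; rewrite Un Ln.
Qed.

Lemma der_px2 t : der px2 t (pm2 t / sM b (X t)).
Proof.
have := derM (dsin t) (@derV _ (fun s => u0 + ov o s) _ _ (Un t) (der_U t)).
by move/der_val; apply; rewrite /pm2 /sM UE; field; rewrite Un Ln.
Qed.

Lemma der_px3 t : der px3 t (pm3 t / sM b (X t)).
Proof.
have := derM (lin_z or.1 t) (@derV _ (fun s => u0 + ov o s) _ _ (Un t) (der_U t)).
by move/der_val; apply; rewrite /pm3 /sM ZE UE; field; rewrite Un Ln.
Qed.

Lemma vel_bound t : [/\ `|pm1 t / sM b (X t)| <= pos_lip b * (1 + k),
  `|pm2 t / sM b (X t)| <= pos_lip b * (1 + k) & `|pm3 t / sM b (X t)| <= pos_lip b * (1 + k)].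
Proof.
have [k0 ku _] := sk; have [ok _ _] := or.2; have [hv hv1 hz hz1] := ok t.
have u00 := bu_gt0 b.
have [U2 _ _ _] := pos t; have U0 := oU_gt0 t.
pose i := (sU b (X t))^-1.
have iU : i <= 2 / u0 by rewrite -[leRHS]invf_div lef_pV2 ?posrE// divr_gt0.
have iU0 : 0 < i by rewrite invr_gt0.
have ni : `|i| = i by rewrite gtr0_norm.
have iU2 : i * i <= 4 / u0 ^+ 2.
  rewrite (_ : 4 / u0 ^+ 2 = 2 / u0 * (2 / u0)); last by field; rewrite gt_eqF.
  by rewrite ler_pM// ltW.
have u4 : 0 <= 4 / u0 ^+ 2 by rewrite divr_ge0// exprn_ge0// ltW.
have u6 : 0 <= 2 / u0 by rewrite divr_ge0// ltW.
have bnd (x y C D : R) : `|x| <= C -> `|y| <= D -> `|x * i + y * (i * i)| <= C * (2 / u0) + D * (4 / u0 ^+ 2).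
  move=> xC yD; rewrite (le_trans (ler_normD _ _))// !normrM ni.
  have i0 : 0 <= i by exact: ltW.
  have ii0 : 0 <= i * i by exact: mulr_ge0.
  by rewrite lerD// ler_pM//.
have E : pos_lip b * (1 + k) = 4 / u0 ^+ 2 + 3 * (2 / u0) + k * (4 / u0 ^+ 2) + 3 * (k * (2 / u0)).
  by rewrite /pos_lip; ring.
have ku4 : 0 <= k * (4 / u0 ^+ 2) by rewrite mulr_ge0.
have ku2 : 0 <= k * (2 / u0) by rewrite mulr_ge0.
have c1 := cos_norm_le1 t; have s1 := sin_norm_le1 t.
have prod (x y : R) : `|x| <= 1 -> `|y| <= k -> `|x * y| <= k.
  by move=> x1 yk; rewrite normrM -[leRHS]mul1r ler_pM.
split.
- rewrite (_ : _ / _ = - sin t * i + (- (cos t * ov1 o t)) * (i * i)).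
    by have := bnd (- sin t) (- (cos t * ov1 o t)) 1 k; rewrite !normrN => /(_ s1 (prod _ _ c1 hv1)); lra.
  by rewrite /pm1 /sM /i UE; field; rewrite Un Ln.
- rewrite (_ : _ / _ = cos t * i + (- (sin t * ov1 o t)) * (i * i)).
    by have := bnd (cos t) (- (sin t * ov1 o t)) 1 k; rewrite !normrN => /(_ c1 (prod _ _ s1 hv1)); lra.
  by rewrite /pm2 /sM /i UE; field; rewrite Un Ln.
rewrite (_ : _ / _ = oz1 o t * i + (- (oz o t * ov1 o t)) * (i * i)).
  have h1 : `|- (oz o t * ov1 o t)| <= k * (u0 / 2).
    by rewrite normrN normrM ler_pM// (le_trans hv1).
  have := bnd _ _ _ _ hz1 h1.
  have -> : k * (u0 / 2) * (4 / u0 ^+ 2) = k * (2 / u0) by field; rewrite gt_eqF.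
  by lra.
by rewrite /pm3 /sM /i ZE UE; field; rewrite Un Ln.
Qed.

Let dlip (f df : R -> R) L t s : (forall t, der f t (df t)) -> (forall t, `|df t| <= L) ->
  `|f s - f t| <= L * `|s - t|.
Proof.
move=> dff dfL; have [st|/ltW ts] := leP t s.
  by rewrite (ger0_norm (_ : 0 <= s - t)) ?subr_ge0// (der_bound st dff).
rewrite distrC [`|s - t|]distrC (ger0_norm (_ : 0 <= t - s)) ?subr_ge0//.
by rewrite (der_bound ts dff).
Qed.

Lemma near_orbit t : near_circle b t (rho / 2) (px1 t) (px2 t) (px3 t).
Proof.
have [k0 ku kr] := sk; have [ok _ _] := or.2; have [hv hv1 hz hz1] := ok t.
by apply: near_circleW kr _; apply: pos_near => //; apply: le_trans ku.
Qed.

Lemma der_P t : der (fun s => P 0%N (px1 s) (px2 s) (px3 s)) t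
  (P 1%N (px1 t) (px2 t) (px3 t) * (pm1 t / sM b (X t)) +
   P 2 (px1 t) (px2 t) (px3 t) * (pm2 t / sM b (X t)) +
   P 3 (px1 t) (px2 t) (px3 t) * (pm3 t / sM b (X t))).
Proof.
have [k0 ku kr] := sk.
have L0 : 0 <= pos_lip b * (1 + k) by rewrite mulr_ge0 ?(ltW (pos_lip_gt0 b)) ?addr_ge0.
apply: (pert_chain Pp rho0 L0 B0 (near_orbit t) _ (der_px1 t) (der_px2 t) (der_px3 t)).
move=> s; split; apply: dlip; [exact: der_px1| |exact: der_px2| |exact: der_px3|];
  by move=> r; have [] := vel_bound r.
Qed.

Lemma der_S t : der (fun s => sS (X s)) t (- (oz o t * oz1 o t) * (sS (X t) * sS (X t) * sS (X t))).
Proof.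
have p : 0 < 1 + oz o t * oz o t by rewrite ltr_pwDl// -expr2 sqr_ge0.
have d1 := derD (derC 1 t) (derM (lin_z or.1 t) (lin_z or.1 t)).
have d2 := @der_sqrt _ (fun s => 1 + oz o s * oz o s) _ _ p d1.
have q : Num.sqrt (1 + oz o t * oz o t) != 0 by rewrite gt_eqF// sqrtr_gt0.
have := @derV _ (fun s => Num.sqrt (1 + oz o s * oz o s)) _ _ q d2.
move/der_val; apply; rewrite (_ : sS (X t) = (Num.sqrt (1 + oz o t * oz o t))^-1)//.
by field.
Qed.

Lemma der_W t : der (fun s => sW b (X s)) t
  (al * (ov1 o t * sS (X t) - sU b (X t) * (oz o t * oz1 o t) * (sS (X t) * sS (X t) * sS (X t)))
   + (X t 7 * (- ov1 o t / sU b (X t) ^+ 2) + X t 8 / sU b (X t) + X t 9 * sZ b (X t) / sU b (X t) ^+ 2)).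
Proof.
have := derD (derD (derC h t) (derZ al (derM (der_U t) (der_S t)))) (derZ eps (der_P t)).
move/der_val; apply.
rewrite /pm1 /pm2 /pm3 /sM ZE UE /ost /state /= /force_at -/(px1 t) -/(px2 t) -/(px3 t) -/(X t).
have := oS_gt0 t; set S := sS _ => _.
have := cos2Dsin2 t => /(canRL (addrK _)) E.
by field: E; rewrite Un Ln.
Qed.

Let ode_v t : der (ov1 o) t (- (sFr b (X t) / (sL2 b (X t) * (sU b (X t) * sU b (X t))))
   - sPhi b (X t) * ov1 o t - sU b (X t)).
Proof. by apply: der_val (lin_v1 or.1 t) _; rewrite /sG1 -[X t 0%N]/(ov o t) -[X t 1%N]/(ov1 o t); ring. Qed.

Let ode_z t : der (oz1 o) t ((sFz b (X t) - oz o t * sFr b (X t)) /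
   (sL2 b (X t) * (sU b (X t) * sU b (X t) * sU b (X t))) - sPhi b (X t) * oz1 o t - oz o t).
Proof. by apply: der_val (lin_z1 or.1 t) _; rewrite /sG2 -[X t 2]/(oz o t) -[X t 3]/(oz1 o t)
  -[X t 4]/(ol1 o * cos t + ol2 o * sin t); ring. Qed.

Lemma der_Z t : der (fun s => sZ b (X s)) t
  (- (oz o t * (- (sFr b (X t) / (sL2 b (X t) * (sU b (X t) * sU b (X t))))
   - sPhi b (X t) * ov1 o t - sU b (X t))) +
   sU b (X t) * ((sFz b (X t) - oz o t * sFr b (X t)) /
   (sL2 b (X t) * (sU b (X t) * sU b (X t) * sU b (X t))) - sPhi b (X t) * oz1 o t - oz o t)).
Proof.
have := derB (derM (ode_z t) (der_U t)) (derM (lin_z or.1 t) (ode_v t)).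
by move/der_val; apply; rewrite -UE; ring.
Qed.

(* The multiplier force is orthogonal to the momentum: it does not affect N. *)
Lemma der_N t : der (fun s => sN b (X s)) t
  (2 * (- sFr b (X t) * ov1 o t / sU b (X t) ^+ 2 + sFt b (X t) / sU b (X t)
        + sFz b (X t) * sZ b (X t) / sU b (X t) ^+ 2)).
Proof.
have dW := der_W t.
have := derB (derM (derM dW dW) (derC ((c ^+ 2)^-1) t)) (derC ((m * c) ^+ 2) t).
move/der_val; apply.
rewrite /sFr /sFt /sFz /sC -[X t 2]/(oz o t) -[X t 1%N]/(ov1 o t).
have := oS_sqr t; have := ZE t; rewrite -UE.
set S := sS _; set U := sU _ _; set Z := sZ _ _; set L := sL _ _; set W := sW _ _.
move=> hZ hS.
have un : U != 0 by rewrite gt_eqF ?oU_gt0.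
have -> : al * (ov1 o t * S - U * (oz o t * oz1 o t) * (S * S * S)) =
  al * S * (ov1 o t * (S * S * (1 + oz o t * oz o t)) - U * (oz o t * oz1 o t) * (S * S)).
  by rewrite hS; ring.
by rewrite hZ; field; rewrite un cn.
Qed.

(** The radial and vertical equations were written with [sPhi] in the place of L' / L.
    Differentiating L^2 = N / Q confirms that guess: N' - L^2 Q' = 2 L^2 Phi Q. So the energy
    relation supplies the missing tangential equation. *)
Lemma der_L t : der (fun s => sL b (X s)) t (sL b (X t) * sPhi b (X t)).
Proof.
have [_ _ n0 q0] := pos t.
have dZ := der_Z t; have dU := der_U t; have dv := ode_v t.
have dQ := derD (derD (derM dv dv) (derM dU dU)) (derM dZ dZ).
have qn : sQ b (X t) != 0 by rewrite gt_eqF.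
have dL2 := derM (der_N t) (@derV _ (fun s => sQ b (X s)) _ _ qn dQ).
have := @der_sqrt _ (fun s => sL2 b (X s)) _ _ (oL2_gt0 t) dL2.
move/der_val; apply.
have eN : sN b (X t) = sL2 b (X t) * sQ b (X t) by rewrite /sL2 divfK.
rewrite -/(sL2 b (X t)) -/(sL b (X t)) eN.
have ln := Ln t; have l2n := L2n t.
have un : sU b (X t) != 0 by rewrite gt_eqF ?oU_gt0.
set dQ' := (X in _ * (- X / _)); set dN' := (X in X / sQ _ _).
suff E : dN' - sL2 b (X t) * dQ' = 2 * sL2 b (X t) * sPhi b (X t) * sQ b (X t).
  rewrite (_ : _ + _ = (dN' - sL2 b (X t) * dQ') / sQ b (X t)); last by field.
  by rewrite E -oL_sqr; field; rewrite qn ln.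
rewrite /dN' /dQ' /sPhi /sQ -[X t 1%N]/(ov1 o t).
have := ZE t; rewrite -UE => hZ.
move: (sZ b (X t)) hZ => Z hZ.
move: (sFr b (X t)) (sFt b (X t)) (sFz b (X t)) (sL2 b (X t)) l2n (sU b (X t)) un hZ.
by move=> Fr Ft Fz L2 l2n U un ->; field; rewrite un l2n.
Qed.

(** [magn1], [magn2], [magn3] are the components of the cross product of (l1, l2, 0) with the
    momentum. *)
Definition magn1 t := ol2 o * pm3 t.
Definition magn2 t := - (ol1 o * pm3 t).
Definition magn3 t := ol1 o * pm2 t - ol2 o * pm1 t.
Definition rinv t := sU b (X t) * sS (X t).
Definition force t (j : nat) xj := sW b (X t) / c ^+ 2 *
   (- (al * rinv t ^+ 3 * xj) + eps * P j (px1 t) (px2 t) (px3 t)).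

(** The force in the moving frame, turned back to the fixed axes. These identities convert the orbit
    equations into Newton's law for the momentum. *)
Lemma force1E t : cos t * sFr b (X t) - sin t * sFt b (X t) = force t 1 (px1 t) + magn1 t.
Proof.
have un : sU b (X t) != 0 by rewrite gt_eqF ?oU_gt0.
have E := cos2Dsin2 t.
rewrite /force /magn1 /pm3 /rinv /sFr /sFt /sC.
rewrite (_ : X t 4 = ol1 o * cos t + ol2 o * sin t)// (_ : X t 5 = ol2 o * cos t - ol1 o * sin t)//.
rewrite (_ : X t 7 = eps * P 1%N (px1 t) (px2 t) (px3 t) * cos t
  + eps * P 2 (px1 t) (px2 t) (px3 t) * sin t)//.
rewrite (_ : X t 8 = eps * P 2 (px1 t) (px2 t) (px3 t) * cos t
  - eps * P 1%N (px1 t) (px2 t) (px3 t) * sin t)//.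
move: (P 1%N _ _ _) (P 2 _ _ _) => Q1 Q2; rewrite {1}/px1 /pos1 -UE.
move: (sW _ _) (sS _) (sL _ _) (sZ _ _) (sU _ _) un => W S L Z U un.
by move: E => /(canRL (addrK _)) E; field: E; rewrite un cn.
Qed.

Lemma force2E t : sin t * sFr b (X t) + cos t * sFt b (X t) = force t 2 (px2 t) + magn2 t.
Proof.
have un : sU b (X t) != 0 by rewrite gt_eqF ?oU_gt0.
have E := cos2Dsin2 t.
rewrite /force /magn2 /pm3 /rinv /sFr /sFt /sC.
rewrite (_ : X t 4 = ol1 o * cos t + ol2 o * sin t)// (_ : X t 5 = ol2 o * cos t - ol1 o * sin t)//.
rewrite (_ : X t 7 = eps * P 1%N (px1 t) (px2 t) (px3 t) * cos t
  + eps * P 2 (px1 t) (px2 t) (px3 t) * sin t)//.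
rewrite (_ : X t 8 = eps * P 2 (px1 t) (px2 t) (px3 t) * cos t
  - eps * P 1%N (px1 t) (px2 t) (px3 t) * sin t)//.
move: (P 1%N _ _ _) (P 2 _ _ _) => Q1 Q2; rewrite {1}/px2 /pos2 -UE.
move: (sW _ _) (sS _) (sL _ _) (sZ _ _) (sU _ _) un => W S L Z U un.
by move: E => /(canRL (addrK _)) E; field: E; rewrite un cn.
Qed.

Lemma force3E t : sFz b (X t) = force t 3 (px3 t) + magn3 t.
Proof.
have un : sU b (X t) != 0 by rewrite gt_eqF ?oU_gt0.
rewrite /force /magn3 /pm1 /pm2 /rinv /sFz /sC.
rewrite (_ : X t 4 = ol1 o * cos t + ol2 o * sin t)// (_ : X t 5 = ol2 o * cos t - ol1 o * sin t)//.
rewrite (_ : X t 9 = eps * P 3 (px1 t) (px2 t) (px3 t))// (_ : X t 2 = oz o t)//.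
move: (P 3 _ _ _) => Q3; rewrite {1}/px3 /pos3 -UE (_ : X t 1%N = ov1 o t)//.
move: (sW _ _) (sS _) (sL _ _) (sU _ _) un => W S L U un.
by field; rewrite un cn.
Qed.

Lemma der_pm1 t : der pm1 t ((force t 1 (px1 t) + magn1 t) / sM b (X t)).
Proof.
have := derN (derM (der_L t) (derD (derM (dsin t) (der_U t)) (derM (dcos t) (ode_v t)))).
rewrite (_ : (fun y => - _) = pm1); last by apply/funext => s; rewrite /pm1 -mulNr.
move/der_val; apply.
have un : sU b (X t) != 0 by rewrite gt_eqF ?oU_gt0.
have ln := Ln t.
rewrite -force1E /sM /sPhi -UE -oL_sqr.
by field; rewrite un ln.
Qed.

Lemma der_pm2 t : der pm2 t ((force t 2 (px2 t) + magn2 t) / sM b (X t)).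
Proof.
have := derM (der_L t) (derB (derM (dcos t) (der_U t)) (derM (dsin t) (ode_v t))).
move/der_val; apply.
have un : sU b (X t) != 0 by rewrite gt_eqF ?oU_gt0.
have ln := Ln t.
rewrite -force2E /sM /sPhi -UE -oL_sqr.
by field; rewrite un ln.
Qed.

Lemma der_pm3 t : der pm3 t ((force t 3 (px3 t) + magn3 t) / sM b (X t)).
Proof.
have := derM (der_L t) (der_Z t).
move/der_val; apply.
have un : sU b (X t) != 0 by rewrite gt_eqF ?oU_gt0.
have ln := Ln t.
rewrite -force3E /sM /sPhi -oL_sqr (_ : sZ b (X t) = oz1 o t * sU b (X t) - oz o t * ov1 o t)//.
by field; rewrite un ln.
Qed.

Lemma momentum_sqr t : pm1 t ^+ 2 + pm2 t ^+ 2 + pm3 t ^+ 2 = sN b (X t).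
Proof.
have [_ _ n0 q0] := pos t.
have E := cos2Dsin2 t.
have -> : sN b (X t) = sL b (X t) * sL b (X t) * sQ b (X t).
  by rewrite oL_sqr /sL2 divfK// gt_eqF.
rewrite /pm1 /pm2 /pm3 /sQ -[X t 1%N]/(ov1 o t).
by move: E => /(canRL (addrK _)) E; ring: E.
Qed.

Lemma rinv_gt0 t : 0 < rinv t.
Proof. by rewrite mulr_gt0 ?oU_gt0 ?oS_gt0. Qed.

Lemma rinvE t : rinv t ^+ 2 * (px1 t ^+ 2 + px2 t ^+ 2 + px3 t ^+ 2) = 1.
Proof.
have un : sU b (X t) != 0 by rewrite gt_eqF ?oU_gt0.
have E := cos2Dsin2 t.
rewrite -(oS_sqr t) /rinv /px1 /px2 /px3 /pos1 /pos2 /pos3 -UE.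
by move: E => /(canRL (addrK _)) E; field: E.
Qed.

Lemma oWE t : sW b (X t) = h + al * rinv t + eps * P 0%N (px1 t) (px2 t) (px3 t).
Proof. by []. Qed.

Lemma ost_periodic t : X (t + tpi) = X t.
Proof.
have l := or.1.
rewrite /ost /state /force_at /pos1 /pos2 (lin_vp l) (lin_v1p l) (lin_zp l) (lin_z1p l).
by rewrite cosD2pi sinD2pi.
Qed.

Lemma pos_periodic t : [/\ px1 (t + tpi) = px1 t, px2 (t + tpi) = px2 t & px3 (t + tpi) = px3 t].
Proof.
have l := or.1.
by rewrite /px1 /px2 /px3 /pos1 /pos2 (lin_vp l) (lin_zp l) cosD2pi sinD2pi.
Qed.

Lemma mom_periodic t : [/\ pm1 (t + tpi) = pm1 t, pm2 (t + tpi) = pm2 t & pm3 (t + tpi) = pm3 t].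
Proof.
have l := or.1.
by rewrite /pm1 /pm2 /pm3 ost_periodic (lin_v1p l) cosD2pi sinD2pi.
Qed.

End Along.
End Motion.

(** * Recovering time from the angle *)

Section TimeChange.
Variable R : realType.
Local Notation tpi := (pi *+ 2 : R).

(** Time is the primitive of dt/dth, an increasing bijection because [T] is bounded below by a
    positive constant, and [Th] is its inverse. Its increment over 2 pi does not depend on the
    starting angle: this is the period. *)
Lemma time_change (T : R -> R) (T0 Tmin e : R) : continuous T -> 0 < Tmin ->
  (forall x, Tmin <= T x) -> (forall x, T (x + tpi) = T x) ->
  (forall x, `|T x - T0| <= e) ->
  exists (Th : R -> R) (sigma : R), [/\ 0 < sigma, forall t, der Th t (T (Th t))^-1,
    forall t, Th (t + sigma) = Th t + tpi, `|sigma - T0 * tpi| <= e * tpi &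
    forall t, `|T0 * Th t - t| <= e * `|Th t|].
Proof.
move=> cT Tm0 Tm Tp Te.
have [F [F0 dF]] := primitive_ex cT.
have mono x y : x <= y -> Tmin * (y - x) <= F y - F x.
  move=> xy; have [z _ ->] := mean_value xy dF.
  by rewrite ler_wpM2r ?subr_ge0.
have inj x y : F x = F y -> x = y.
  wlog xy : x y / x <= y => [H|] E.
    by have [/H->|/ltW /H->] := leP x y.
  apply/eqP; rewrite eq_le xy -subr_le0 -(pmulr_rle0 _ Tm0).
  by rewrite (le_trans (mono _ _ xy))// E subrr.
have cF : continuous F by apply: der_continuous => x; exists (T x).
have surj y : exists x, F x = y.
  pose a := `|y| / Tmin.
  have a0 : 0 <= a by rewrite divr_ge0// ltW.
  have h1 : y <= F a.
    have := mono _ _ a0; rewrite F0 !subr0 mulrC divfK ?gt_eqF//.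
    by apply: le_trans; exact: ler_norm.
  have h2 : F (- a) <= y.
    have an : - a <= 0 by rewrite oppr_le0.
    have := mono _ _ an; rewrite F0 !sub0r opprK mulrC divfK ?gt_eqF//.
    by rewrite lerNr => /le_trans; apply; rewrite lerNl -normrN ler_norm.
  have [| | |c _ Fc] := @IVT R F (- a) a y.
  - by rewrite (le_trans _ a0)// oppr_le0.
  - exact: continuous_subspaceT.
  - by rewrite ge_min h2 le_max h1 orbT.
  by exists c.
have [Th FTh] := choice surj.
have ThF x : Th (F x) = x by apply: inj; rewrite FTh.
have Fper x : F (x + tpi) - F x = F tpi.
  have := @der_cst _ (fun x => F (x + tpi) - F x) _ x 0; rewrite add0r F0 subr0; apply=> z.
  by apply: der_val (derB (der_shift (dF (z + tpi))) (dF z)) _; rewrite Tp subrr.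
have tp := tpi_gt0 R.
exists Th, (F tpi); split.
- by have := mono _ _ (ltW tp); rewrite F0 !subr0; apply: lt_le_trans; rewrite mulr_gt0.
- move=> t; rewrite -{1}(FTh t).
  apply: (@is_derive_inverse R F Th (T (Th t)) (Th t)).
  + by near=> z; exact: ThF.
  + by near=> z; exact: cF.
  + exact: dF.
  + by rewrite gt_eqF// (lt_le_trans Tm0).
- by move=> t; apply: inj; rewrite FTh -(Fper (Th t)) FTh addrC subrK.
- have dG x : der (fun x => F x - T0 * x) x (T x - T0).
    by apply: der_val (derB (dF x) (derZ T0 (der_id x))) _; rewrite mulr1.
  have := der_bound (ltW tp) dG (fun x _ => Te x).
  by rewrite F0 mulr0 !subr0.
- have dG x : der (fun x => T0 * x - F x) x (T0 - T x).
    by apply: der_val (derB (derZ T0 (der_id x)) (dF x)) _; rewrite mulr1.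
  have Te' x : `|T0 - T x| <= e by rewrite distrC.
  move=> t; have [t0|/ltW t0] := leP 0 (Th t).
    have := der_bound t0 dG (fun x _ => Te' x).
    by rewrite F0 FTh mulr0 !subr0 (ger0_norm t0).
  have := der_bound t0 dG (fun x _ => Te' x).
  by rewrite F0 FTh mulr0 subrr !sub0r normrN (ler0_norm t0).
Unshelve. all: by end_near. Qed.

End TimeChange.

Section ClosedMotion.
Variables (R : realType) (b : base R).
Local Notation u0 := (bu b).
Local Notation c := (bc b).
Local Notation m := (bm b).
Local Notation al := (bal b).
Local Notation h := (bh b).
Local Notation tpi := (pi *+ 2 : R).
Local Notation rad := (bu b)^-1.

(* Inverse angular velocity of the circular orbit. *)
Definition T0 := (h + al * u0) / (c ^+ 2 * (bl b * u0 ^+ 2)).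

Lemma T0_gt0 : 0 < T0.
Proof. by rewrite divr_gt0 ?bW_gt0// !mulr_gt0 ?exprn_gt0 ?bc_gt0 ?bl_gt0 ?bu_gt0. Qed.

(* Position [x], momentum [q], inverse distance [r] to the origin and
   relativistic energy [W] of a solution, as functions of time. *)
Record motion (eps : R) (P : nat -> R -> R -> R -> R) (x1 x2 x3 q1 q2 q3 r W : R -> R) : Prop :=
  Motion {
  mo_x1 : forall t, der x1 t (c ^+ 2 * q1 t / W t);
  mo_x2 : forall t, der x2 t (c ^+ 2 * q2 t / W t);
  mo_x3 : forall t, der x3 t (c ^+ 2 * q3 t / W t);
  mo_q1 : forall t, der q1 t (- (al * r t ^+ 3 * x1 t) + eps * P 1%N (x1 t) (x2 t) (x3 t));
  mo_q2 : forall t, der q2 t (- (al * r t ^+ 3 * x2 t) + eps * P 2 (x1 t) (x2 t) (x3 t));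
  mo_q3 : forall t, der q3 t (- (al * r t ^+ 3 * x3 t) + eps * P 3 (x1 t) (x2 t) (x3 t));
  mo_r : forall t, 0 < r t;
  mo_rE : forall t, r t ^+ 2 * (x1 t ^+ 2 + x2 t ^+ 2 + x3 t ^+ 2) = 1;
  mo_W : forall t, 0 < W t;
  mo_WE : forall t, W t = h + al * r t + eps * P 0%N (x1 t) (x2 t) (x3 t);
  mo_q : forall t, q1 t ^+ 2 + q2 t ^+ 2 + q3 t ^+ 2 = W t * W t / c ^+ 2 - (m * c) ^+ 2 }.

Lemma cos_lip (x y : R) : `|cos x - cos y| <= `|x - y| /\ `|sin x - sin y| <= `|x - y|.
Proof.
wlog yx : x y / y <= x => [H|].
  by have [/H//|/ltW/H] := leP y x; rewrite distrC [`|sin y - _|]distrC [`|y - _|]distrC.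
rewrite [`|x - y|]ger0_norm ?subr_ge0//; split.
  have := der_bound (k := 1) yx (@dcos R); rewrite mul1r; apply=> t _.
  by rewrite normrN sin_norm_le1.
have := der_bound (k := 1) yx (@dsin R); rewrite mul1r; apply=> t _.
exact: cos_norm_le1.
Qed.

Lemma orbit_small (B rho C r : R) : 0 <= B -> 0 < rho -> 0 <= C -> 0 < r ->
  exists e0 D : R, [/\ 0 < e0, 0 <= D & forall P (eps : R) o, pert b B rho P -> `|eps| <= e0 ->
    is_orbit b eps P (C * `|eps|) o ->
    small b (rho / 2) (C * `|eps|) /\
    forall t, ball0 (D * `|eps|) (ost b eps P o t) /\ D * `|eps| <= r].
Proof.
move=> B0 rho0 C0 r0; have pl := pos_lip_gt0 b; have u00 := bu_gt0 b.
pose M := C * (2 / u0) + C * pos_lip b * (2 / rho) + (2 * C + 2 * B) / r + 1.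
have h1 : 0 <= C * (2 / u0) by rewrite mulr_ge0// divr_ge0// ltW.
have [pl' rho'] : 0 <= pos_lip b /\ 0 <= rho by split; exact: ltW.
have h2 : 0 <= C * pos_lip b * (2 / rho) by rewrite !mulr_ge0// invr_ge0.
have h3 : 0 <= (2 * C + 2 * B) / r by rewrite divr_ge0 ?(ltW r0)// addr_ge0// mulr_ge0.
have M0 : 0 < M by rewrite /M; lra.
exists (M^-1), (2 * C + 2 * B); split; first by rewrite invr_gt0.
  by rewrite addr_ge0// mulr_ge0.
move=> P eps o Pp epse [_ ob].
have epsM : `|eps| * M <= 1 by rewrite -ler_pdivlMr// div1r.
have le1 x : 0 <= x -> x <= M -> `|eps| * x <= 1.
  by move=> x0 xM; apply: le_trans epsM; rewrite ler_wpM2l.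
have s2 : small b (rho / 2) (C * `|eps|).
  split; first exact: mulr_ge0.
    have := le1 _ h1; rewrite (_ : `|eps| * _ = C * `|eps| / (u0 / 2)); last by field; rewrite gt_eqF.
    by rewrite ler_pdivrMr ?divr_gt0// mul1r; apply; rewrite /M; lra.
  have := le1 _ h2; rewrite (_ : `|eps| * _ = pos_lip b * (C * `|eps|) / (rho / 2)); last first.
    by field; rewrite gt_eqF.
  by rewrite ler_pdivrMr ?divr_gt0// mul1r; apply; rewrite /M; lra.
split=> // t; split.
  have s1 : small b rho (C * `|eps|) by case: s2 => ? ? ?; split=> //; lra.
  have [lo hi] := ost_bound eps t Pp B0 s1 ob.
  have c0 : 0 <= `|eps| * C by rewrite mulr_ge0.
  have b0 : 0 <= `|eps| * B by rewrite mulr_ge0.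
  move=> i; have [i6|i6] := ltnP i 6; first by rewrite (le_trans (lo i i6))//; lra.
  by rewrite (le_trans (hi i i6))//; lra.
have : `|eps| * ((2 * C + 2 * B) / r) <= 1 by apply: le1 => //; rewrite /M; lra.
by rewrite mulrA ler_pdivrMr// mul1r mulrC.
Qed.

Lemma closed_motion (B rho C Tmax eta : R) : 0 <= B -> 0 < rho -> 0 <= C -> 0 <= Tmax -> 0 < eta ->
  exists2 e0 : R, 0 < e0 & forall P (eps : R) o, pert b B rho P -> `|eps| <= e0 ->
    is_orbit b eps P (C * `|eps|) o -> ol1 o = 0 -> ol2 o = 0 ->
  exists (x1 x2 x3 q1 q2 q3 r W : R -> R) (sigma : R),
   [/\ motion eps P x1 x2 x3 q1 q2 q3 r W,
     0 < sigma /\ forall t, [/\ x1 (t + sigma) = x1 t, x2 (t + sigma) = x2 t & x3 (t + sigma) = x3 t],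
     `|sigma - T0 * tpi| <= eta,
     forall t, exists s, near_circle b s (rho / 2) (x1 t) (x2 t) (x3 t) /\
       ((forall s, oz o s = 0) -> x3 t = 0) &
     forall t, 0 <= t <= Tmax -> [/\ `|x1 t - rad * cos (t / T0)| <= eta,
       `|x2 t - rad * sin (t / T0)| <= eta & `|x3 t| <= eta]].
Proof.
move=> B0 rho0 C0 Tm0 eta0.
have pl := pos_lip_gt0 b; have u00 := bu_gt0 b; have T00 := T0_gt0; have tp := tpi_gt0 R.
have [r1 r10 Hpos] := state_pos b.
have [LT sT'] := sdiff_T b.
have [CT [r2 [CT0 r20 HT]]] := sdiff_lip sT'.
have HT0 : sT b (fun=> 0) = T0 by case: sT'.
have [|e1 [D [e10 D0 Hsm]]] := @orbit_small B rho C (Num.min r1 r2) B0 rho0 C0.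
  by rewrite lt_min r10.
(* Distance from the circle at the same angle, plus the drift of the angle: |Th t - t / T0| grows in
   proportion to |Th t|, which is at most 2 Tmax / T0 on the time interval. *)
pose K := pos_lip b * C + rad * (CT * D * (2 * Tmax / T0 ^+ 2)).
have K0 : 0 <= K.
  have [pl' u0' T0'] : [/\ 0 <= pos_lip b, 0 <= u0 & 0 <= T0] by split; exact: ltW.
  by rewrite addr_ge0 ?mulr_ge0 ?invr_ge0 ?exprn_ge0.
pose e0 := Num.min e1 (Num.min (T0 / 2 / (CT * D + 1)) (Num.min (eta / (CT * D * tpi + 1)) (eta / (K + 1)))).
have cd0 : 0 <= CT * D by rewrite mulr_ge0.
have cdt0 : 0 <= CT * D * tpi by rewrite mulr_ge0// ltW.
have p1 : 0 < CT * D + 1 by lra.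
have p2 : 0 < CT * D * tpi + 1 by lra.
have p3 : 0 < K + 1 by lra.
have T02 : 0 < T0 / 2 by exact: divr_gt0.
exists e0.
  by rewrite !lt_min e10 (divr_gt0 T02 p1) (divr_gt0 eta0 p2) (divr_gt0 eta0 p3).
move=> P eps o Pp epse ob l1 l2.
have ee1 : `|eps| <= e1 by rewrite (le_trans epse)// ge_min lexx.
have ineq x y : 0 <= x -> `|eps| <= y / (x + 1) -> x * `|eps| <= y.
  move=> x0; have x1 : 0 < x + 1 by lra.
  rewrite ler_pdivlMr// mulrDr mulr1 [x * _]mulrC.
  by have := normr_ge0 eps; lra.
have ee2 : CT * D * `|eps| <= T0 / 2.
  by apply: ineq => //; rewrite (le_trans epse)// !ge_min lexx !orbT.
have ee3 : CT * D * tpi * `|eps| <= eta.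
  by apply: ineq => //; rewrite (le_trans epse)// !ge_min lexx !orbT.
have ee4 : K * `|eps| <= eta.
  by apply: ineq => //; rewrite (le_trans epse)// !ge_min lexx !orbT.
have [sk Hb] := Hsm P eps o Pp ee1 ob.
have inb t : ball0 r1 (ost b eps P o t) /\ ball0 r2 (ost b eps P o t).
  have [h1 h2] := Hb t; split; apply: ball0W h1; rewrite (le_trans h2)// ge_min lexx ?orbT//.
have pos t := Hpos _ (inb t).1.
have ob2 : forall t, [/\ `|ov o t| <= C * `|eps|, `|ov1 o t| <= C * `|eps|,
   `|oz o t| <= C * `|eps| & `|oz1 o t| <= C * `|eps|] by case: ob => _ [].
pose T t := sT b (ost b eps P o t).
have TT0 t : `|T t - T0| <= CT * D * `|eps|.
  rewrite -HT0 -mulrA; apply: HT; [exact: (inb t).2|by move=> i; rewrite normr0 ltW|].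
  by move=> i; rewrite subr0; have [h1 _] := Hb t.
have Mpos t := oM_gt0 pos t.
have dT t : exists a, der T t a.
  have dW := der_W Pp B0 rho0 sk ob pos t.
  have dL := der_L Pp B0 rho0 sk ob pos t.
  have dU := der_U ob t.
  have n0 : c ^+ 2 * sM b (ost b eps P o t) != 0.
    by rewrite gt_eqF// mulr_gt0 ?exprn_gt0 ?bc_gt0.
  eexists; exact: (derM dW (@derV _ (fun s => c ^+ 2 * (sL b (ost b eps P o s) *
    (sU b (ost b eps P o s) * sU b (ost b eps P o s)))) _ _ n0 (derZ _ (derM dL (derM dU dU))))).
have T2 t : T0 / 2 <= T t by have /ler_normlP[] := TT0 t; lra.
have [||Th [sg [sg0 dTh Thp sgT ThT]]] := @time_change R T T0 (T0 / 2) (CT * D * `|eps|)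
    (der_continuous dT) _ T2 _ TT0.
- by rewrite divr_gt0.
- by move=> t; rewrite /T (ost_periodic ob).
have Wpos t : 0 < sW b (ost b eps P o t) by case: (pos t).
have cn : c != 0 by rewrite gt_eqF ?bc_gt0.
have TE t : (T t)^-1 = c ^+ 2 * sM b (ost b eps P o t) / sW b (ost b eps P o t).
  by rewrite /T /sT invf_div.
exists (fun t => px1 b o (Th t)), (fun t => px2 b o (Th t)), (fun t => px3 b o (Th t)).
exists (fun t => pm1 b eps P o (Th t)), (fun t => pm2 b eps P o (Th t)), (fun t => pm3 b eps P o (Th t)).
exists (fun t => rinv b eps P o (Th t)), (fun t => sW b (ost b eps P o (Th t))), sg.
have chain_x (x : R -> R) p t : der x (Th t) (p / sM b (ost b eps P o (Th t))) ->
    der (fun t => x (Th t)) t (c ^+ 2 * p / sW b (ost b eps P o (Th t))).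
  move=> dx; apply: der_val (der_comp dx (dTh t)) _; rewrite TE.
  by field; rewrite !gt_eqF ?Mpos ?Wpos.
have chain_q (q : R -> R) mg j xj t : mg = 0 ->
    der q (Th t) ((force b eps P o (Th t) j xj + mg) / sM b (ost b eps P o (Th t))) ->
    der (fun t => q (Th t)) t (- (al * rinv b eps P o (Th t) ^+ 3 * xj) +
      eps * P j (px1 b o (Th t)) (px2 b o (Th t)) (px3 b o (Th t))).
  move=> -> dq; apply: der_val (der_comp dq (dTh t)) _; rewrite TE /force.
  by field; rewrite !gt_eqF ?Mpos ?Wpos ?bc_gt0.
split.
- split=> t.
  + exact: chain_x (der_px1 ob pos _).
  + exact: chain_x (der_px2 ob pos _).
  + exact: chain_x (der_px3 ob pos _).
  + by apply: chain_q (der_pm1 Pp B0 rho0 sk ob pos _); rewrite /magn1 l2 mul0r.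
  + by apply: chain_q (der_pm2 Pp B0 rho0 sk ob pos _); rewrite /magn2 l1 mul0r oppr0.
  + by apply: chain_q (der_pm3 Pp B0 rho0 sk ob pos _); rewrite /magn3 l1 l2 !mul0r subr0.
  + exact: rinv_gt0.
  + exact: rinvE.
  + exact: Wpos.
  + exact: oWE.
  + exact: momentum_sqr.
- by split=> // t; rewrite Thp; exact: (pos_periodic ob).
- by rewrite (le_trans sgT)// mulrAC.
- move=> t; exists (Th t); split; first exact: near_orbit sk ob _.
  by move=> z0; rewrite /px3 /pos3 z0 mul0r.
move=> t /andP[t0 tT].
have H := ThT t.
have Tn : T0 != 0 by rewrite gt_eqF.
have Thb : `|Th t| <= 2 * Tmax / T0.
  rewrite ler_pdivlMr//.
  have h1 : T0 * `|Th t| <= `|t| + CT * D * `|eps| * `|Th t|.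
    rewrite -{1}(gtr0_norm T00) -normrM -(subrK t (T0 * Th t)).
    by rewrite (le_trans (ler_normD _ _))// addrC lerD.
  have h2 : CT * D * `|eps| * `|Th t| <= T0 / 2 * `|Th t| by rewrite ler_wpM2r.
  by rewrite (ger0_norm t0) in h1; lra.
have dist : `|Th t - t / T0| <= CT * D * (2 * Tmax / T0 ^+ 2) * `|eps|.
  have h1 : `|T0 * Th t - t| <= CT * D * `|eps| * (2 * Tmax / T0).
    by rewrite (le_trans H)// ler_wpM2l// mulr_ge0.
  rewrite -(ler_pM2l T00) -{1}(gtr0_norm T00) -normrM mulrBr mulrCA mulfV// mulr1.
  by rewrite (le_trans h1)// le_eqVlt; apply/orP; left; apply/eqP; field.
have [h1 h2] := cos_lip (Th t) (t / T0).
have rad0 : 0 < rad by rewrite invr_gt0.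
have [k0 ku kr] := sk.
have [b1 _ b3 _] := ob2 (Th t).
have [n1 n2 n3] := pos_near (Th t) (le_trans b1 ku) b1 b3.
have EK : K * `|eps| = pos_lip b * (C * `|eps|) + rad * (CT * D * (2 * Tmax / T0 ^+ 2) * `|eps|).
  by rewrite /K; ring.
have r0 : 0 <= rad * (CT * D * (2 * Tmax / T0 ^+ 2) * `|eps|).
  by rewrite mulr_ge0 ?(ltW rad0)// (le_trans _ dist).
have tri (x a a' : R) : `|x - rad * a| <= pos_lip b * (C * `|eps|) -> `|a - a'| <= `|Th t - t / T0| ->
    `|x - rad * a'| <= eta.
  move=> xa aa; rewrite -(subrK (rad * a) x) -addrA -mulrBr (le_trans (ler_normD _ _))//.
  rewrite normrM (gtr0_norm rad0).
  have : rad * `|a - a'| <= rad * (CT * D * (2 * Tmax / T0 ^+ 2) * `|eps|).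
    by rewrite ler_wpM2l ?(ltW rad0)// (le_trans aa).
  by lra.
split; [exact: tri n1 h1|exact: tri n2 h2|].
by rewrite (le_trans n3)//; lra.
Qed.

End ClosedMotion.

(** * First variation of the action *)

Section VariationAlgebra.
Variable R : realType.

Lemma sum3_sqr_bound (x y z k : R) : `|x| <= k -> `|y| <= k -> `|z| <= k ->
  x ^+ 2 + y ^+ 2 + z ^+ 2 <= 3 * k ^+ 2.
Proof.
have sq (a : R) : `|a| <= k -> a ^+ 2 <= k ^+ 2.
  move=> ak; rewrite -(real_normK (num_real a)) lerXn2r ?nnegrE//.
  exact: le_trans ak.
by move=> /sq hx /sq hy /sq hz; lra.
Qed.

(** Only the relations r^2 |x|^2 = 1 are used: they express rb - ra as - ra^2 rb^2 s / (ra + rb),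
    where s is the change of |x|^2, and the expansion to second order becomes algebra. *)
Lemma inv_dist_taylor (G : R) : 0 < G -> exists2 C : R, 0 <= C &
  forall (a1 a2 a3 v1 v2 v3 ra rb k : R), 0 < ra -> 0 < rb -> ra <= G -> rb <= G ->
  ra ^+ 2 * (a1 ^+ 2 + a2 ^+ 2 + a3 ^+ 2) = 1 ->
  rb ^+ 2 * ((a1 + v1) ^+ 2 + (a2 + v2) ^+ 2 + (a3 + v3) ^+ 2) = 1 ->
  `|a1| <= G -> `|a2| <= G -> `|a3| <= G ->
  `|v1| <= k -> `|v2| <= k -> `|v3| <= k -> k <= 1 ->
  `|rb - ra| <= C * k /\ `|rb - ra + ra ^+ 3 * (a1 * v1 + a2 * v2 + a3 * v3)| <= C * k ^+ 2.
Proof.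
move=> G0; have G0' := ltW G0.
pose K := 6 * G + 3.
have K0 : 0 <= K by rewrite /K; lra.
exists (G ^+ 3 * K + K * (G ^+ 2 * (G ^+ 3 * K)) + 3 * G ^+ 3).
  by rewrite !addr_ge0 ?mulr_ge0 ?exprn_ge0.
move=> a1 a2 a3 v1 v2 v3 ra rb k ra0 rb0 raG rbG Ea Eb h1 h2 h3 hv1 hv2 hv3 k1.
have k0 : 0 <= k by apply: le_trans hv1.
have ra0' := ltW ra0; have rb0' := ltW rb0.
pose vv := v1 ^+ 2 + v2 ^+ 2 + v3 ^+ 2.
pose s := 2 * (a1 * v1 + a2 * v2 + a3 * v3) + vv.
have vv0 : 0 <= vv by rewrite !addr_ge0 ?sqr_ge0.
have vvk : vv <= 3 * k ^+ 2 by exact: sum3_sqr_bound.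
have k2 : k ^+ 2 <= k by rewrite expr2 ler_piMr.
have sk : `|s| <= K * k.
  have pr (a v : R) : `|a| <= G -> `|v| <= k -> `|a * v| <= G * k by move=> ? ?; rewrite normrM ler_pM.
  have q1 := pr _ _ h1 hv1; have q2 := pr _ _ h2 hv2; have q3 := pr _ _ h3 hv3.
  rewrite /s (le_trans (ler_normD _ _))// normrM (ger0_norm vv0) (ger0_norm (_ : 0 <= 2))//.
  have := ler_normD (a1 * v1 + a2 * v2) (a3 * v3); have := ler_normD (a1 * v1) (a2 * v2).
  by rewrite /K; lra.
have rn : ra + rb != 0 by rewrite gt_eqF// addr_gt0.
have Es : rb - ra = - (ra ^+ 2 * rb ^+ 2 * s) / (ra + rb).
  have : ra ^+ 2 - rb ^+ 2 = ra ^+ 2 * rb ^+ 2 * s.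
    transitivity (ra ^+ 2 * (rb ^+ 2 * ((a1 + v1) ^+ 2 + (a2 + v2) ^+ 2 + (a3 + v3) ^+ 2))
      - rb ^+ 2 * (ra ^+ 2 * (a1 ^+ 2 + a2 ^+ 2 + a3 ^+ 2))); first by rewrite Ea Eb !mulr1.
    by rewrite /s /vv; ring.
  by move=> <-; field.
have frac (x : R) : 0 <= x -> x <= 2 * (ra + rb) -> x / (ra + rb) <= 2.
  by move=> x0 xl; rewrite ler_pdivrMr ?addr_gt0.
have P2 : ra ^+ 2 <= G ^+ 2 by rewrite lerXn2r ?nnegrE.
have P3 : ra ^+ 3 <= G ^+ 3 by rewrite lerXn2r ?nnegrE.
have Q2 : rb ^+ 2 <= G ^+ 2 by rewrite lerXn2r ?nnegrE.
have d1 : `|rb - ra| <= G ^+ 3 * K * k.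
  pose q := ra * (ra / (ra + rb)) * rb ^+ 2.
  have f0 : 0 <= ra / (ra + rb) by rewrite divr_ge0// addr_ge0.
  have f1 : ra / (ra + rb) <= 1 by rewrite ler_pdivrMr ?addr_gt0// mul1r lerDl.
  have q0 : 0 <= q by apply: mulr_ge0; [exact: mulr_ge0|exact: exprn_ge0].
  have qG : q <= G ^+ 3.
    rewrite exprS; apply: ler_pM => //; [exact: mulr_ge0|exact: exprn_ge0|].
    by rewrite (le_trans _ raG)// ler_piMr.
  rewrite Es (_ : _ / _ = - (q * s)); last by rewrite /q; field.
  by rewrite normrN normrM (ger0_norm q0) -mulrA ler_pM.
have GK : 0 <= G ^+ 3 * K * k by rewrite !mulr_ge0 ?exprn_ge0.
have E2 : rb - ra + ra ^+ 3 * (a1 * v1 + a2 * v2 + a3 * v3) =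
   s * (ra ^+ 2 * (ra - rb) * ((ra + 2 * rb) / (ra + rb) / 2)) - ra ^+ 3 * vv / 2.
  rewrite Es (_ : a1 * v1 + a2 * v2 + a3 * v3 = (s - vv) / 2); last by rewrite /s; field.
  by field.
split.
  rewrite (le_trans d1)// ler_wpM2r// -addrA lerDl addr_ge0 ?mulr_ge0 ?exprn_ge0//.
rewrite E2 (le_trans (ler_normB _ _))//.
have t1 : `|s * (ra ^+ 2 * (ra - rb) * ((ra + 2 * rb) / (ra + rb) / 2))| <=
    (K * k) * (G ^+ 2 * (G ^+ 3 * K * k) * 1).
  rewrite normrM ler_pM// normrM ler_pM//.
    by rewrite normrM ler_pM// ?(ger0_norm (exprn_ge0 _ _))// distrC.
  rewrite ger0_norm; last by rewrite !divr_ge0 ?addr_ge0 ?mulr_ge0.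
  rewrite ler_pdivrMr// mul1r frac ?addr_ge0 ?mulr_ge0//; lra.
have t2 : `|ra ^+ 3 * vv / 2| <= 3 * G ^+ 3 * k ^+ 2.
  rewrite ger0_norm ?divr_ge0 ?mulr_ge0 ?exprn_ge0//.
  have : ra ^+ 3 * vv <= G ^+ 3 * (3 * k ^+ 2) by rewrite ler_pM ?exprn_ge0.
  have : 0 <= G ^+ 3 * (3 * k ^+ 2) by rewrite !mulr_ge0 ?exprn_ge0.
  by lra.
have t3 : 0 <= G ^+ 3 * K * k ^+ 2 by rewrite !mulr_ge0 ?exprn_ge0.
have e1 : K * k * (G ^+ 2 * (G ^+ 3 * K * k) * 1) = K * (G ^+ 2 * (G ^+ 3 * K)) * k ^+ 2 by ring.
rewrite e1 in t1.
rewrite (_ : (_ + _ + _) * k ^+ 2 = G ^+ 3 * K * k ^+ 2 +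
  K * (G ^+ 2 * (G ^+ 3 * K)) * k ^+ 2 + 3 * G ^+ 3 * k ^+ 2); last by ring.
apply: (le_trans (lerD t1 t2)).
by rewrite -addrA lerDr.
Qed.

(* By AM-GM, N |b'| <= (M |b'|^2 + N^2 / M) / 2, with equality on the reference curve;
   the right-hand side is expanded to second order in the displacement. *)
Lemma action_pointwise (G c2 mc : R) : 0 < G -> 0 < c2 -> exists2 C : R, 0 <= C &
  forall (k M L' Q' U' L Q U Wa dW g1 g2 g3 w1 w2 w3 v1 v2 v3 p1 p2 p3 y1 y2 y3 n1 n2 n3 : R),
  0 < M -> M <= G -> M^-1 <= G -> 0 < Wa -> Wa <= G ->
  `|dW| <= G * k -> `|dW - (g1 * v1 + g2 * v2 + g3 * v3)| <= G * k ^+ 2 ->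
  `|w1| <= k -> `|w2| <= k -> `|w3| <= k ->
  0 < U -> 0 < U' -> 0 <= Q' -> M = L * (U * U) -> L * L * Q = Wa * Wa / c2 - mc ->
  L' * L' * Q' = (Wa + dW) * (Wa + dW) / c2 - mc ->
  (* |a'|^2 = Q / U^4 for both curves, p = M a' *)
  p1 ^+ 2 + p2 ^+ 2 + p3 ^+ 2 = M ^+ 2 * (Q / U ^+ 4) ->
  (p1 / M + w1) ^+ 2 + (p2 / M + w2) ^+ 2 + (p3 / M + w3) ^+ 2 = Q' / U' ^+ 4 ->
  y1 = (Wa / c2 * g1 + n1) / M -> y2 = (Wa / c2 * g2 + n2) / M -> y3 = (Wa / c2 * g3 + n3) / M ->
  L' * Q' / (U' * U') - L * Q / (U * U) <=
   (y1 * v1 + p1 * w1) + (y2 * v2 + p2 * w2) + (y3 * v3 + p3 * w3)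
   - (n1 * v1 + n2 * v2 + n3 * v3) / M + C * k ^+ 2.
Proof.
move=> G0 c20; have G0' := ltW G0.
exists (2 * G + 2 * (G * G * G / c2)); first by rewrite addr_ge0 ?mulr_ge0// invr_ge0 ltW.
move=> k M L' Q' U' L Q U Wa dW g1 g2 g3 w1 w2 w3 v1 v2 v3 p1 p2 p3 y1 y2 y3 n1 n2 n3.
move=> M0 MG MiG W0 WG hdW hrho hw1 hw2 hw3 U0 U'0 Q'0 EM EN EN' Ep Ep' -> -> ->.
have k0 : 0 <= k by apply: le_trans hw1.
have Mn : M != 0 by rewrite gt_eqF.
have Un : U != 0 by rewrite gt_eqF.
have U'n : U' != 0 by rewrite gt_eqF.
have cn : c2 != 0 by rewrite gt_eqF.
set rho := dW - _ in hrho.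
have ww := sum3_sqr_bound hw1 hw2 hw3.
pose E' := Q' / U' ^+ 4; pose N' := L' * L' * Q'.
have S1 : L' * Q' / (U' * U') <= (M * E' + N' / M) / 2.
  rewrite -subr_ge0 (_ : _ - _ = Q' / M * (M / (U' * U') - L') ^+ 2 / 2).
    by rewrite !divr_ge0// mulr_ge0 ?sqr_ge0// divr_ge0// ltW.
  by rewrite /E' /N'; field; rewrite Mn U'n.
have S2 : L * Q / (U * U) = (M * (Q / U ^+ 4) + (L * L * Q) / M) / 2.
  have Ln : L != 0 by apply: contra_neq Mn => L0; rewrite EM L0 mul0r.
  by rewrite EM; field; rewrite Ln Un.
have EQ : M * (Q / U ^+ 4) = (p1 ^+ 2 + p2 ^+ 2 + p3 ^+ 2) / M by rewrite Ep; field; rewrite Mn Un.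
rewrite S2 EQ EN.
move: S1; rewrite /N' EN' /E' -Ep' => S1.
have T1 : M * (w1 ^+ 2 + w2 ^+ 2 + w3 ^+ 2) <= G * (3 * k ^+ 2).
  by apply: ler_pM => //; [exact: ltW|rewrite !addr_ge0 ?sqr_ge0].
have T2 : Wa * rho / c2 / M <= G * (G * k ^+ 2) / c2 * G.
  rewrite (le_trans (ler_norm _))// !normrM !normfV (gtr0_norm W0) (gtr0_norm M0) (gtr0_norm c20).
  rewrite ler_pM ?invr_ge0 ?(ltW M0) ?divr_ge0 ?mulr_ge0 ?(ltW W0) ?(ltW c20)//.
  by rewrite ler_pM2r ?invr_gt0// ler_pM// ltW.
have T3 : dW ^+ 2 / c2 / M <= (G * k) ^+ 2 / c2 * G.
  rewrite ler_pM ?invr_ge0 ?(ltW M0) ?divr_ge0 ?sqr_ge0 ?(ltW c20)//.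
  rewrite ler_pM2r ?invr_gt0// -(real_normK (num_real dW)) lerXn2r ?nnegrE ?mulr_ge0//.
(* The terms of first order form y v + p w minus the work of the multiplier force; the other three
   terms are quadratic in the displacement. *)
have E1 : (M * ((p1 / M + w1) ^+ 2 + (p2 / M + w2) ^+ 2 + (p3 / M + w3) ^+ 2) +
     ((Wa + dW) * (Wa + dW) / c2 - mc) / M) / 2 -
   ((p1 ^+ 2 + p2 ^+ 2 + p3 ^+ 2) / M + (Wa * Wa / c2 - mc) / M) / 2 =
   ((Wa / c2 * g1 + n1) / M * v1 + p1 * w1) + ((Wa / c2 * g2 + n2) / M * v2 + p2 * w2) +
   ((Wa / c2 * g3 + n3) / M * v3 + p3 * w3) - (n1 * v1 + n2 * v2 + n3 * v3) / M
   + M * (w1 ^+ 2 + w2 ^+ 2 + w3 ^+ 2) / 2 + Wa * rho / c2 / M + dW ^+ 2 / c2 / M / 2.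
  by rewrite /rho; field; rewrite Mn cn.
have H1 : G * (G * k ^+ 2) / c2 * G = G * G * G / c2 * k ^+ 2 by field.
have H2 : (G * k) ^+ 2 / c2 * G = G * G * G / c2 * k ^+ 2 by field.
rewrite H1 in T2; rewrite H2 in T3.
have g1' : 0 <= G * k ^+ 2 by rewrite mulr_ge0 ?sqr_ge0.
have g3' : 0 <= G * G * G / c2 * k ^+ 2 by rewrite !mulr_ge0 ?sqr_ge0// invr_ge0 ltW.
by rewrite mulrDl; lra.
Qed.

End VariationAlgebra.

Section Variation.
Variables (R : realType) (b : base R).
Local Notation u0 := (bu b).
Local Notation c := (bc b).
Local Notation m := (bm b).
Local Notation al := (bal b).
Local Notation h := (bh b).
Local Notation tpi := (pi *+ 2 : R).
Local Notation rad := (bu b)^-1.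

Lemma bprod (x y a d : R) : `|x| <= a -> `|y| <= d -> `|x * y| <= a * d.
Proof. by move=> xa yd; rewrite normrM ler_pM. Qed.

Lemma bsum (x y a d : R) : `|x| <= a -> `|y| <= d -> `|x + y| <= a + d.
Proof. by move=> xa yd; rewrite (le_trans (ler_normD _ _))// lerD. Qed.

Lemma bdif (x y a d : R) : `|x| <= a -> `|y| <= d -> `|x - y| <= a + d.
Proof. by move=> xa yd; rewrite (le_trans (ler_normB _ _))// lerD. Qed.

Definition vel1 (t v v1 : R) := - sin t * (u0 + v)^-1 - cos t * (v1 * ((u0 + v)^-1 * (u0 + v)^-1)).
Definition vel2 (t v v1 : R) := cos t * (u0 + v)^-1 - sin t * (v1 * ((u0 + v)^-1 * (u0 + v)^-1)).
Definition vel3 (v v1 z z1 : R) := z1 * (u0 + v)^-1 - z * (v1 * ((u0 + v)^-1 * (u0 + v)^-1)).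

Lemma vel_cmp : exists2 L : R, 0 <= L & forall t v v1 z z1 v' v1' z' z1' k : R,
  `|v| <= u0 / 2 -> `|v'| <= u0 / 2 -> `|v1| <= u0 -> `|v1'| <= u0 -> `|z'| <= u0 -> `|z1'| <= u0 ->
  `|v - v'| <= k -> `|v1 - v1'| <= k -> `|z - z'| <= k -> `|z1 - z1'| <= k ->
  [/\ `|vel1 t v v1 - vel1 t v' v1'| <= L * k, `|vel2 t v v1 - vel2 t v' v1'| <= L * k
    & `|vel3 v v1 z z1 - vel3 v' v1' z' z1'| <= L * k].
Proof.
have u00 := bu_gt0 b; have un : u0 != 0 by rewrite gt_eqF.
pose A := 4 / u0 ^+ 2.
have A0 : 0 <= A by rewrite divr_ge0 ?exprn_ge0 ?ltW.
pose L := 6 * A + 2 / u0 + 7 * (u0 * A).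
have uA : 0 <= u0 * A by rewrite mulr_ge0 ?(ltW u00).
have u2 : 0 <= 2 / u0 by rewrite divr_ge0 ?(ltW u00).
exists L; first by rewrite /L; lra.
move=> t v v1 z z1 v' v1' z' z1' k hv hv' hv1 hv1' hz' hz1' dv dv1 dz dz1.
have k0 : 0 <= k by apply: le_trans dv.
have [U U'] : u0 / 2 <= u0 + v /\ u0 / 2 <= u0 + v'.
  by move/ler_normlP: hv => [? ?]; move/ler_normlP: hv' => [? ?]; split; lra.
have U0 : 0 < u0 + v by lra.
have U'0 : 0 < u0 + v' by lra.
rewrite /vel1 /vel2 /vel3; set i := (u0 + v)^-1; set j := (u0 + v')^-1.
have inv_le x : u0 / 2 <= x -> `|x^-1| <= 2 / u0.
  move=> hx; have x0 : 0 < x by lra.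
  by rewrite gtr0_norm ?invr_gt0// -[leRHS]invf_div lef_pV2 ?posrE// divr_gt0.
have ib : `|i| <= 2 / u0 by exact: inv_le.
have jb : `|j| <= 2 / u0 by exact: inv_le.
have AE : 2 / u0 * (2 / u0) = A by rewrite /A; field.
have ij : `|i - j| <= A * k.
  rewrite (_ : i - j = (v' - v) * (i * j)); last by rewrite /i /j; field; rewrite !gt_eqF.
  by rewrite mulrC -AE bprod ?bprod// distrC.
have ii : `|i * i| <= A by rewrite -AE bprod.
have iijj : `|i * i - j * j| <= A * k * (4 / u0).
  rewrite (_ : i * i - j * j = (i - j) * (i + j)); last by ring.
  by rewrite bprod// (le_trans (bsum ib jb))//; lra.
have vij : `|v1 * (i * i) - v1' * (j * j)| <= 5 * A * k.
  rewrite (_ : _ - _ = (v1 - v1') * (i * i) + v1' * (i * i - j * j)); last by ring.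
  have := bsum (bprod dv1 ii) (bprod hv1' iijj).
  by rewrite (_ : u0 * (A * k * (4 / u0)) = 4 * A * k); [lra|field].
have c1 := cos_norm_le1 t; have s1 := sin_norm_le1 t.
have Ak : 0 <= A * k by rewrite mulr_ge0.
have uAk : 0 <= u0 * A * k by rewrite mulr_ge0.
have u2k : 0 <= 2 / u0 * k by rewrite mulr_ge0.
have EL : L * k = 6 * (A * k) + 2 / u0 * k + 7 * (u0 * A * k) by rewrite /L; ring.
split.
- rewrite (_ : _ - _ = (- sin t) * (i - j) - cos t * (v1 * (i * i) - v1' * (j * j))); last by ring.
  by have := bdif (bprod (_ : `|- sin t| <= 1) ij) (bprod c1 vij); rewrite normrN => /(_ s1); lra.
- rewrite (_ : _ - _ = cos t * (i - j) - sin t * (v1 * (i * i) - v1' * (j * j))); last by ring.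
  by have := bdif (bprod c1 ij) (bprod s1 vij); lra.
rewrite (_ : _ - _ = ((z1 - z1') * i + z1' * (i - j)) -
   ((z - z') * (v1 * (i * i)) + z' * (v1 * (i * i) - v1' * (j * j)))); last by ring.
have := bdif (bsum (bprod dz1 ib) (bprod hz1' ij)) (bsum (bprod dz (bprod hv1 ii)) (bprod hz' vij)).
by rewrite EL; lra.
Qed.

(* First-order effect of a rotation of small angle [f] around the axis
   (k1, k2, 0) on a nearly circular curve. *)
Lemma rotation_numbers (q e f s co k1 k2 a1 a2 a3 y1 y2 y3
    m11 m12 m13 m21 m22 m23 m31 m32 m33 : R) : 0 <= q -> 0 <= e -> e <= 1 -> `|f| <= 1 ->
  `|k1| <= 1 -> `|k2| <= 1 ->
  `|m11 - 1| <= f ^+ 2 -> `|m12| <= f ^+ 2 -> `|m13 - f * k2| <= f ^+ 2 ->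
  `|m21| <= f ^+ 2 -> `|m22 - 1| <= f ^+ 2 -> `|m23 + f * k1| <= f ^+ 2 ->
  `|m31 + f * k2| <= f ^+ 2 -> `|m32 - f * k1| <= f ^+ 2 -> `|m33 - 1| <= f ^+ 2 ->
  `|y1| <= q -> `|y2| <= q -> `|y3| <= q ->
  `|y1 - a1| <= q * (e * `|f|) -> `|y2 - a2| <= q * (e * `|f|) -> `|y3 - a3| <= q * (e * `|f|) ->
  `|y1 - co| <= q * e -> `|y2 - s| <= q * e ->
  [/\ `|m11 * y1 + m12 * y2 + m13 * y3 - a1| <= 7 * q * `|f|,
      `|m21 * y1 + m22 * y2 + m23 * y3 - a2| <= 7 * q * `|f|,
      `|m31 * y1 + m32 * y2 + m33 * y3 - a3| <= 7 * q * `|f| &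
      `|m31 * y1 + m32 * y2 + m33 * y3 - a3 - f * (k1 * s - k2 * co)| <=
         3 * q * (e * `|f| + f ^+ 2)].
Proof.
move=> q0 e0 e1 f1 hk1 hk2 h11 h12 h13 h21 h22 h23 h31 h32 h33 Y1 Y2 Y3 d1 d2 d3 D1 D2.
have f0 := normr_ge0 f.
have f2 : f ^+ 2 <= `|f|.
  by rewrite -(real_normK (num_real f)) expr2 ler_piMr.
have f20 : 0 <= f ^+ 2 by exact: sqr_ge0.
have big (x k : R) : `|k| <= 1 -> `|x| <= f ^+ 2 -> `|x + f * k| <= 2 * `|f|.
  by move=> kk xx; have := bsum xx (bprod (lexx `|f|) kk); lra.
have B13 : `|m13| <= 2 * `|f| by rewrite -(subrK (f * k2) m13) big.
have B23 : `|m23| <= 2 * `|f|.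
  by rewrite (_ : m23 = m23 + f * k1 + f * (- k1)); [rewrite big// normrN|ring].
have B31 : `|m31| <= 2 * `|f|.
  by rewrite (_ : m31 = m31 + f * k2 + f * (- k2)); [rewrite big// normrN|ring].
have B32 : `|m32| <= 2 * `|f| by rewrite -(subrK (f * k1) m32) big.
have qf : 0 <= q * `|f| by rewrite mulr_ge0.
have qe : q * (e * `|f|) <= q * `|f| by rewrite ler_wpM2l// ler_piMl.
have qf2 : q * f ^+ 2 <= q * `|f| by rewrite ler_wpM2l.
have qf20 : 0 <= q * f ^+ 2 by rewrite mulr_ge0.
split.
- rewrite (_ : _ - a1 = (m11 - 1) * y1 + m12 * y2 + m13 * y3 + (y1 - a1)); last by ring.
  by have := bsum (bsum (bsum (bprod h11 Y1) (bprod h12 Y2)) (bprod B13 Y3)) d1; lra.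
- rewrite (_ : _ - a2 = m21 * y1 + (m22 - 1) * y2 + m23 * y3 + (y2 - a2)); last by ring.
  by have := bsum (bsum (bsum (bprod h21 Y1) (bprod h22 Y2)) (bprod B23 Y3)) d2; lra.
- rewrite (_ : _ - a3 = m31 * y1 + m32 * y2 + (m33 - 1) * y3 + (y3 - a3)); last by ring.
  by have := bsum (bsum (bsum (bprod B31 Y1) (bprod B32 Y2)) (bprod h33 Y3)) d3; lra.
rewrite (_ : _ - _ = (m31 + f * k2) * y1 + (m32 - f * k1) * y2 + (m33 - 1) * y3 + (y3 - a3)
   + f * (k1 * (y2 - s) - k2 * (y1 - co))); last by ring.
have := bsum (bsum (bsum (bsum (bprod h31 Y1) (bprod h32 Y2)) (bprod h33 Y3)) d3)
  (bprod (lexx `|f|) (bdif (bprod hk1 D2) (bprod hk2 D1))).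
by lra.
Qed.

(* [(l1, l2, 0) x a'] against the displacement [v], compared with the circle. *)
Lemma torque_numbers (q e f s co w l1 l2 p1 p2 p3 v1 v2 v3 : R) : 0 <= q -> 0 <= e -> e <= 1 ->
  `|s| <= q -> `|co| <= q -> `|w| <= 7 * q * `|f| ->
  `|p1 + s| <= q * e -> `|p2 - co| <= q * e -> `|p3| <= q * e ->
  `|v1| <= 7 * q * `|f| -> `|v2| <= 7 * q * `|f| -> `|v3| <= 7 * q * `|f| ->
  `|v3 - w| <= 3 * q * (e * `|f| + f ^+ 2) ->
  `|l2 * p3 * v1 + - (l1 * p3) * v2 + (l1 * p2 - l2 * p1) * v3 - (l1 * co + l2 * s) * w| <=
   (`|l1| + `|l2|) * (17 * q ^+ 2 * (e * `|f| + f ^+ 2)).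
Proof.
move=> q0 e0 e1 sq coq ww P1 P2 P3 V1 V2 V3 VW.
have f0 := normr_ge0 f.
have q20 : 0 <= q ^+ 2 * f ^+ 2 by rewrite mulr_ge0 ?sqr_ge0.
rewrite (_ : _ - _ = l1 * ((p2 - co) * v3 + co * (v3 - w) - p3 * v2)
   + l2 * (p3 * v1 - (p1 + s) * v3 + s * (v3 - w))); last by ring.
have x1 := bdif (bsum (bprod P2 V3) (bprod coq VW)) (bprod P3 V2).
have x2 := bsum (bdif (bprod P3 V1) (bprod P1 V3)) (bprod sq VW).
have E : q * e * (7 * q * `|f|) + q * (3 * q * (e * `|f| + f ^+ 2)) + q * e * (7 * q * `|f|)
   <= 17 * q ^+ 2 * (e * `|f| + f ^+ 2) by lra.
have E' : q * e * (7 * q * `|f|) + q * e * (7 * q * `|f|) + q * (3 * q * (e * `|f| + f ^+ 2))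
   <= 17 * q ^+ 2 * (e * `|f| + f ^+ 2) by lra.
rewrite [leRHS]mulrDl; apply: bsum; apply: bprod => //; [exact: le_trans x1 E|exact: le_trans x2 E'].
Qed.

(** The integral from 0 to 2 pi, taken as the value at 2 pi of a primitive vanishing at 0, the form
    in which derivative bounds apply to it. *)
Definition integral (f : R -> R) : R :=
  xget 0 [set v | exists F : R -> R, [/\ F 0 = 0, forall x, der F x (f x) & v = F tpi]].

Lemma integralP (f : R -> R) : continuous f ->
  exists F : R -> R, [/\ F 0 = 0, forall x, der F x (f x) & integral f = F tpi].
Proof.
move=> cf; rewrite /integral; case: xgetP => [v _ //|H].
have [F [F0 dF]] := primitive_ex cf.
by exfalso; apply: (H (F tpi)); exists F.
Qed.

End Variation.

Section ActionVariation.
Variables (R : realType) (b : base R).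
Local Notation u0 := (bu b).
Local Notation c := (bc b).
Local Notation m := (bm b).
Local Notation al := (bal b).
Local Notation h := (bh b).
Local Notation tpi := (pi *+ 2 : R).
Local Notation rad := (bu b)^-1.

Definition opos (eps : R) P o := forall t,
  [/\ u0 / 2 <= sU b (ost b eps P o t), 0 < sW b (ost b eps P o t),
  0 < sN b (ost b eps P o t) & 0 < sQ b (ost b eps P o t)].

Lemma velE eps P o t : opos eps P o ->
  [/\ pm1 b eps P o t / sM b (ost b eps P o t) = vel1 b t (ov o t) (ov1 o t),
      pm2 b eps P o t / sM b (ost b eps P o t) = vel2 b t (ov o t) (ov1 o t) &
      pm3 b eps P o t / sM b (ost b eps P o t) = vel3 b (ov o t) (ov1 o t) (oz o t) (oz1 o t)].
Proof.
move=> pos; have un : sU b (ost b eps P o t) != 0 by rewrite gt_eqF ?(oU_gt0 pos).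
have ln : sL b (ost b eps P o t) != 0 by rewrite gt_eqF ?(oL_gt0 pos).
rewrite /pm1 /pm2 /pm3 /sM /vel1 /vel2 /vel3.
rewrite (_ : sZ b (ost b eps P o t) = oz1 o t * sU b (ost b eps P o t) - oz o t * ov1 o t)//.
rewrite -[u0 + ov o t]/(sU b (ost b eps P o t)).
by split; field; rewrite un ln.
Qed.

Lemma orbit_regular (B rho C : R) : 0 <= B -> 0 < rho -> 0 <= C ->
  exists e0 q : R, [/\ 0 < e0, e0 <= 1, 1 <= q & forall P (eps : R) o, pert b B rho P -> `|eps| <= e0 ->
    is_orbit b eps P (C * `|eps|) o ->
    [/\ small b (rho / 2) (C * `|eps|), opos eps P o &
    forall t,
    [/\ sM b (ost b eps P o t) <= q, (sM b (ost b eps P o t))^-1 <= q,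
        sW b (ost b eps P o t) <= q & rinv b eps P o t <= q] /\
    [/\ `|px1 b o t - rad * cos t| <= q * `|eps|, `|px2 b o t - rad * sin t| <= q * `|eps| &
        `|px3 b o t| <= q * `|eps|] /\
    [/\ `|pm1 b eps P o t / sM b (ost b eps P o t) + rad * sin t| <= q * `|eps|,
        `|pm2 b eps P o t / sM b (ost b eps P o t) - rad * cos t| <= q * `|eps| &
        `|pm3 b eps P o t / sM b (ost b eps P o t)| <= q * `|eps|]]].
Proof.
move=> B0 rho0 C0; have u00 := bu_gt0 b; have un : u0 != 0 by rewrite gt_eqF.
have pl := pos_lip_gt0 b.
have [r1 r10 Hpos] := state_pos b.
have M00 : 0 < bl b * u0 ^+ 2 by rewrite mulr_gt0 ?exprn_gt0 ?bl_gt0.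
have W00 := bW_gt0 b.
have [LM sM'] := sdiff_M b.
have [|r2 r20 HM] := sdiff_near sM' (e := bl b * u0 ^+ 2 / 2); first by rewrite divr_gt0.
have [|r3 r30 HW] := sdiff_near (sdiff_W b) (e := 1); first by [].
have rm0 : 0 < Num.min r1 (Num.min r2 r3) by rewrite !lt_min r10 r20.
have [e1 [D [e10 D0 Hsm]]] := @orbit_small R b B rho C _ B0 rho0 C0 rm0.
have [L L0 HL] := vel_cmp b.
pose q := 1 + 2 * (bl b * u0 ^+ 2) + 2 / (bl b * u0 ^+ 2) + (h + al * u0 + 1) + 2 * u0 + pos_lip b * C + L * C.
have t1 : 0 <= 2 / (bl b * u0 ^+ 2) by rewrite divr_ge0// ltW.
have t2 : 0 <= pos_lip b * C by rewrite mulr_ge0// ltW.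
have t3 : 0 <= L * C by rewrite mulr_ge0.
exists (Num.min e1 1), q; split.
- by rewrite lt_min e10 ltr01.
- by rewrite ge_min lexx orbT.
- by rewrite /q; lra.
move=> P eps o Pp epse ob.
have ee1 : `|eps| <= e1 by rewrite (le_trans epse)// ge_min lexx.
have ee2 : `|eps| <= 1 by rewrite (le_trans epse)// ge_min lexx orbT.
have eps0 := normr_ge0 eps.
have [sk Hb] := Hsm P eps o Pp ee1 ob.
have inb r t : Num.min r1 (Num.min r2 r3) <= r -> ball0 r (ost b eps P o t).
  by move=> hr; have [h1 h2] := Hb t; apply: ball0W h1; apply: le_trans hr.
have pos : opos eps P o by move=> t; apply: Hpos; apply: inb; rewrite ge_min lexx.
have [kk0 ku kr] := sk.
split=> // t.
have [b1 b2 b3 b4] : [/\ `|ov o t| <= C * `|eps|, `|ov1 o t| <= C * `|eps|,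
   `|oz o t| <= C * `|eps| & `|oz1 o t| <= C * `|eps|] by case: ob => _ [].
have hM := HM _ (inb _ t (_ : _ <= r2)); have hW := HW _ (inb _ t (_ : _ <= r3)).
have {}hM := hM ltac:(by rewrite !ge_min lexx orbT).
have {}hW := hW ltac:(by rewrite !ge_min lexx !orbT).
have q1 : pos_lip b * C <= q by rewrite /q; lra.
have q2 : L * C <= q by rewrite /q; lra.
have scale (x K : R) : K * C <= q -> x <= K * (C * `|eps|) -> x <= q * `|eps|.
  by move=> Kq xK; rewrite (le_trans xK)// mulrA ler_wpM2r.
split.
  move/ler_normlP: hM => [M1 M2]; move/ler_normlP: hW => [W1 W2].
  split.
  - by rewrite /q; lra.
  - have M2' : bl b * u0 ^+ 2 / 2 <= sM b (ost b eps P o t) by lra.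
    have M0' : 0 < bl b * u0 ^+ 2 / 2 by lra.
    apply: (@le_trans _ _ (2 / (bl b * u0 ^+ 2))); last by rewrite /q; lra.
    by rewrite -[leRHS]invf_div lef_pV2 ?posrE// (lt_le_trans M0').
  - by rewrite /q; lra.
  - have S1 : sS (ost b eps P o t) <= 1.
      rewrite /sS invf_le1 ?sqrtr_gt0 ?ltr_pwDl// -?expr2 ?sqr_ge0//.
      by rewrite -[leLHS]sqrtr1 ler_wsqrtr// lerDl sqr_ge0.
    have U1 : sU b (ost b eps P o t) <= 2 * u0.
      by have /ler_normlP[] := b1; rewrite /sU -[ost b eps P o t 0%N]/(ov o t); lra.
    apply: (@le_trans _ _ (2 * u0)); last by rewrite /q; lra.
    rewrite /rinv -[leRHS]mulr1; apply: ler_pM => //; apply: ltW.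
      exact: oU_gt0 pos t.
    exact: oS_gt0.
split.
  have [n1 n2 n3] := pos_near t (le_trans b1 ku) b1 b3.
  by split; apply: scale q1 _.
have h0 : `|0 : R| <= u0 / 2 by rewrite normr0 divr_ge0// ltW.
have h1 : `|0 : R| <= u0 by rewrite normr0 ltW.
have bu1 : `|ov1 o t| <= u0 by lra.
have [w1 w2 w3] : [/\ `|vel1 b t (ov o t) (ov1 o t) - vel1 b t 0 0| <= L * (C * `|eps|),
   `|vel2 b t (ov o t) (ov1 o t) - vel2 b t 0 0| <= L * (C * `|eps|) &
   `|vel3 b (ov o t) (ov1 o t) (oz o t) (oz1 o t) - vel3 b 0 0 0 0| <= L * (C * `|eps|)].
  by apply: HL; rewrite ?subr0//; exact: le_trans ku.
have [-> -> ->] := velE t pos.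
have z1 : vel1 b t 0 0 = - (rad * sin t) by rewrite /vel1 addr0; field.
have z2 : vel2 b t 0 0 = rad * cos t by rewrite /vel2 addr0; field.
have z3 : vel3 b 0 0 0 0 = 0 by rewrite /vel3 !mul0r subrr.
move: w1 w2 w3; rewrite z1 z2 z3 opprK subr0 => w1 w2 w3.
by split; apply: scale q2 _.
Qed.

Lemma action_continuous (B rho eps k : R) P o : pert b B rho P -> 0 <= B -> 0 < rho ->
  small b (rho / 2) k -> is_orbit b eps P k o -> opos eps P o ->
  continuous (fun t => sA b (ost b eps P o t)).
Proof.
move=> Pp B0 rho0 sk ob pos; apply: der_continuous => t.
have dL := der_L Pp B0 rho0 sk ob pos t.
have dU := der_U ob t.
have dZ := der_Z ob t.
have [a dv] : exists a, der (ov1 o) t a by eexists; exact: (lin_v1 ob.1).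
have un : sU b (ost b eps P o t) * sU b (ost b eps P o t) != 0.
  by rewrite mulf_neq0 ?gt_eqF ?(oU_gt0 pos).
have dQ := derD (derD (derM dv dv) (derM dU dU)) (derM dZ dZ).
eexists; exact: (derM (derM dL dQ) (@derV _ (fun s => (u0 + ov o s) * (u0 + ov o s)) _ _ un (derM dU dU))).
Qed.

End ActionVariation.

Section FirstVariation.
Variables (R : realType) (b : base R).
Local Notation u0 := (bu b).
Local Notation c := (bc b).
Local Notation m := (bm b).
Local Notation al := (bal b).
Local Notation h := (bh b).
Local Notation tpi := (pi *+ 2 : R).
Local Notation rad := (bu b)^-1.

Lemma oboundedW (k k' : R) (o : orbit R) : k <= k' -> obounded k o -> obounded k' o.
Proof.
move=> kk' [h1 h2 h3]; split; [|exact: le_trans kk'|exact: le_trans kk'].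
by move=> t; have [? ? ? ?] := h1 t; split; apply: le_trans kk'.
Qed.

(* [(m_ij)] is a rotation of angle [f] around the axis (k1, k2, 0), up to [f ^+ 2]. *)
Definition near_rotation (f k1 k2 m11 m12 m13 m21 m22 m23 m31 m32 m33 : R) :=
  [/\ [/\ `|k1| <= 1 & `|k2| <= 1],
      [/\ `|m11 - 1| <= f ^+ 2, `|m12| <= f ^+ 2 & `|m13 - f * k2| <= f ^+ 2],
      [/\ `|m21| <= f ^+ 2, `|m22 - 1| <= f ^+ 2 & `|m23 + f * k1| <= f ^+ 2],
      [/\ `|m31 + f * k2| <= f ^+ 2, `|m32 - f * k1| <= f ^+ 2 & `|m33 - 1| <= f ^+ 2] &
      forall y1 y2 y3 : R, (m11 * y1 + m12 * y2 + m13 * y3) ^+ 2 + (m21 * y1 + m22 * y2 + m23 * y3) ^+ 2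
        + (m31 * y1 + m32 * y2 + m33 * y3) ^+ 2 = y1 ^+ 2 + y2 ^+ 2 + y3 ^+ 2].

Definition action (eps : R) P o := integral (fun t => sA b (ost b eps P o t)).

(** The orbit in the rotated potential, turned by (m_ij), is a curve of equal action in the original
    potential, and can be compared with [o]. In the bound of [action_pointwise] the terms y v + p w
    are an exact derivative and vanish over a period; the work of the multipliers on an
    infinitesimal rotation of the circle remains. An upper bound is enough, since it is tested at a
    minimum. *)
Lemma action_variation (B rho C D : R) : 0 <= B -> 0 < rho -> 0 <= C -> 0 <= D ->
  exists e1 f1 C1 C2 : R, [/\ 0 < e1, 0 < f1, 0 <= C1, 0 <= C2 &
  forall P P' (eps : R) o o' (f k1 k2 m11 m12 m13 m21 m22 m23 m31 m32 m33 : R),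
   pert b B rho P -> pert b B rho P' -> `|eps| <= e1 ->
   is_orbit b eps P (C * `|eps|) o -> is_orbit b eps P' (C * `|eps|) o' ->
   `|f| <= f1 -> near_rotation f k1 k2 m11 m12 m13 m21 m22 m23 m31 m32 m33 ->
   (forall y1 y2 y3, P' 0%N y1 y2 y3 = P 0%N (m11 * y1 + m12 * y2 + m13 * y3)
      (m21 * y1 + m22 * y2 + m23 * y3) (m31 * y1 + m32 * y2 + m33 * y3)) ->
   (forall j t x1 x2 x3, near_circle b t rho x1 x2 x3 ->
      `|P' j x1 x2 x3 - P j x1 x2 x3| <= D * `|f|) ->
   action eps P' o' - action eps P o <= f * (rad ^+ 2 * pi) * (k2 * ol1 o - k1 * ol2 o)
     + C1 * (`|eps| * (`|ol1 o| + `|ol2 o|) * `|f|) + C2 * f ^+ 2].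
Proof.
move=> B0 rho0 C0 D0.
have u00 := bu_gt0 b; have un : u0 != 0 by rewrite gt_eqF.
have al0 := bal_gt0 b; have c0 := bc_gt0 b; have pl := pos_lip_gt0 b.
have rad0 : 0 < rad by rewrite invr_gt0.
have c20 : 0 < c ^+ 2 by rewrite exprn_gt0.
have [e0 [q0 [e00 e01 q01 Hreg]]] := @orbit_regular R b B rho C B0 rho0 C0.
have [kd [ed [Cd [kd0 ed0 Cd0 Hdiff]]]] := @orbit_diff R b B rho B0 rho0.
have [VL VL0 Hvel] := vel_cmp b.
pose q := q0 + rad + (pos_lip b + VL) * (Cd * D).
have CdD : 0 <= Cd * D by rewrite mulr_ge0.
have qd0 : 0 <= (pos_lip b + VL) * (Cd * D) by rewrite mulr_ge0// addr_ge0// ltW.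
have q1 : 1 <= q by rewrite /q; clear -q01 rad0 qd0; lra.
have q0' : 0 < q by exact: lt_le_trans ltr01 q1.
have [Ct Ct0 Htay] := inv_dist_taylor q0'.
pose G := q + al * Ct + B.
have alCt : 0 <= al * Ct by rewrite mulr_ge0 ?(ltW al0).
have G0 : 0 < G by rewrite /G; clear -q0' alCt B0; lra.
have [Cp Cp0 Hpt] := @action_pointwise R G (c ^+ 2) ((m * c) ^+ 2) G0 c20.
(* The displacement is at most 7 q |f|; it has to stay below 1 for the expansion of the inverse
   distance and below rho / 2 for the potential. *)
pose f1 := Num.min 1 (Num.min ((7 * q)^-1) (rho / 2 / (7 * q))).
have q7 : 0 < 7 * q by exact: mulr_gt0.
have f10 : 0 < f1.
  by rewrite !lt_min ltr01 invr_gt0 q7 /= divr_gt0// divr_gt0.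
pose e1 := Num.min e0 (Num.min ed (kd / (C + 1))).
have C10 : 0 < C + 1 by rewrite ltr_wpDl.
have e10 : 0 < e1 by rewrite !lt_min e00 ed0 divr_gt0.
have tp := tpi_gt0 R.
(* Coefficient of f^2: the quadratic part of the torque estimate, where |l1| + |l2| <= 2 C, and the
   remainder Cp k^2 with k = 7 q |f|. *)
pose E2 := 17 * q ^+ 2 * (2 * C) + Cp * (49 * q ^+ 2).
have q20 : 0 <= q ^+ 2 by exact: sqr_ge0.
have tp' := ltW tp.
have E20 : 0 <= E2 by apply: addr_ge0; do ?[apply: mulr_ge0 => //].
exists e1, f1, (tpi * (17 * q ^+ 2)), (tpi * E2); split=> //.
- by do ?[apply: mulr_ge0 => //].
- exact: mulr_ge0.
move=> P P' eps o o' f k1 k2 m11 m12 m13 m21 m22 m23 m31 m32 m33.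
move=> Pp Pp' epse ob ob' ff [[hk1 hk2] [h11 h12 h13] [h21 h22 h23] [h31 h32 h33] orth] P0 PP.
have ee0 : `|eps| <= e0 by rewrite (le_trans epse)// ge_min lexx.
have eed : `|eps| <= ed by rewrite (le_trans epse)// !ge_min lexx orbT.
have eek : `|eps| <= kd / (C + 1) by rewrite (le_trans epse)// !ge_min lexx !orbT.
have e_1 : `|eps| <= 1 by apply: le_trans e01.
have eps0 := normr_ge0 eps; have f0 := normr_ge0 f.
have ff1 : `|f| <= 1 by rewrite (le_trans ff)// ge_min lexx.
have ff2 : 7 * q * `|f| <= 1.
  by rewrite mulrC -ler_pdivlMr// div1r (le_trans ff)// !ge_min lexx orbT.
have ff3 : 7 * q * `|f| <= rho / 2.
  by rewrite mulrC -ler_pdivlMr// (le_trans ff)// !ge_min lexx !orbT.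
have Ckd : C * `|eps| <= kd.
  by move: eek; rewrite ler_pdivlMr//; clear -eps0; lra.
have [sk pos reg] := Hreg P eps o Pp ee0 ob.
have [sk' pos' reg'] := Hreg P' eps o' Pp' ee0 ob'.
have fsq : `|f| ^+ 2 = f ^+ 2 by exact: real_normK (num_real f).
(* The two orbits differ by O(eps f) only, so at first order in f the displacement is that of the
   rotation. *)
have obd : obounded (Cd * (`|eps| * (D * `|f|))) (osub o' o).
  apply: (Hdiff P' P eps) => //.
  - by rewrite mulr_ge0.
  - by split; [exact: ob'.1|exact: oboundedW Ckd ob'.2].
  - by split; [exact: ob.1|exact: oboundedW Ckd ob.2].
have {}obd : obounded (Cd * D * (`|eps| * `|f|)) (osub o' o).
  by rewrite (_ : Cd * D * _ = Cd * (`|eps| * (D * `|f|)))//; ring.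
have ef0 : 0 <= `|eps| * `|f| by rewrite mulr_ge0.
have le_q (K x : R) : K <= (pos_lip b + VL) -> x <= K * (Cd * D * (`|eps| * `|f|)) ->
    x <= q * (`|eps| * `|f|).
  move=> HK /le_trans; apply; rewrite !mulrA -(mulrA (K * Cd * D)) -(mulrA q) ler_wpM2r//.
  apply: (@le_trans _ _ ((pos_lip b + VL) * (Cd * D))); last by rewrite /q lerDr; clear -q01 rad0; lra.
  by rewrite -mulrA ler_wpM2r.
have le_q0 x : x <= q0 * `|eps| -> x <= q * `|eps|.
  by move=> /le_trans; apply; rewrite ler_wpM2r// /q -addrA lerDl; clear -rad0 qd0; lra.
pose X := ost b eps P o; pose X' := ost b eps P' o'.
pose M t := sM b (X t); pose M' t := sM b (X' t).
pose b1 t := m11 * px1 b o' t + m12 * px2 b o' t + m13 * px3 b o' t.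
pose b2 t := m21 * px1 b o' t + m22 * px2 b o' t + m23 * px3 b o' t.
pose b3 t := m31 * px1 b o' t + m32 * px2 b o' t + m33 * px3 b o' t.
pose v1 t := b1 t - px1 b o t; pose v2 t := b2 t - px2 b o t; pose v3 t := b3 t - px3 b o t.
pose y1 t := pm1 b eps P' o' t / M' t; pose y2 t := pm2 b eps P' o' t / M' t.
pose y3 t := pm3 b eps P' o' t / M' t.
pose w1 t := m11 * y1 t + m12 * y2 t + m13 * y3 t - pm1 b eps P o t / M t.
pose w2 t := m21 * y1 t + m22 * y2 t + m23 * y3 t - pm2 b eps P o t / M t.
pose w3 t := m31 * y1 t + m32 * y2 t + m33 * y3 t - pm3 b eps P o t / M t.
have dv1 t : der v1 t (w1 t).
  exact: (derB (derD (derD (derZ m11 (der_px1 ob' pos' t)) (derZ m12 (der_px2 ob' pos' t)))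
    (derZ m13 (der_px3 ob' pos' t))) (der_px1 ob pos t)).
have dv2 t : der v2 t (w2 t).
  exact: (derB (derD (derD (derZ m21 (der_px1 ob' pos' t)) (derZ m22 (der_px2 ob' pos' t)))
    (derZ m23 (der_px3 ob' pos' t))) (der_px2 ob pos t)).
have dv3 t : der v3 t (w3 t).
  exact: (derB (derD (derD (derZ m31 (der_px1 ob' pos' t)) (derZ m32 (der_px2 ob' pos' t)))
    (derZ m33 (der_px3 ob' pos' t))) (der_px3 ob pos t)).
have dp1 := der_pm1 Pp B0 rho0 sk ob pos.
have dp2 := der_pm2 Pp B0 rho0 sk ob pos.
have dp3 := der_pm3 Pp B0 rho0 sk ob pos.
pose z1 t := (force b eps P o t 1 (px1 b o t) + magn1 b eps P o t) / M t.
pose z2 t := (force b eps P o t 2 (px2 b o t) + magn2 b eps P o t) / M t.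
pose z3 t := (force b eps P o t 3 (px3 b o t) + magn3 b eps P o t) / M t.
pose S t := (z1 t * v1 t + pm1 b eps P o t * w1 t) + (z2 t * v2 t + pm2 b eps P o t * w2 t)
   + (z3 t * v3 t + pm3 b eps P o t * w3 t).
pose l1 := ol1 o; pose l2 := ol2 o.
(* Minus the scalar product of the multiplier force on the unperturbed circle with the displacement
   due to the rotation. *)
pose main t := - ((l1 * (rad * cos t) + l2 * (rad * sin t)) *
   (f * (k1 * (rad * sin t) - k2 * (rad * cos t)))).
pose E := 17 * q ^+ 2 * (`|eps| * (`|l1| + `|l2|) * `|f|) + E2 * f ^+ 2.
have bound t : sA b (X' t) - sA b (X t) - S t - main t <= E.
  have [[rM riM rW rr] [[rx1 rx2 rx3] [rp1 rp2 rp3]]] := reg t.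
  have [[_ _ _ rr'] [[rx1' rx2' rx3'] [rp1' rp2' rp3']]] := reg' t.
  have [[ov1b _ ozb _] _ _] : [/\ [/\ `|ov o t| <= C * `|eps|, `|ov1 o t| <= C * `|eps|,
     `|oz o t| <= C * `|eps| & `|oz1 o t| <= C * `|eps|], `|ol1 o| <= C * `|eps| & `|ol2 o| <= C * `|eps|].
    by case: ob => _ [ok h2 h3]; split=> //; exact: ok.
  have [ok okl1 okl2] := ob.2; have [ok' _ _] := ob'.2; have [od _ _] := obd.
  have [a_1 a_2 a_3 a_4] := ok t; have [b_1 b_2 b_3 b_4] := ok' t; have [d_1 d_2 d_3 d_4] := od t.
  have [kk0 ku kr] := sk.
  have le_u (x : R) : x <= C * `|eps| -> x <= u0 by move=> hx; clear -hx ku u00; lra.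
  have [p1 p2 p3] := pos_cmp t (le_trans b_1 ku) (le_trans a_1 ku) (le_u _ a_3) d_1 d_3.
  have [n1 n2 n3] := Hvel t _ _ _ _ _ _ _ _ _ (le_trans b_1 ku) (le_trans a_1 ku)
     (le_u _ b_2) (le_u _ a_2) (le_u _ a_3) (le_u _ a_4) d_1 d_2 d_3 d_4.
  have [V1 V2 V3] := velE t pos; have [V1' V2' V3'] := velE t pos'.
  rewrite -V1 -V1' in n1; rewrite -V2 -V2' in n2; rewrite -V3 -V3' in n3.
  have plV : pos_lip b <= pos_lip b + VL by rewrite lerDl.
  have VLp : VL <= pos_lip b + VL by rewrite lerDr ltW.
  have near_q (x a : R) : `|a| <= 1 -> `|x - rad * a| <= q0 * `|eps| -> `|x| <= q.
    move=> a1 xa; rewrite -(subrK (rad * a) x).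
    have := bsum xa (bprod (_ : `|rad| <= rad) a1); rewrite ger0_norm ?(ltW rad0)// => /(_ (lexx _)).
    have : q0 * `|eps| <= q0 by rewrite ler_piMr// (le_trans ler01).
    by rewrite /q; clear -qd0; lra.
  have c1 := cos_norm_le1 t; have s1 := sin_norm_le1 t; have z_1 : `|0 : R| <= 1 by rewrite normr0.
  have cq : `|rad * cos t| <= q by apply: (near_q _ (cos t)) => //; rewrite subrr normr0 mulr_ge0// (le_trans ler01).
  have sq : `|rad * sin t| <= q by apply: (near_q _ (sin t)) => //; rewrite subrr normr0 mulr_ge0// (le_trans ler01).
  have rx3'0 : `|px3 b o' t - rad * 0| <= q0 * `|eps| by rewrite mulr0 subr0.
  have rx30 : `|px3 b o t - rad * 0| <= q0 * `|eps| by rewrite mulr0 subr0.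
  have rp3'0 : `|pm3 b eps P' o' t / M' t - rad * 0| <= q0 * `|eps| by rewrite mulr0 subr0.
  have ms1 : `|- sin t| <= 1 by rewrite normrN.
  have rp1'0 : `|pm1 b eps P' o' t / M' t - rad * - sin t| <= q0 * `|eps| by rewrite mulrN opprK.
  have [vk1 vk2 vk3 vw] : [/\ `|v1 t| <= 7 * q * `|f|, `|v2 t| <= 7 * q * `|f|, `|v3 t| <= 7 * q * `|f| &
      `|v3 t - f * (k1 * (rad * sin t) - k2 * (rad * cos t))| <= 3 * q * (`|eps| * `|f| + f ^+ 2)]
    := rotation_numbers (ltW q0') eps0 e_1 ff1 hk1 hk2 h11 h12 h13 h21 h22 h23
    h31 h32 h33 (near_q _ _ c1 rx1') (near_q _ _ s1 rx2') (near_q _ _ z_1 rx3'0)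
    (le_q _ _ plV p1) (le_q _ _ plV p2) (le_q _ _ plV p3) (le_q0 _ rx1') (le_q0 _ rx2').
  have [wk1 wk2 wk3 _] : [/\ `|w1 t| <= 7 * q * `|f|, `|w2 t| <= 7 * q * `|f|, `|w3 t| <= 7 * q * `|f| & _]
    := rotation_numbers (ltW q0') eps0 e_1 ff1 hk1 hk2 h11 h12 h13 h21 h22 h23
    h31 h32 h33 (near_q _ _ ms1 rp1'0) (near_q _ _ c1 rp2') (near_q _ _ z_1 rp3'0)
    (le_q _ _ VLp n1) (le_q _ _ VLp n2) (le_q _ _ VLp n3) (le_q0 _ rp1'0) (le_q0 _ rp2').
  pose w := f * (k1 * (rad * sin t) - k2 * (rad * cos t)).
  have ww : `|w| <= 7 * q * `|f|.
    have := bprod (lexx `|f|) (bdif (bprod hk1 sq) (bprod hk2 cq)).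
    have : 0 <= q * `|f| by rewrite mulr_ge0// ltW.
    by rewrite /w; clear; lra.
  have tq := torque_numbers l1 l2 (ltW q0') eps0 e_1 sq cq ww (le_q0 _ rp1) (le_q0 _ rp2) (le_q0 _ rp3)
    vk1 vk2 vk3 vw.
  pose k := 7 * q * `|f|.
  have k0 : 0 <= k by rewrite mulr_ge0// ltW.
  have na := near_orbit sk ob t.
  have nb : near_circle b t rho (b1 t) (b2 t) (b3 t).
    case: na => na1 na2 na3.
    have tri (x y z : R) : `|x - y| <= k -> `|y - z| <= rho / 2 -> `|x - z| <= rho.
      move=> xy yz; rewrite -(subrK y x) -addrA.
      by have := bsum xy yz; rewrite /k; move: ff3; clear; lra.
    split; [exact: tri vk1 na1|exact: tri vk2 na2|].
    by rewrite -[b3 t]subr0; apply: tri vk3 _; rewrite subr0.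
  have na' : near_circle b t rho (px1 b o t) (px2 b o t) (px3 b o t) by apply: near_circleW na; clear -rho0; lra.
  have [_ PL PT] := Pp _ _ _ _ _ _ _ _ nb na' vk1 vk2 vk3.
  have rE := rinvE pos t; have rE' := rinvE pos' t.
  have rp := rinv_gt0 pos t; have rp' := rinv_gt0 pos' t.
  have q0q : q0 <= q by rewrite /q -addrA lerDl; clear -rad0 qd0; lra.
  have hrb : rinv b eps P' o' t ^+ 2 * ((px1 b o t + v1 t) ^+ 2 + (px2 b o t + v2 t) ^+ 2 + (px3 b o t + v3 t) ^+ 2) = 1.
    rewrite (_ : px1 b o t + v1 t = b1 t); last by rewrite /v1 addrC subrK.
    rewrite (_ : px2 b o t + v2 t = b2 t); last by rewrite /v2 addrC subrK.
    rewrite (_ : px3 b o t + v3 t = b3 t); last by rewrite /v3 addrC subrK.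
    by rewrite orth.
  have [dr dr2] := Htay (px1 b o t) (px2 b o t) (px3 b o t) (v1 t) (v2 t) (v3 t) _ _ k rp rp'
    (le_trans rr q0q) (le_trans rr' q0q) rE
    hrb
    (near_q _ _ c1 rx1) (near_q _ _ s1 rx2) (near_q _ _ z_1 rx30) vk1 vk2 vk3 ff2.
  pose dW := sW b (X' t) - sW b (X t).
  have dWE : dW = al * (rinv b eps P' o' t - rinv b eps P o t)
      + eps * (P 0%N (b1 t) (b2 t) (b3 t) - P 0%N (px1 b o t) (px2 b o t) (px3 b o t)).
    by rewrite /dW /X /X' !oWE P0 -/(b1 t) -/(b2 t) -/(b3 t); ring.
  have kk2 : 0 <= k ^+ 2 by exact: sqr_ge0.
  have dW1 : `|dW| <= G * k.
    rewrite dWE.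
    have := bsum (bprod (lexx `|al|) dr) (bprod e_1 (PL 0%N)).
    have : 0 <= q * k by rewrite mulr_ge0// ltW.
    by rewrite (gtr0_norm al0) /G /k; clear; lra.
  have dW2 : `|dW - ((- (al * rinv b eps P o t ^+ 3 * px1 b o t) + eps * P 1%N (px1 b o t) (px2 b o t) (px3 b o t)) * v1 t
     + (- (al * rinv b eps P o t ^+ 3 * px2 b o t) + eps * P 2 (px1 b o t) (px2 b o t) (px3 b o t)) * v2 t
     + (- (al * rinv b eps P o t ^+ 3 * px3 b o t) + eps * P 3 (px1 b o t) (px2 b o t) (px3 b o t)) * v3 t)| <= G * k ^+ 2.
    have := bsum (bprod (lexx `|al|) dr2) (bprod e_1 PT).
    have : 0 <= q * k ^+ 2 by rewrite mulr_ge0// ltW.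
    rewrite (gtr0_norm al0) dWE => g1 g2.
    rewrite (_ : _ - _ = al * (rinv b eps P' o' t - rinv b eps P o t + rinv b eps P o t ^+ 3 *
      (px1 b o t * v1 t + px2 b o t * v2 t + px3 b o t * v3 t)) + eps *
      (P 0%N (b1 t) (b2 t) (b3 t) - P 0%N (px1 b o t) (px2 b o t) (px3 b o t) -
      (P 1%N (px1 b o t) (px2 b o t) (px3 b o t) * (b1 t - px1 b o t) +
       P 2 (px1 b o t) (px2 b o t) (px3 b o t) * (b2 t - px2 b o t) +
       P 3 (px1 b o t) (px2 b o t) (px3 b o t) * (b3 t - px3 b o t)))); last by rewrite /v1 /v2 /v3; ring.
    by move: g1 g2; rewrite /G /k; clear; lra.
  have Mp := oM_gt0 pos t; have Up := oU_gt0 pos t; have Up' := oU_gt0 pos' t.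
  have Lp := oL_gt0 pos t; have Lp' := oL_gt0 pos' t.
  have [_ Wp _ Qp] := pos t; have [_ _ _ Qp'] := pos' t.
  have qG : q <= G by rewrite /G -addrA lerDl; clear -alCt B0; lra.
  have q0G := le_trans q0q qG.
  have NE : sL b (X t) * sL b (X t) * sQ b (X t) = sW b (X t) * sW b (X t) / c ^+ 2 - (m * c) ^+ 2.
    by rewrite /X (oL_sqr pos) /sL2 divfK ?gt_eqF.
  have NE' : sL b (X' t) * sL b (X' t) * sQ b (X' t) =
      (sW b (X t) + dW) * (sW b (X t) + dW) / c ^+ 2 - (m * c) ^+ 2.
    rewrite (_ : sW b (X t) + dW = sW b (X' t)); last by rewrite /dW addrC subrK.
    by rewrite /X' (oL_sqr pos') /sL2 divfK ?gt_eqF.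
  have pE : pm1 b eps P o t ^+ 2 + pm2 b eps P o t ^+ 2 + pm3 b eps P o t ^+ 2 =
      M t ^+ 2 * (sQ b (X t) / sU b (X t) ^+ 4).
    rewrite (momentum_sqr pos) -[sN _ _]/(sW b (X t) * sW b (X t) / c ^+ 2 - (m * c) ^+ 2) -NE.
    by rewrite /M /sM; field; rewrite gt_eqF.
  have yE : (pm1 b eps P o t / M t + w1 t) ^+ 2 + (pm2 b eps P o t / M t + w2 t) ^+ 2 +
      (pm3 b eps P o t / M t + w3 t) ^+ 2 = sQ b (X' t) / sU b (X' t) ^+ 4.
    rewrite (_ : _ / M t + w1 t = m11 * y1 t + m12 * y2 t + m13 * y3 t); last by rewrite addrC /w1 subrK.
    rewrite (_ : _ / M t + w2 t = m21 * y1 t + m22 * y2 t + m23 * y3 t); last by rewrite addrC /w2 subrK.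
    rewrite (_ : _ / M t + w3 t = m31 * y1 t + m32 * y2 t + m33 * y3 t); last by rewrite addrC /w3 subrK.
    rewrite orth /y1 /y2 /y3 !expr_div_n -!mulrDl.
    rewrite (momentum_sqr pos') (_ : sN b _ = sL b (X' t) * sL b (X' t) * sQ b (X' t)).
      by rewrite /M' /sM; field; rewrite !gt_eqF.
    by rewrite /X' (oL_sqr pos') /sL2 divfK ?gt_eqF.
  have := Hpt k (M t) (sL b (X' t)) (sQ b (X' t)) (sU b (X' t)) (sL b (X t)) (sQ b (X t)) (sU b (X t))
    (sW b (X t)) dW _ _ _ (w1 t) (w2 t) (w3 t) (v1 t) (v2 t) (v3 t) _ _ _ (z1 t) (z2 t) (z3 t) _ _ _
    Mp (le_trans rM q0G) (le_trans riM q0G) Wp (le_trans rW q0G) dW1 dW2 wk1 wk2 wk3 Up Up' (ltW Qp')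
    erefl NE NE' pE yE erefl erefl erefl.
  rewrite -/(sA b (X t)) -/(sA b (X' t)) -/(S t) => D1.
  move: tq; rewrite -/l1 -/l2.
  set tor := l2 * _ * _ + _ + _; rewrite -[X in `|tor - X|]opprK -/(main t) opprK => tq.
  have torE : (magn1 b eps P o t * v1 t + magn2 b eps P o t * v2 t + magn3 b eps P o t * v3 t) / M t = tor.
    rewrite /tor /magn1 /magn2 /magn3 -/l1 -/l2 /M /X.
    by field; rewrite gt_eqF.
  rewrite torE in D1.
  have tq' : - tor - main t <= (`|l1| + `|l2|) * (17 * q ^+ 2 * (`|eps| * `|f| + f ^+ 2)).
    by move: tq; rewrite ler_norml => /andP[+ _]; clear; lra.
  have LL : (`|l1| + `|l2|) * (17 * q ^+ 2 * f ^+ 2) <= 17 * q ^+ 2 * (2 * C) * f ^+ 2.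
    have h1 : `|l1| + `|l2| <= 2 * C.
      have : C * `|eps| <= C by rewrite ler_piMr.
      by move: okl1 okl2; rewrite /l1 /l2; clear; lra.
    have h2 : 0 <= 17 * q ^+ 2 * f ^+ 2 by apply: mulr_ge0; [exact: mulr_ge0|exact: sqr_ge0].
    by have := ler_wpM2r h2 h1; clear; lra.
  have kE : Cp * k ^+ 2 = Cp * (49 * q ^+ 2) * f ^+ 2 by rewrite /k -fsq; ring.
  rewrite kE in D1.
  rewrite /E /E2; move: D1 tq' LL; clear; lra.
rewrite /action.
have [A [A0 dA ->]] := integralP (action_continuous Pp B0 rho0 sk ob pos).
have [A' [A'0 dA' ->]] := integralP (action_continuous Pp' B0 rho0 sk' ob' pos').
(* An explicit primitive of [main]; only the integrals pi of cos^2 and sin^2 survive over a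
   period. *)
pose Mn t := - (f * rad ^+ 2) * (l1 * k1 * (sin t * sin t / 2) - l1 * k2 * ((t + sin t * cos t) / 2)
   + l2 * k1 * ((t - sin t * cos t) / 2) - l2 * k2 * (sin t * sin t / 2)).
have dMn t : der Mn t (main t).
  have ds2 := derM (derM (dsin t) (dsin t)) (derC 2^-1 t).
  have dtp := derM (derD (der_id t) (derM (dsin t) (dcos t))) (derC 2^-1 t).
  have dtm := derM (derB (der_id t) (derM (dsin t) (dcos t))) (derC 2^-1 t).
  have := derZ (- (f * rad ^+ 2)) (derB (derD (derB (derZ (l1 * k1) ds2) (derZ (l1 * k2) dtp))
    (derZ (l2 * k1) dtm)) (derZ (l2 * k2) ds2)).
  move/der_val; apply; rewrite /main.
  by have /(canRL (addrK _)) e := cos2Dsin2 t; field: e; rewrite un.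
pose V t := pm1 b eps P o t * v1 t + pm2 b eps P o t * v2 t + pm3 b eps P o t * v3 t.
have dV t : der V t (S t).
  exact: (derD (derD (derM (dp1 t) (dv1 t)) (derM (dp2 t) (dv2 t))) (derM (dp3 t) (dv3 t))).
have dH t : der (fun t => A' t - A t - V t - Mn t) t (sA b (X' t) - sA b (X t) - S t - main t).
  exact: (derB (derB (derB (dA' t) (dA t)) (dV t)) (dMn t)).
have := der_le (ltW tp) dH (fun t _ => bound t).
have Vp : V tpi = V 0.
  have [e1' e2' e3'] := pos_periodic ob 0; have [e4 e5 e6] := mom_periodic ob 0.
  have [e7 e8 e9] := pos_periodic ob' 0.
  rewrite add0r in e1' e2' e3' e4 e5 e6 e7 e8 e9.
  by rewrite /V /v1 /v2 /v3 /b1 /b2 /b3 e1' e2' e3' e4 e5 e6 e7 e8 e9.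
have M0 : Mn 0 = 0 by rewrite /Mn sin0 !(mul0r, addr0, subr0, mulr0).
have Mt : Mn tpi = f * (rad ^+ 2 * pi) * (k2 * l1 - k1 * l2).
  rewrite /Mn sin2pi -mulr_natr; move: (@pi R) => p; by field; rewrite un.
rewrite A0 A'0 Vp M0 Mt !subr0 /E -/l1 -/l2; clear; lra.
Qed.

End FirstVariation.

(** * Estimates for a smooth potential *)

Section MatrixNorm.
Variable R : realType.

Lemma mx_entry_le m n (A : 'M[R]_(m, n)) i j : `|A i j| <= `|A|.
Proof.
rewrite [leRHS]/Num.norm /= mx_normrE; apply/bigmax_geP; right.
by exists (i, j).
Qed.

Lemma mx_norm_le m n (A : 'M[R]_(m, n)) k : 0 <= k -> (forall i j, `|A i j| <= k) -> `|A| <= k.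
Proof.
move=> k0 H; rewrite [leLHS]/Num.norm /= mx_normrE; by apply/bigmax_leP; split.
Qed.

Lemma bounded_closed_compact_mx m n (A : set 'M[R]_(m, n)) :
  bounded_set A -> closed A -> compact A.
Proof.
move=> bA cA.
have cv : continuous (@vec_mx R m n).
  move=> v S /nbhs_ballP[e /= e0 eS]; apply/nbhs_ballP; exists e => //= w.
  rewrite -ball_normE /= => vw; apply: eS; rewrite -ball_normE /=.
  apply: le_lt_trans vw; apply: mx_norm_le => // i j.
  by have := mx_entry_le (v - w) 0 (mxvec_index i j); rewrite !mxE.
have -> : A = (@vec_mx R m n) @` ((@vec_mx R m n) @^-1` A).
  apply/seteqP; split=> [M AM|_ [v Av <-]]; last exact: Av.
  by exists (mxvec M); rewrite /= ?mxvecK.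
apply: continuous_compact; first exact: continuous_subspaceT.
apply: bounded_closed_compact.
  have [M [Mr HM]] := bA; exists M; split=> // x Mx v Av.
  have := HM x Mx _ Av => H; apply: mx_norm_le => [|i j].
    by apply: le_trans H.
  rewrite (ord1 i); have := mx_entry_le (vec_mx v) => /(_ _ _) Hv.
  case/mxvec_indexP: j => i' j'.
  by have := Hv i' j'; rewrite mxE => /le_trans; apply.
by apply: closed_comp => // v _; exact: cv.
Qed.

End MatrixNorm.

Section Regularity.
Variables (R : realType) (d : nat).
Implicit Types (f U : 'cV[R]_d -> R) (x y z p : 'cV[R]_d).

Lemma derivable_line f z (e : 'cV[R]_d) (s : R) : derivable f (z + s *: e) e ->
  der (fun s => f (z + s *: e)) s ('D_e f (z + s *: e)).
Proof.
move=> H.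
have E : (fun h : R => h^-1 *: (((fun s => f (z + s *: e)) \o shift s) (h *: (1 : R)) - f (z + s *: e))) =
    (fun h : R => h^-1 *: ((f \o shift (z + s *: e)) (h *: e) - f (z + s *: e))).
  apply/funext => h /=; congr (_ *: (f _ - _)).
  by rewrite [h *: 1]mulr1 scalerDl addrCA.
by split; [rewrite /derivable E|rewrite /derive E].
Qed.

(** The conditions [|s| <= |a|] and [0 <= s * a] say that s lies between 0 and a for either sign of
    a (for a = 0 they give s = 0). *)
Lemma line_mean_value f z (e : 'cV[R]_d) (a : R) :
  (forall s, `|s| <= `|a| -> 0 <= s * a -> derivable f (z + s *: e) e) ->
  exists s, [/\ `|s| <= `|a|, 0 <= s * a & f (z + a *: e) - f z = 'D_e f (z + s *: e) * a].
Proof.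
move=> H; pose g s := f (z + s *: e).
have g0 : g 0 = f z by rewrite /g scale0r addr0.
have dg s : `|s| <= `|a| -> 0 <= s * a -> der g s ('D_e f (z + s *: e)).
  by move=> h1 h2; apply: derivable_line; apply: H.
have cont u v : (forall s, u <= s <= v -> `|s| <= `|a| /\ 0 <= s * a) -> {within `[u, v], continuous g}.
  move=> uv; apply: derivable_within_continuous => s; rewrite in_itv /= => /uv[h1 h2].
  by have [] := dg s h1 h2.
have sub (u v s : R) : s \in `]u, v[ -> u <= s <= v.
  by rewrite in_itv /= => /andP[/ltW-> /ltW->].
have [a0|/ltW a0] := leP 0 a.
  have uv s : 0 <= s <= a -> `|s| <= `|a| /\ 0 <= s * a.
    by move=> /andP[s0 sa]; rewrite !ger0_norm// mulr_ge0.
  have [||s sI E] := @MVT_segment R g (fun s => 'D_e f (z + s *: e)) 0 a a0.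
  - by move=> s /sub /uv[h1 h2]; apply: dg.
  - exact: cont.
  move: sI; rewrite in_itv /= => /uv[h1 h2]; exists s; split=> //.
  by move: E; rewrite g0 subr0.
have uv s : a <= s <= 0 -> `|s| <= `|a| /\ 0 <= s * a.
  by move=> /andP[s0 sa]; rewrite !ler0_norm// lerN2 mulr_le0.
have [||s sI E] := @MVT_segment R g (fun s => 'D_e f (z + s *: e)) a 0 a0.
- by move=> s /sub /uv[h1 h2]; apply: dg.
- exact: cont.
move: sI; rewrite in_itv /= => /uv[h1 h2]; exists s; split=> //.
by move: E; rewrite g0 sub0r mulrN => /eqP; rewrite -opprB eqr_opp => /eqP.
Qed.

Definition box p (r : R) x := forall i, `|x i 0 - p i 0| <= r.

Lemma boxP p r x : 0 <= r -> box p r x <-> `|x - p| <= r.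
Proof.
move=> r0; split=> [H|H i]; first by apply: mx_norm_le => // i j; rewrite !mxE (ord1 j).
by have := mx_entry_le (x - p) i 0; rewrite !mxE => /le_trans; apply.
Qed.

(** Smoothness is given by partial derivatives, so increments are estimated along a staircase that
    replaces the coordinates of [y] by those of [x] one at a time. *)
Definition stair x y (n : nat) : 'cV[R]_d := \col_i (if (i < n)%N then x i 0 else y i 0).

Lemma stair0 x y : stair x y 0 = y.
Proof. by apply/colP => i; rewrite mxE. Qed.

Lemma staird x y : stair x y d = x.
Proof. by apply/colP => i; rewrite mxE ltn_ord. Qed.

Lemma stairS x y (i : 'I_d) :
  stair x y i.+1 = stair x y i + (x i 0 - y i 0) *: basis_vec R i.
Proof.
apply/colP => j; rewrite !mxE eqxx andbT ltnS leq_eqVlt -val_eqE /=.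
case: eqP => [/val_inj ->|_] /=; first by rewrite ltnn mulr1 addrC subrK.
by rewrite mulr0 addr0.
Qed.

Lemma stair_box p r x y (i : 'I_d) (s : R) : box p r x -> box p r y ->
  `|s| <= `|x i 0 - y i 0| -> 0 <= s * (x i 0 - y i 0) -> box p r (stair x y i + s *: basis_vec R i).
Proof.
move=> bx by_ sxy pos j; rewrite !mxE eqxx andbT.
have [->|ij] := eqVneq j i; last first.
  by rewrite mulr0 addr0; case: ifP => _; [exact: bx|exact: by_].
rewrite ltnn mulr1.
have := bx i; have := by_ i; rewrite !ler_norml => /andP[a1 a2] /andP[b1 b2].
have [xy|/ltW xy] := leP 0 (x i 0 - y i 0).
  have s0 : 0 <= s.
    have [xy0|xy0] := eqVneq (x i 0 - y i 0) 0.
      by move: sxy; rewrite xy0 normr0 normr_le0 => /eqP ->.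
    by rewrite -(pmulr_lge0 _ (_ : 0 < x i 0 - y i 0))// lt0r xy0.
  by move: sxy; rewrite !ger0_norm// => sxy; apply/andP; split; lra.
have s0 : s <= 0.
  have [xy0|xy0] := eqVneq (x i 0 - y i 0) 0.
    by move: sxy; rewrite xy0 normr0 normr_le0 => /eqP ->.
  by rewrite -(nmulr_lge0 _ (_ : x i 0 - y i 0 < 0))// lt_def eq_sym xy0.
by move: sxy; rewrite !ler0_norm// => sxy; apply/andP; split; lra.
Qed.

End Regularity.

Section BoxEstimates.
Variables (R : realType) (d : nat).
Implicit Types (f U : 'cV[R]_d -> R) (x y z p : 'cV[R]_d).

Local Notation e_ i := (basis_vec R i).

Lemma stair_telescope f x y :
  f x - f y = \sum_(i < d) (f (stair x y i.+1) - f (stair x y i)).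
Proof.
rewrite -(big_mkord xpredT (fun i => f (stair x y i.+1) - f (stair x y i))).
by rewrite telescope_sumr// stair0 staird.
Qed.

Lemma stair_mean_value f p (r : R) x y (i : 'I_d) :
  (forall z, box p r z -> derivable f z (e_ i)) -> box p r x -> box p r y ->
  exists2 z, box p r z & f (stair x y i.+1) - f (stair x y i) = 'D_(e_ i) f z * (x i 0 - y i 0).
Proof.
move=> df bx by_; rewrite stairS.
have [|s [h1 h2 E]] := @line_mean_value R d f (stair x y i) (e_ i) (x i 0 - y i 0).
  by move=> s h1 h2; apply: df; apply: stair_box.
exists (stair x y i + s *: e_ i); last exact: E.
exact: stair_box.
Qed.

Lemma box_lipschitz f p (r B : R) : 0 <= B ->
  (forall z, box p r z -> forall i, derivable f z (e_ i) /\ `|'D_(e_ i) f z| <= B) ->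
  forall x y, box p r x -> box p r y -> `|f x - f y| <= d%:R * B * `|x - y|.
Proof.
move=> B0 H x y bx by_; rewrite stair_telescope (le_trans (ler_norm_sum _ _ _))//.
rewrite (_ : d%:R * B * `|x - y| = \sum_(i < d) (B * `|x - y|)); last first.
  by rewrite sumr_const card_ord -[RHS]mulr_natl mulrA.
apply: ler_sum => i _.
have [z bz ->] := @stair_mean_value f p r x y i (fun z bz => (H z bz i).1) bx by_.
rewrite normrM ler_pM//; first exact: (H z bz i).2.
by have := mx_entry_le (x - y) i 0; rewrite !mxE.
Qed.

(** The bound [B] is uniform over all centres on the sphere, so that it does not depend on the plane
    in which the circle lies. *)
Definition regular U (r rho B : R) := forall p, enorm p = r -> forall x y, box p rho x -> box p rho y ->
  [/\ `|U x| <= B, forall i, `|'D_(e_ i) U x| <= B, `|U x - U y| <= B * `|x - y|,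
      forall i, `|'D_(e_ i) U x - 'D_(e_ i) U y| <= B * `|x - y| &
      `|U x - U y - \sum_(i < d) 'D_(e_ i) U y * (x i 0 - y i 0)| <= B * `|x - y| ^+ 2].

(* Steps of the staircase from [y] to [x] stay within distance |x - y| of [y]. *)
Lemma box_taylor f p (r B : R) : 0 <= B ->
  (forall z, box p r z -> forall i, derivable f z (e_ i)) ->
  (forall z i, box p r z -> forall j, derivable ('D_(e_ i) f) z (e_ j) /\
     `|'D_(e_ j) ('D_(e_ i) f) z| <= B) ->
  forall x y, box p r x -> box p r y ->
  `|f x - f y - \sum_(i < d) 'D_(e_ i) f y * (x i 0 - y i 0)| <= d%:R * (d%:R * B) * `|x - y| ^+ 2.
Proof.
move=> B0 df H x y bx by_; rewrite stair_telescope -sumrB (le_trans (ler_norm_sum _ _ _))//.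
rewrite (_ : d%:R * (d%:R * B) * `|x - y| ^+ 2 = \sum_(i < d) (d%:R * B * `|x - y| * `|x - y|)); last first.
  by rewrite sumr_const card_ord -[RHS]mulr_natl; ring.
have xy0 : 0 <= `|x - y| by exact: normr_ge0.
have bxy : box y `|x - y| x by apply/boxP.
have byy : box y `|x - y| y by move=> i; rewrite subrr normr0.
apply: ler_sum => i _.
pose b z := box p r z /\ box y `|x - y| z.
have [s [h1 h2 E]] : exists s : R, [/\ `|s| <= `|x i 0 - y i 0|, 0 <= s * (x i 0 - y i 0) &
    f (stair x y i + (x i 0 - y i 0) *: e_ i) - f (stair x y i) =
    'D_(e_ i) f (stair x y i + s *: e_ i) * (x i 0 - y i 0)].
  by apply: line_mean_value => s h1 h2; apply: df; apply: stair_box.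
rewrite stairS E -mulrBl normrM ler_pM//.
set z := stair x y i + s *: e_ i.
have bz : box p r z by exact: stair_box.
have bz' : box y `|x - y| z by exact: stair_box.
have := @box_lipschitz ('D_(e_ i) f) p r B B0 (fun z bz => H z i bz) z y bz by_.
move=> /le_trans; apply; rewrite ler_wpM2l ?mulr_ge0//.
exact/(boxP _ _ xy0).
Qed.

Lemma enorm_bounds x : `|x| <= enorm x /\ enorm x ^+ 2 <= d%:R * `|x| ^+ 2.
Proof.
have s0 : 0 <= \sum_(i < d) x i 0 ^+ 2 by apply: sumr_ge0 => i _; exact: sqr_ge0.
split.
  apply: mx_norm_le => [|i j]; first exact: sqrtr_ge0.
  rewrite (ord1 j) -sqrtr_sqr ler_wsqrtr//.
  rewrite (bigD1 i)//= lerDl; apply: sumr_ge0 => k _; exact: sqr_ge0.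
rewrite sqr_sqrtr// -[d in d%:R]card_ord mulr_natl -sumr_const.
apply: ler_sum => i _; rewrite -(real_normK (num_real (x i 0))) lerXn2r ?nnegrE//.
exact: mx_entry_le.
Qed.

Lemma compact_shell (r1 r2 : R) : compact [set x : 'cV[R]_d | r1 <= `|x| <= r2].
Proof.
apply: bounded_closed_compact_mx.
  exists r2; split; first exact: num_real.
  by move=> M /ltW rM x /andP[_ xr]; exact: le_trans rM.
rewrite (_ : [set x : 'cV[R]_d | r1 <= `|x| <= r2] =
  [set x : 'cV[R]_d | r1 <= `|x|] `&` [set x : 'cV[R]_d | `|x| <= r2]); last first.
  by apply/seteqP; split=> x /=; [move/andP|move=> [-> ->]].
apply: closedI.
  by apply: (@closed_comp _ _ (fun x : 'cV[R]_d => `|x|) [set y | r1 <= y]);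
    [move=> x _; exact: norm_continuous|exact: closed_ge].
by apply: (@closed_comp _ _ (fun x : 'cV[R]_d => `|x|) [set y | y <= r2]);
  [move=> x _; exact: norm_continuous|exact: closed_le].
Qed.

Lemma shell_bounded f (r1 r2 : R) :
  (forall x, r1 <= `|x| <= r2 -> {for x, continuous f}) ->
  exists2 B : R, 0 <= B & forall x, r1 <= `|x| <= r2 -> `|f x| <= B.
Proof.
move=> cf.
have /compact_bounded : compact (f @` [set x : 'cV[R]_d | r1 <= `|x| <= r2]).
  apply: continuous_compact; last exact: compact_shell.
  by apply: continuous_in_subspaceT => x; rewrite inE => /cf.
move=> /ex_strict_bound_gt0[M M0 HM].
exists M; first exact: ltW.
by move=> x xr; apply/ltW; apply: HM; exists x.
Qed.

(** For d <= 4 the Euclidean sphere of radius r lies in sup norms between r / 2 and r, so the boxes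
    of radius r / 8 stay in a compact shell away from 0, where U and its partial derivatives up to
    order two are bounded. *)
Lemma smooth_regular U (r : R) : (0 < d <= 4)%N -> 0 < r ->
  smooth_on [set x : 'cV[R]_d | x != 0] U ->
  exists2 B : R, 0 <= B & regular U r (r / 8) B.
Proof.
move=> /andP[d0 d4] r0 sU.
have n0 x : r / 4 <= `|x| <= 2 * r -> x != 0.
  move=> /andP[xr _]; rewrite -normr_gt0; apply: lt_le_trans xr; exact: divr_gt0.
have [B1 B10 H1] : exists2 B : R, 0 <= B & forall x, r / 4 <= `|x| <= 2 * r -> `|U x| <= B.
  by apply: shell_bounded => x /n0 x0; have [] := sU [::] x x0.
have H2' : forall i : 'I_d, exists B : R, 0 <= B /\ forall x, r / 4 <= `|x| <= 2 * r -> `|'D_(e_ i) U x| <= B.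
  move=> i; have [|B B0 H] := @shell_bounded ('D_(e_ i) U) (r / 4) (2 * r); last by exists B.
  by move=> x /n0 x0; have [] := sU [:: i] x x0.
have H3' : forall ij : 'I_d * 'I_d, exists B : R, 0 <= B /\
    forall x, r / 4 <= `|x| <= 2 * r -> `|'D_(e_ ij.1) ('D_(e_ ij.2) U) x| <= B.
  move=> ij; have [|B B0 H] := @shell_bounded ('D_(e_ ij.1) ('D_(e_ ij.2) U)) (r / 4) (2 * r); last by exists B.
  by move=> x /n0 x0; have [] := sU [:: ij.1; ij.2] x x0.
have [B2 H2] := choice H2'; have [B3 H3] := choice H3'.
pose S2 := \sum_i B2 i; pose S3 := \sum_ij B3 ij.
have S20 : 0 <= S2 by apply: sumr_ge0 => i _; exact: (H2 i).1.
have S30 : 0 <= S3 by apply: sumr_ge0 => i _; exact: (H3 i).1.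
have S2i i : B2 i <= S2 by rewrite /S2 (bigD1 i)//= lerDl sumr_ge0// => j _; exact: (H2 j).1.
have S3i i : B3 i <= S3 by rewrite /S3 (bigD1 i)//= lerDl sumr_ge0// => j _; exact: (H3 j).1.
have dn0 : 0 <= d%:R :> R by [].
pose B := B1 + S2 + d%:R * S2 + d%:R * S3 + d%:R * (d%:R * S3).
have dS2 : 0 <= d%:R * S2 by rewrite mulr_ge0.
have dS3 : 0 <= d%:R * S3 by rewrite mulr_ge0.
have ddS3 : 0 <= d%:R * (d%:R * S3) by rewrite mulr_ge0.
exists B; first by rewrite /B !addr_ge0.
move=> p pr.
have shell x : box p (r / 8) x -> r / 4 <= `|x| <= 2 * r.
  move=> bx; have xp : `|x - p| <= r / 8 by apply/boxP => //; rewrite divr_ge0 ?ltW.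
  have [p1 p2] := enorm_bounds p; rewrite pr in p1 p2.
  have p3 : r / 2 <= `|p|.
    rewrite -ler_sqr ?nnegrE ?divr_ge0 ?(ltW r0)//.
    have : d%:R * `|p| ^+ 2 <= 4 * `|p| ^+ 2 by rewrite ler_wpM2r ?sqr_ge0// ler_nat.
    by rewrite expr_div_n; lra.
  have t1 : `|x| <= `|x - p| + `|p| by rewrite -{1}(subrK p x) ler_normD.
  have t2 : `|p| <= `|x - p| + `|x|.
    by rewrite -{1}(subrK x p) (le_trans (ler_normD _ _))// distrC.
  by apply/andP; split; lra.
have dU z : box p (r / 8) z -> forall i, derivable U z (e_ i) /\ `|'D_(e_ i) U z| <= S2.
  move=> /shell bz i; split; last exact: le_trans ((H2 i).2 z bz) (S2i i).
  by have [_] := sU [::] z (n0 _ bz); apply.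
have ddU z i : box p (r / 8) z -> forall j, derivable ('D_(e_ i) U) z (e_ j) /\
    `|'D_(e_ j) ('D_(e_ i) U) z| <= S3.
  move=> /shell bz j; split; last exact: le_trans ((H3 (j, i)).2 z bz) (S3i (j, i)).
  by have [_] := sU [:: i] z (n0 _ bz); apply.
move=> x y bx by_.
have xy0 : 0 <= `|x - y| by exact: normr_ge0.
have up (K K' u : R) : K <= K' -> 0 <= u -> K * u <= K' * u by move=> ? ?; rewrite ler_wpM2r.
split.
- by rewrite (le_trans (H1 _ (shell _ bx)))// /B; lra.
- by move=> i; rewrite (le_trans (dU x bx i).2)// /B; lra.
- rewrite (le_trans (box_lipschitz S20 dU bx by_))// up// /B; lra.
- move=> i; rewrite (le_trans (box_lipschitz S30 (fun z bz => ddU z i bz) bx by_))// up// /B; lra.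
rewrite (le_trans (box_taylor S30 (fun z bz i => (dU z bz i).1) ddU bx by_))// up ?sqr_ge0// /B; lra.
Qed.

End BoxEstimates.

(** * Potentials in a rotated frame *)

Section Lift.
Variables (R : realType) (d : nat).
Local Notation e_ i := (basis_vec R i).

Definition vec3 (y1 y2 y3 : R) : 'cV[R]_3 := \col_i nth 0 [:: y1; y2; y3] i.

Lemma mul_vec3 (A : 'M[R]_(d, 3)) y1 y2 y3 i :
  (A *m vec3 y1 y2 y3) i 0 = A i 0 * y1 + A i 1 * y2 + A i 2 * y3.
Proof.
rewrite mxE !big_ord_recl big_ord0 !mxE /= addr0 addrA.
by congr (_ + A i _ * _ + A i _ * _); apply/val_inj.
Qed.

Lemma cV_derive (x : R -> 'cV[R]_d) (t : R) (dx : 'cV[R]_d) :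
  (forall i, der (fun s => x s i 0) t (dx i 0)) -> is_derive t 1 x dx.
Proof.
move=> H.
have D : derivable x t 1 by apply/derivable_mxP => i j; rewrite (ord1 j); have [] := H i.
split=> //; rewrite derive_mx//; apply/colP => i; rewrite mxE.
by have [_] := H i.
Qed.

Lemma derive_cV (x : R -> 'cV[R]_d) (t : R) (dx : 'cV[R]_d) i :
  is_derive t 1 x dx -> der (fun s => x s i 0) t (dx i 0).
Proof.
move=> [D <-]; split; first by move/derivable_mxP: D; apply.
by rewrite derive_mx// mxE.
Qed.

(** The potential U(A y) and its partial derivatives, given by the columns of [A]; [A] has three
    columns whatever d is. For j above 3 [inord] falls back to column 0, harmless for the bounds of
    [pert] over all j. *)
Definition lift_pert (A : 'M[R]_(d, 3)) (U : 'cV[R]_d -> R) (j : nat) (y1 y2 y3 : R) : R :=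
  if j is j'.+1 then \sum_(i < d) A i (inord j') * 'D_(e_ i) U (A *m vec3 y1 y2 y3)
  else U (A *m vec3 y1 y2 y3).

Lemma lift_grad (A : 'M[R]_(d, 3)) U y1 y2 y3 v1 v2 v3 :
  lift_pert A U 1 y1 y2 y3 * v1 + lift_pert A U 2 y1 y2 y3 * v2 + lift_pert A U 3 y1 y2 y3 * v3 =
  \sum_(i < d) 'D_(e_ i) U (A *m vec3 y1 y2 y3) * ((A *m vec3 v1 v2 v3) i 0).
Proof.
rewrite /lift_pert !big_distrl -!big_split /=; apply: eq_bigr => i _; rewrite mul_vec3.
rewrite (_ : inord 0 = 0); last by apply/val_inj; rewrite /= inordK.
rewrite (_ : inord 1 = 1); last by apply/val_inj; rewrite /= inordK.
rewrite (_ : inord 2 = 2); last by apply/val_inj; rewrite /= inordK.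
by ring.
Qed.

Lemma lift_dist (A : 'M[R]_(d, 3)) x1 x2 x3 y1 y2 y3 k : (forall i j, `|A i j| <= 1) ->
  `|x1 - y1| <= k -> `|x2 - y2| <= k -> `|x3 - y3| <= k ->
  `|A *m vec3 x1 x2 x3 - A *m vec3 y1 y2 y3| <= 3 * k.
Proof.
move=> A1 h1 h2 h3; have k0 : 0 <= k by apply: le_trans h1.
apply: mx_norm_le => [|i j]; first exact: mulr_ge0.
rewrite (ord1 j).
have -> : (A *m vec3 x1 x2 x3 - A *m vec3 y1 y2 y3) i 0 =
  (A *m vec3 x1 x2 x3) i 0 - (A *m vec3 y1 y2 y3) i 0 by rewrite !mxE.
rewrite !mul_vec3.
rewrite (_ : _ - _ = A i 0 * (x1 - y1) + A i 1 * (x2 - y2) + A i 2 * (x3 - y3)); last by ring.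
have := bsum (bsum (bprod (A1 i 0) h1) (bprod (A1 i 1) h2)) (bprod (A1 i 2) h3).
by move=> /le_trans; apply; lra.
Qed.

End Lift.

Section LiftPert.
Variables (R : realType) (d : nat) (b : base R).
Local Notation e_ i := (basis_vec R i).
Local Notation rad := (bu b)^-1.
Variables (U : 'cV[R]_d -> R) (rho B : R).
Hypotheses (B0 : 0 <= B) (rho0 : 0 < rho) (rhor : rho <= rad) (rU : regular U rad rho B).

Definition admissible (A : 'M[R]_(d, 3)) :=
  (forall i j, `|A i j| <= 1) /\ forall t, enorm (A *m vec3 (rad * cos t) (rad * sin t) 0) = rad.

Lemma lift_box A t x1 x2 x3 : admissible A -> near_circle b t (rho / 6) x1 x2 x3 ->
  box (A *m vec3 (rad * cos t) (rad * sin t) 0) (rho / 2) (A *m vec3 x1 x2 x3).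
Proof.
move=> [A1 _] [n1 n2 n3]; have rho0' := rho0.
have r0 : 0 <= rho / 2 by rewrite divr_ge0// ltW.
apply/(boxP _ _ r0); have n3' : `|x3 - 0| <= rho / 6 by rewrite subr0.
by have := lift_dist A1 n1 n2 n3'; move=> /le_trans; apply; lra.
Qed.

Lemma boxW p (r s : R) (x : 'cV[R]_d) : r <= s -> box p r x -> box p s x.
Proof. by move=> rs bx i; rewrite (le_trans (bx i)). Qed.

Lemma lift_pert_ok A : admissible A -> pert b ((3 * d%:R + 9) * B) (rho / 6) (lift_pert A U).
Proof.
move=> aA t x1 x2 x3 y1 y2 y3 k nx ny h1 h2 h3; have [A1 Ac] := aA.
have [B0' rho0'] := (B0, rho0).
have k0 : 0 <= k by apply: le_trans h1.
have [n d0 nE] : exists2 n : R, 0 <= n & n = d%:R by exists d%:R.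
rewrite -nE.
have dB : 0 <= n * B by rewrite mulr_ge0.
have dBk : 0 <= n * B * k by rewrite mulr_ge0.
have Bk : 0 <= B * k by rewrite mulr_ge0.
have r2 : rho / 2 <= rho by rewrite ler_pdivrMr ?ler_peMr ?(ltW rho0) ?ler1n.
have bx := boxW r2 (lift_box aA nx); have by_ := boxW r2 (lift_box aA ny).
have [Ux _ Uxy DUxy Tay] := rU (Ac t) bx by_.
have [Uy DUy _ _ _] := rU (Ac t) by_ bx.
have dist := lift_dist A1 h1 h2 h3.
have sumb (F : 'I_d -> R) K : (forall i, `|F i| <= K) -> `|\sum_i F i| <= n * K.
  move=> FK; rewrite (le_trans (ler_norm_sum _ _ _))//.
  rewrite (_ : n * K = \sum_(i < d) K); last by rewrite sumr_const card_ord nE mulr_natl.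
  exact: ler_sum.
split.
- case=> [|j] /=; first by rewrite (le_trans Uy)//; lra.
  apply: (@le_trans _ _ (n * B)); last by lra.
  by apply: sumb => i; rewrite -[leRHS]mul1r bprod.
- case=> [|j] /=.
    rewrite (le_trans Uxy)// (le_trans (ler_wpM2l B0 dist))//; lra.
  rewrite -sumrB; apply: (@le_trans _ _ (n * (B * (3 * k)))); last by lra.
  apply: sumb => i; rewrite -mulrBr -[leRHS]mul1r bprod//.
  by rewrite (le_trans (DUxy i))// ler_wpM2l.
rewrite lift_grad.
have -> : \sum_(i < d) 'D_(e_ i) U (A *m vec3 y1 y2 y3) * (A *m vec3 (x1 - y1) (x2 - y2) (x3 - y3)) i 0 =
   \sum_(i < d) 'D_(e_ i) U (A *m vec3 y1 y2 y3) * ((A *m vec3 x1 x2 x3) i 0 - (A *m vec3 y1 y2 y3) i 0).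
  by apply: eq_bigr => i _; rewrite !mul_vec3; congr (_ * _); ring.
rewrite (le_trans Tay)//.
have : `|A *m vec3 x1 x2 x3 - A *m vec3 y1 y2 y3| ^+ 2 <= (3 * k) ^+ 2.
  by rewrite lerXn2r ?nnegrE// mulr_ge0.
move=> /(ler_wpM2l B0) /le_trans; apply.
have : 0 <= n * B * k ^+ 2 by rewrite mulr_ge0 ?sqr_ge0.
by lra.
Qed.

Lemma lift_pert_diff A A' (e : R) : admissible A -> admissible A' -> 0 <= e -> e <= 1 -> 6 * rad * e <= rho / 2 ->
  (forall i j, `|A i j - A' i j| <= e) ->
  forall j t x1 x2 x3, near_circle b t (rho / 6) x1 x2 x3 ->
  `|lift_pert A U j x1 x2 x3 - lift_pert A' U j x1 x2 x3| <= (d%:R + 1) * (B * (1 + 6 * rad)) * e.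
Proof.
move=> aA aA' e0 e1 er AA j t x1 x2 x3 nx; have [A1 Ac] := aA; have [A'1 _] := aA'.
have [[B0' rho0'] rhor'] := (B0, rho0, rhor).
have rad0 : 0 < rad by rewrite invr_gt0 bu_gt0.
have [n d0 nE] : exists2 n : R, 0 <= n & n = d%:R by exists d%:R.
rewrite -nE.
have r2 : rho / 2 <= rho by rewrite ler_pdivrMr ?ler_peMr ?(ltW rho0) ?ler1n.
have bx := lift_box aA nx.
have big (x a : R) : `|a| <= 1 -> `|x - rad * a| <= rho / 6 -> `|x| <= 2 * rad.
  move=> a1 xa; have := bsum xa (bprod (lexx `|rad|) a1); rewrite subrK (gtr0_norm rad0).
  by lra.
have [n1 n2 n3] := nx.
have X1 := big _ _ (cos_norm_le1 t) n1; have X2 := big _ _ (sin_norm_le1 t) n2.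
have X3 : `|x3| <= 2 * rad by lra.
have dist : `|A *m vec3 x1 x2 x3 - A' *m vec3 x1 x2 x3| <= 6 * rad * e.
  apply: mx_norm_le => [|i k]; first by rewrite !mulr_ge0// ltW.
  rewrite (ord1 k).
  have -> : (A *m vec3 x1 x2 x3 - A' *m vec3 x1 x2 x3) i 0 =
      (A *m vec3 x1 x2 x3) i 0 - (A' *m vec3 x1 x2 x3) i 0 by rewrite !mxE.
  rewrite !mul_vec3 (_ : _ - _ = (A i 0 - A' i 0) * x1 + (A i 1 - A' i 1) * x2 + (A i 2 - A' i 2) * x3); last by ring.
  have := bsum (bsum (bprod (AA i 0) X1) (bprod (AA i 1) X2)) (bprod (AA i 2) X3).
  by move=> /le_trans; apply; lra.
have bx' : box (A *m vec3 (rad * cos t) (rad * sin t) 0) rho (A' *m vec3 x1 x2 x3).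
  have r0 : 0 <= rho by exact: ltW.
  have r0' : 0 <= rho / 2 by rewrite divr_ge0.
  apply/(boxP _ _ r0); rewrite -(subrK (A *m vec3 x1 x2 x3) (A' *m _)) -addrA.
  rewrite (le_trans (ler_normD _ _))// distrC.
  by have := (boxP _ _ r0').1 bx; lra.
have [_ _ Uxy DUxy _] := rU (Ac t) (boxW r2 bx) bx'.
have [_ DUy _ _ _] := rU (Ac t) bx' (boxW r2 bx).
have B1 : B * `|A *m vec3 x1 x2 x3 - A' *m vec3 x1 x2 x3| <= B * (6 * rad * e) by rewrite ler_wpM2l.
have c0 : 0 <= B * (6 * rad * e) by rewrite (le_trans _ B1)// mulr_ge0.
have Be : 0 <= B * e by rewrite mulr_ge0.
have dB1 : 0 <= n * (B * (6 * rad * e)) by rewrite mulr_ge0.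
have dB2 : 0 <= n * (B * e) by rewrite mulr_ge0.
have sumb (F : 'I_d -> R) K : (forall i, `|F i| <= K) -> `|\sum_i F i| <= n * K.
  move=> FK; rewrite (le_trans (ler_norm_sum _ _ _))//.
  rewrite (_ : n * K = \sum_(i < d) K); last by rewrite sumr_const card_ord nE mulr_natl.
  exact: ler_sum.
case: j => [|j] /=; first by rewrite (le_trans Uxy)// (le_trans B1)//; lra.
rewrite -sumrB; apply: (@le_trans _ _ (n * (e * B + B * (6 * rad * e)))); last by lra.
apply: sumb => i.
rewrite (_ : _ - _ = (A i (inord j) - A' i (inord j)) * 'D_(e_ i) U (A' *m vec3 x1 x2 x3) +
   A i (inord j) * ('D_(e_ i) U (A *m vec3 x1 x2 x3) - 'D_(e_ i) U (A' *m vec3 x1 x2 x3))); last by ring.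
apply: bsum; first exact: bprod.
by rewrite -[leRHS]mul1r bprod// (le_trans (DUxy i)).
Qed.

End LiftPert.

Section Transfer.
Variables (R : realType) (d : nat) (b : base R).
Local Notation e_ i := (basis_vec R i).

Lemma der_mul_vec3 (A : 'M[R]_(d, 3)) (x1 x2 x3 : R -> R) (t a1 a2 a3 : R) :
  der x1 t a1 -> der x2 t a2 -> der x3 t a3 ->
  is_derive t 1 (fun s => A *m vec3 (x1 s) (x2 s) (x3 s)) (A *m vec3 a1 a2 a3).
Proof.
move=> d1 d2 d3; apply: cV_derive => i; rewrite mul_vec3.
have -> : (fun s => (A *m vec3 (x1 s) (x2 s) (x3 s)) i 0) =
  (fun s => A i 0 * x1 s + A i 1 * x2 s + A i 2 * x3 s) by apply/funext => s; rewrite mul_vec3.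
exact: (derD (derD (derZ _ d1) (derZ _ d2)) (derZ _ d3)).
Qed.

Lemma vec3Z (a y1 y2 y3 : R) : a *: vec3 y1 y2 y3 = vec3 (a * y1) (a * y2) (a * y3).
Proof. by apply/colP => -[[|[|[|i]]] Hi] //; rewrite !mxE. Qed.

Lemma vec3D (x1 x2 x3 y1 y2 y3 : R) :
  vec3 x1 x2 x3 + vec3 y1 y2 y3 = vec3 (x1 + y1) (x2 + y2) (x3 + y3).
Proof. by apply/colP => -[[|[|[|i]]] Hi] //; rewrite !mxE. Qed.

Lemma enormZ (a : R) (x : 'cV[R]_d) : 0 <= a -> enorm (a *: x) = a * enorm x.
Proof.
move=> a0; rewrite /enorm -[in RHS](ger0_norm a0) -sqrtr_sqr -sqrtrM ?sqr_ge0//.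
by rewrite big_distrr; congr Num.sqrt; apply: eq_bigr => i _; rewrite !mxE exprMn.
Qed.

(** The gradient of U(A y) is A^T grad U, and A A^T = 1 brings it back. *)
Lemma lift_gradient (A : 'M[R]_(d, 3)) (U : 'cV[R]_d -> R) y1 y2 y3 : A *m A^T = 1%:M ->
  A *m vec3 (lift_pert A U 1 y1 y2 y3) (lift_pert A U 2 y1 y2 y3) (lift_pert A U 3 y1 y2 y3) =
  gradient U (A *m vec3 y1 y2 y3).
Proof.
move=> AA; have -> : vec3 (lift_pert A U 1 y1 y2 y3) (lift_pert A U 2 y1 y2 y3) (lift_pert A U 3 y1 y2 y3)
    = A^T *m gradient U (A *m vec3 y1 y2 y3).
  apply/colP => -[[|[|[|i]]] Hi] //; rewrite !mxE /=; apply: eq_bigr => i _; rewrite !mxE;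
  by congr (A i _ * _); apply/val_inj; rewrite /= inordK.
by rewrite mulmxA AA mul1mx.
Qed.

Lemma motion_solution (A : 'M[R]_(d, 3)) U eps (x1 x2 x3 q1 q2 q3 r W : R -> R) :
  A *m A^T = 1%:M -> motion b eps (lift_pert A U) x1 x2 x3 q1 q2 q3 r W ->
  (forall t : R, enorm (A *m vec3 (x1 t) (x2 t) (x3 t)) ^+ 2 = x1 t ^+ 2 + x2 t ^+ 2 + x3 t ^+ 2) ->
  (forall t : R, enorm (A *m vec3 (q1 t) (q2 t) (q3 t)) ^+ 2 = q1 t ^+ 2 + q2 t ^+ 2 + q3 t ^+ 2) ->
  fixed_energy_solution (bm b) (bc b) (bal b) eps (bh b) U
    (fun t => A *m vec3 (x1 t) (x2 t) (x3 t)).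
Proof.
move=> AA [dx1 dx2 dx3 dq1 dq2 dq3 r0 rE W0 WE qE] nx nq.
have c0 := bc_gt0 b; have m0 := bm_gt0 b.
have cn : bc b != 0 by rewrite gt_eqF.
pose x (t : R) := A *m vec3 (x1 t) (x2 t) (x3 t); pose q (t : R) := A *m vec3 (q1 t) (q2 t) (q3 t).
have dx (t : R) : is_derive t 1 x (((bc b) ^+ 2 / W t) *: q t).
  have := der_mul_vec3 A (dx1 t) (dx2 t) (dx3 t).
  rewrite /q scalemxAr vec3Z.
  by rewrite !(mulrAC _ (W t)^-1).
have x'E (t : R) : derive1 x t = ((bc b) ^+ 2 / W t) *: q t.
  by rewrite derive1E; have [_] := dx t.
have Wn (t : R) : W t != 0 by rewrite gt_eqF.
have cW (t : R) : 0 < (bc b) ^+ 2 / W t by rewrite divr_gt0 ?exprn_gt0.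
(* The relation between momentum and W gives |x'| < c and the Lorentz factor m c^2 / W, so that q is
   indeed the relativistic momentum. *)
have v2 (t : R) : enorm (derive1 x t) ^+ 2 = (bc b) ^+ 2 - ((bm b) * (bc b) ^+ 3 / W t) ^+ 2.
  rewrite x'E enormZ ?ltW// exprMn nq qE; by field; rewrite Wn cn.
have lor (t : R) : lorentz (bc b) (derive1 x t) = bm b * (bc b) ^+ 2 / W t.
  rewrite /lorentz v2 (_ : 1 - _ = (bm b * (bc b) ^+ 2 / W t) ^+ 2); last by field; rewrite Wn cn.
  by rewrite sqrtr_sqr ger0_norm// divr_ge0 ?mulr_ge0 ?exprn_ge0// ltW.
have lor0 (t : R) : 0 < lorentz (bc b) (derive1 x t).
  by rewrite lor divr_gt0 ?mulr_gt0 ?exprn_gt0.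
have xn (t : R) : enorm (x t) = (r t)^-1.
  apply: (@pexpIrn _ 2) => //; rewrite ?nnegrE ?sqrtr_ge0 ?invr_ge0 ?(ltW (r0 t))//.
  rewrite /x nx exprVn -[LHS]mul1r -[X in X * _](@mulVf _ (r t ^+ 2)); last first.
    by rewrite expf_neq0// gt_eqF.
  by rewrite -mulrA rE mulr1.
have mom : momentum (bm b) (bc b) x = q.
  apply/funext => t; rewrite /momentum lor x'E scalerA.
  rewrite (_ : _ * _ = 1) ?scale1r//; field; rewrite Wn cn; by rewrite (gt_eqF m0).
split=> t.
  split.
  - apply/eqP => x0; have := r0 t; rewrite -invr_gt0 -xn /x x0 /enorm.
    by rewrite big1 ?sqrtr0 ?ltxx// => i _; rewrite mxE expr0n.
  - by have [] := dx t.
  - rewrite -(@ltr_pXn2r _ 2) ?nnegrE ?sqrtr_ge0 ?(ltW c0)// v2 ltrBlDr ltrDl exprn_gt0//.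
    by rewrite divr_gt0 ?mulr_gt0 ?exprn_gt0.
  rewrite mom; have := der_mul_vec3 A (dq1 t) (dq2 t) (dq3 t).
  congr is_derive.
  rewrite -vec3D mulmxDr -(lift_gradient U _ _ _ AA) xn.
  rewrite -[in RHS]scaleNr !scalemxAr !vec3Z /x.
  by rewrite exprVn invrK !mulNr.
rewrite /energy lor xn WE /lift_pert invrK.
have := Wn t; rewrite WE /lift_pert => wn.
by field; rewrite cn wn (gt_eqF m0).
Qed.

End Transfer.

(** * Circular solutions *)

Section Circular.
Variable R : realType.
Local Notation tpi := (pi *+ 2 : R).

(** Turning (f, f1 / w) back by the angle w t yields two constants, which are evaluated at 0. *)
Lemma harmonic_solution (w : R) (f f1 : R -> R) : w != 0 ->
  (forall t : R, der f t (f1 t)) -> (forall t : R, der f1 t (- w ^+ 2 * f t)) ->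
  forall t : R, f t = cos (w * t) * f 0 + sin (w * t) / w * f1 0.
Proof.
move=> w0 df df1 t.
pose g (s : R) := f s * cos (w * s) - w^-1 * (f1 s * sin (w * s)).
pose k (s : R) := f s * sin (w * s) + w^-1 * (f1 s * cos (w * s)).
have dg (s : R) : der g s 0.
  apply: der_val (derB (derM (df s) (der_cos w s)) (derZ w^-1 (derM (df1 s) (der_sin w s)))) _.
  by field.
have dk (s : R) : der k s 0.
  apply: der_val (derD (derM (df s) (der_sin w s)) (derZ w^-1 (derM (df1 s) (der_cos w s)))) _.
  by field.
have g0 := der_cst dg t 0; have k0 := der_cst dk t 0.
rewrite /g /k mulr0 cos0 sin0 !mulr0 subr0 mulr1 add0r mulr1 in g0 k0.
rewrite -mulrA -k0 -g0.
rewrite [LHS](_ : _ = f t * (cos (w * t) ^+ 2 + sin (w * t) ^+ 2)); first by ring.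
by rewrite cos2Dsin2 mulr1.
Qed.

Lemma cos_eq1_tpi (s : R) : 0 < s <= tpi -> cos s = 1 -> s = tpi.
Proof.
move=> /andP[s0 sp] cs; have tp := tpi_gt0 R.
have [//|sn] := eqVneq s tpi.
have /cos2pi_neq1 : 0 < s / tpi < 1 by rewrite divr_gt0//= ltr_pdivrMr// mul1r lt_neqAle sn.
by rewrite divfK ?gt_eqF// cs ltxx.
Qed.

(** At constant distance the energy makes the Lorentz factor k constant, so the equation becomes a
    harmonic oscillator. Differentiating |x|^2 = r^2 twice gives the orthogonality of x and x' and
    the speed w r. *)
Lemma circular_solution (d : nat) (m c al h r : R) (U : 'cV[R]_d -> R) (x : R -> 'cV[R]_d) :
  0 < m -> 0 < c -> 0 < al -> 0 < r ->
  fixed_energy_solution m c al 0 h U x -> (forall t, enorm (x t) = r) ->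
  exists w k : R, exists y : 'cV[R]_d,
    [/\ [/\ 0 < w, 0 < k < 1, k ^+ 2 = 1 - (w * r / c) ^+ 2, m * c ^+ 2 / k = h + al / r &
            w ^+ 2 * m * r ^+ 3 = k * al],
        forall t, x t = cos (w * t) *: x 0 + sin (w * t) *: y,
        \sum_i x 0 i 0 ^+ 2 = r ^+ 2, \sum_i y i 0 ^+ 2 = r ^+ 2 & \sum_i x 0 i 0 * y i 0 = 0].
Proof.
move=> m0 c0 al0 r0 [sol en] xr.
have x0n t : \sum_i x t i 0 ^+ 2 = r ^+ 2.
  by rewrite -(xr t) sqr_sqrtr// sumr_ge0// => i _; exact: sqr_ge0.
have [mn cn aln rn] : [/\ m != 0, c != 0, al != 0 & r != 0] by rewrite !gt_eqF.
pose v (t : R) := derive1 x t.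
have lor0 t : 0 < lorentz c (v t).
  have [_ _ vc _] := sol t; rewrite sqrtr_gt0 subr_gt0 ltr_pdivrMr ?exprn_gt0// mul1r.
  by rewrite ltr_pXn2r ?nnegrE ?sqrtr_ge0 ?(ltW c0).
have [k kD] : exists k, k = lorentz c (v 0) by exists (lorentz c (v 0)).
have k0 : 0 < k by rewrite kD.
have kn : k != 0 by rewrite gt_eqF.
have kE : m * c ^+ 2 / k = h + al / r by have := en 0; rewrite /energy mul0r subr0 xr kD => <-; rewrite subrK.
have lorE t : lorentz c (v t) = k.
  have := en t; rewrite /energy mul0r subr0 xr => E.
  have kE' : m * c ^+ 2 / lorentz c (v t) = m * c ^+ 2 / k by rewrite kE -[in RHS]E subrK.
  apply: invr_inj; apply: (@mulfI _ (m * c ^+ 2)) => //.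
  by rewrite mulf_neq0// expf_neq0.
pose w := Num.sqrt (k * al / (m * r ^+ 3)).
have w2 : w ^+ 2 = k * al / (m * r ^+ 3).
  by rewrite sqr_sqrtr// divr_ge0 ?mulr_ge0 ?exprn_ge0// ltW.
have w0 : 0 < w by rewrite sqrtr_gt0 divr_gt0 ?mulr_gt0 ?exprn_gt0.
have wn : w != 0 by rewrite gt_eqF.
have dx i t : der (fun s => x s i 0) t (v t i 0).
  by apply: derive_cV; have [_ D _ _] := sol t; rewrite /v derive1E; exact: derivableP.
have dv i t : der (fun s => v s i 0) t (- w ^+ 2 * x t i 0).
  have [_ _ _ D] := sol t.
  have -> : (fun s => v s i 0) = (fun s => k / m * momentum m c x s i 0).
    apply/funext => s; rewrite /momentum -/(v s) lorE mxE mulrA; field.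
    by rewrite kn.
  apply: der_val (derZ (k / m) (derive_cV i D)) _.
  rewrite scale0r addr0 !mxE xr w2; by field; rewrite mn rn.
have sumder (F : 'I_d -> R -> R) (dF : 'I_d -> R) s : (forall i, der (F i) s (dF i)) ->
    der (fun s => \sum_i F i s) s (\sum_i dF i).
  move=> dFi; rewrite (_ : (fun s => \sum_i F i s) = \sum_i F i); last by apply/funext => ?; rewrite fct_sumE.
  exact: is_derive_sum.
have uniq : forall f (s a a' : R), der f s a -> der f s a' -> a = a'.
  by move=> f s a a' [_ <-] [_ <-].
have xv t : \sum_i x t i 0 * v t i 0 = 0.
  have D := sumder _ _ t (fun i => derM (dx i t) (dx i t)).
  have : der (fun=> r ^+ 2) t 0 by exact: derC.
  rewrite (_ : (fun=> _) = (fun s => \sum_i x s i 0 * x s i 0)); last first.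
    by apply/funext => s; rewrite -(x0n s); apply: eq_bigr.
  move=> /(uniq _ _ _ _ D); rewrite (_ : \sum_i _ = 2 * \sum_i x t i 0 * v t i 0); last first.
    by rewrite big_distrr; apply: eq_bigr => i _ /=; ring.
  by move=> /eqP; rewrite mulf_eq0 pnatr_eq0 => /eqP.
have vv t : \sum_i v t i 0 ^+ 2 = (w * r) ^+ 2.
  have D := sumder _ _ t (fun i => derM (dx i t) (dv i t)).
  have : der (fun=> 0 : R) t 0 by exact: derC.
  rewrite (_ : (fun=> _) = (fun s => \sum_i x s i 0 * v s i 0)); last first.
    by apply/funext => s; rewrite xv.
  move=> /(uniq _ _ _ _ D); rewrite (_ : \sum_i _ = \sum_i v t i 0 ^+ 2 - w ^+ 2 * \sum_i x t i 0 ^+ 2).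
    by rewrite x0n exprMn => /eqP; rewrite subr_eq0 => /eqP.
  by rewrite big_distrr -sumrB; apply: eq_bigr => i _ /=; ring.
have k2 : k ^+ 2 = 1 - (w * r / c) ^+ 2.
  have := lor0 0; rewrite kD /lorentz sqrtr_gt0 => /ltW/sqr_sqrtr ->.
  by rewrite /enorm vv sqrtr_sqr real_normK ?num_real// expr_div_n.
exists w, k, (w^-1 *: v 0); split.
- split=> //; last by rewrite w2; field; rewrite mn rn.
  rewrite k0 -(@ltr_pXn2r _ 2) ?nnegrE ?(ltW k0)// k2 expr1n ltrBlDr ltrDl.
  by rewrite exprn_gt0// divr_gt0// mulr_gt0.
- move=> t; apply/colP => i; rewrite (harmonic_solution wn (dx i) (dv i)) !mxE.
  by rewrite mulrA.
- exact: x0n.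
- rewrite (_ : \sum_i _ = w^-1 ^+ 2 * \sum_i v 0 i 0 ^+ 2).
    by rewrite vv; field.
  by rewrite big_distrr; apply: eq_bigr => i _; rewrite mxE exprMn.
- rewrite (_ : \sum_i _ = w^-1 * \sum_i x 0 i 0 * v 0 i 0); first by rewrite xv mulr0.
  by rewrite big_distrr; apply: eq_bigr => i _; rewrite mxE mulrCA.
Qed.

(** Pairing x(tau) = x(0) with x(0) gives cos(w tau) = 1, and minimality gives w tau <= 2 pi. *)
Lemma circular_period (d : nat) (w r tau : R) (y0 y : 'cV[R]_d) (x : R -> 'cV[R]_d) : 0 < w -> 0 < r ->
  (forall t, x t = cos (w * t) *: y0 + sin (w * t) *: y) ->
  \sum_i y0 i 0 ^+ 2 = r ^+ 2 -> \sum_i y0 i 0 * y i 0 = 0 ->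
  is_minimal_period x tau -> tau = tpi / w.
Proof.
move=> w0 r0 xE n0 n1 [[tau0 per] minp].
have wn : w != 0 by rewrite gt_eqF.
have tp := tpi_gt0 R.
have le1 : tau <= tpi / w.
  apply: minp; split; first by rewrite divr_gt0.
  by move=> t; rewrite !xE mulrDr (mulrC w (_ / w)) divfK// cosD2pi sinD2pi.
have : cos (w * tau) = 1.
  have := per 0; rewrite add0r !xE mulr0 cos0 sin0 scale1r scale0r addr0 => E.
  have : \sum_i (y0 i 0 * (cos (w * tau) *: y0 + sin (w * tau) *: y) i 0) = r ^+ 2.
    by rewrite E -n0; apply: eq_bigr.
  rewrite (_ : \sum_i _ = cos (w * tau) * \sum_i y0 i 0 ^+ 2 + sin (w * tau) * \sum_i y0 i 0 * y i 0).
    rewrite n0 n1 mulr0 addr0 -[RHS]mul1r => /mulIf; apply.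
    by rewrite expf_neq0 ?gt_eqF.
  by rewrite !big_distrr -big_split; apply: eq_bigr => i _; rewrite !mxE /=; ring.
move=> /cos_eq1_tpi E; rewrite -E; first by rewrite mulrC mulKf.
by rewrite mulr_gt0//= mulrC -ler_pdivlMr.
Qed.

(** With angular momentum l = (m / k) w r^2, al / (c l) is the ratio w r / c of the speed to c: the
    radial frequency [bk] is the Lorentz factor k itself, whence 0 < k < 1. *)
Lemma circular_base (m c al h r w k : R) : 0 < m -> 0 < c -> 0 < al -> 0 < r -> 0 < w -> 0 < k < 1 ->
  k ^+ 2 = 1 - (w * r / c) ^+ 2 -> m * c ^+ 2 / k = h + al / r -> w ^+ 2 * m * r ^+ 3 = k * al ->
  exists b : base R, [/\ [/\ bm b = m, bc b = c, bal b = al & bh b = h], bu b = r^-1 & T0 b = w^-1].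
Proof.
move=> m0 c0 al0 r0 w0 k01 k2 kE wE; have /andP[k0 k1] := k01.
have [[mn cn aln] [rn wn kn]] : [/\ m != 0, c != 0 & al != 0] /\ [/\ r != 0, w != 0 & k != 0].
  by rewrite !gt_eqF.
have alE : al = w ^+ 2 * m * r ^+ 3 / k by rewrite wE mulrC mulKf.
pose l := m / k * w * r ^+ 2.
have l0 : 0 < l by rewrite !mulr_gt0 ?invr_gt0 ?exprn_gt0.
have r10 : 0 < r^-1 by rewrite invr_gt0.
have W0 : 0 < h + al * r^-1 by rewrite -kE divr_gt0 ?mulr_gt0 ?exprn_gt0.
have E1 : (l * r^-1) ^+ 2 = (h + al * r^-1) * (h + al * r^-1) / c ^+ 2 - (m * c) ^+ 2.
  rewrite -kE /l.
  have -> : m * c ^+ 2 / k * (m * c ^+ 2 / k) / c ^+ 2 - (m * c) ^+ 2 = m ^+ 2 * c ^+ 2 / k ^+ 2 * (1 - k ^+ 2).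
    by field; rewrite kn cn.
  rewrite [1 - k ^+ 2](_ : _ = (w * r / c) ^+ 2); first by field; rewrite kn cn rn.
  by rewrite k2; ring.
have E2 : al * (h + al * r^-1) = c ^+ 2 * l ^+ 2 * r^-1.
  by rewrite -kE alE /l; field; rewrite kn rn.
have E3 : k ^+ 2 = 1 - (al / (c * l)) ^+ 2.
  rewrite k2 alE /l; congr (1 - _ ^+ 2); field.
  by rewrite kn cn rn wn mn.
exists (Base m0 c0 al0 r10 l0 W0 E1 E2 k01 E3); split=> //.
rewrite /T0 /= -kE /l; field.
by rewrite kn cn rn wn mn.
Qed.

End Circular.

(** * Construction of the solutions *)

Section Frames.
Variables (R : realType) (d : nat).

Lemma enorm_sqr (n : nat) (x : 'cV[R]_n) : enorm x ^+ 2 = \sum_i x i 0 ^+ 2.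
Proof. by rewrite sqr_sqrtr// sumr_ge0// => i _; exact: sqr_ge0. Qed.

Lemma enorm_trmx (n : nat) (x : 'cV[R]_n) : enorm x ^+ 2 = (x^T *m x) 0 0.
Proof. by rewrite enorm_sqr mxE; apply: eq_bigr => i _; rewrite !mxE expr2. Qed.

Lemma enorm_vec3 (y1 y2 y3 : R) : enorm (vec3 y1 y2 y3) ^+ 2 = y1 ^+ 2 + y2 ^+ 2 + y3 ^+ 2.
Proof. by rewrite enorm_sqr !big_ord_recl big_ord0 !mxE /= addr0 addrA. Qed.

Lemma isometry_enorm (A : 'M[R]_(d, 3)) y : A^T *m A = 1%:M -> enorm (A *m y) ^+ 2 = enorm y ^+ 2.
Proof. by move=> AA; rewrite !enorm_trmx trmx_mul mulmxA -(mulmxA y^T) AA mulmx1. Qed.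

Lemma unit_rows_entry (n k : nat) (A : 'M[R]_(n, k)) i j : A *m A^T = 1%:M -> `|A i j| <= 1.
Proof.
move=> /matrixP/(_ i i); rewrite !mxE eqxx mulr1n => E.
rewrite -(@ler_pXn2r _ 2) ?nnegrE// expr1n real_normK ?num_real// -E.
rewrite (bigD1 j)//= mxE -expr2 lerDl sumr_ge0// => l _.
by rewrite mxE -expr2 sqr_ge0.
Qed.

Variable b : base R.
Local Notation rad := (bu b)^-1.
Local Notation tpi := (pi *+ 2 : R).

(* The columns of [A] are orthonormal, or the first two are and motion stays in
   their span. *)
Definition framed (A : 'M[R]_(d, 3)) (o : orbit R) :=
  A *m A^T = 1%:M /\
  (A^T *m A = 1%:M \/
   (forall y1 y2, enorm (A *m vec3 y1 y2 0) ^+ 2 = y1 ^+ 2 + y2 ^+ 2) /\ forall t, oz o t = 0).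

Lemma framed_plane A o y1 y2 : framed A o -> enorm (A *m vec3 y1 y2 0) ^+ 2 = y1 ^+ 2 + y2 ^+ 2.
Proof.
by move=> [_ [AA|[]]] //; rewrite (isometry_enorm _ AA) enorm_vec3 (expr2 0) mulr0 addr0.
Qed.

Lemma framed_admissible A o : framed A o -> admissible b A.
Proof.
move=> fA; split=> [i j|t]; first by apply: unit_rows_entry; case: fA.
have r0 : 0 <= rad by rewrite invr_ge0 ltW ?bu_gt0.
apply: (@pexpIrn _ 2) => //; rewrite ?nnegrE ?sqrtr_ge0//.
by rewrite (framed_plane _ _ fA) !exprMn -mulrDr cos2Dsin2 mulr1.
Qed.

Lemma solution_near (B rho C Tmax eta : R) : 0 <= B -> 0 < rho -> 0 <= C -> 0 <= Tmax -> 0 < eta ->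
  exists2 e0 : R, 0 < e0 & forall A U (eps : R) o, framed A o -> pert b B rho (lift_pert A U) ->
    `|eps| <= e0 -> is_orbit b eps (lift_pert A U) (C * `|eps|) o -> ol1 o = 0 -> ol2 o = 0 ->
  exists (x : R -> 'cV[R]_d) (sigma : R),
    [/\ fixed_energy_solution (bm b) (bc b) (bal b) eps (bh b) U x, is_period x sigma,
      `|sigma - T0 b * tpi| <= eta &
      forall t, 0 <= t <= Tmax ->
        `|x t - A *m vec3 (rad * cos (t / T0 b)) (rad * sin (t / T0 b)) 0| <= 3 * eta].
Proof.
move=> B0 rho0 C0 Tm0 eta0.
have [e0 e00 H] := @closed_motion R b B rho C Tmax eta B0 rho0 C0 Tm0 eta0.
exists e0 => // A U eps o fA pA epse ob l1 l2.
have [x1 [x2 [x3 [q1 [q2 [q3 [r [W [sigma [mo [s0 per] sT pl nr]]]]]]]]]] := H _ _ _ pA epse ob l1 l2.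
have := mo => -[_ _ dx3 _ _ _ _ _ W0 _ _].
have cn : bc b != 0 by rewrite gt_eqF ?bc_gt0.
have norms : (forall t, enorm (A *m vec3 (x1 t) (x2 t) (x3 t)) ^+ 2 = x1 t ^+ 2 + x2 t ^+ 2 + x3 t ^+ 2) /\
    (forall t, enorm (A *m vec3 (q1 t) (q2 t) (q3 t)) ^+ 2 = q1 t ^+ 2 + q2 t ^+ 2 + q3 t ^+ 2).
  have [_ [AA|[nA z0]]] := fA; first by split=> t; rewrite (isometry_enorm _ AA) enorm_vec3.
  have x30 t : x3 t = 0 by have [s [_]] := pl t; exact.
  (* In the plane [A] preserves norms only when the third component vanishes; for the momentum this
     comes from x3' = c^2 q3 / W. *)
  have q30 t : q3 t = 0.
    have := dx3 t; rewrite (_ : x3 = fun=> 0); last by apply/funext.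
    move=> [_ E]; have : (0 : R) = bc b ^+ 2 * q3 t / W t by rewrite -E derive_cst.
    move=> /esym/eqP; rewrite !mulf_eq0 invr_eq0 (negbTE cn) (gt_eqF (W0 t)) orbF.
    by move=> /eqP.
  by split=> t; rewrite ?x30 ?q30 nA (expr2 0) mulr0 addr0.
have [AA _] := fA; have [nx nq] := norms.
exists (fun t => A *m vec3 (x1 t) (x2 t) (x3 t)), sigma; split=> //.
- exact: motion_solution AA mo nx nq.
- by split=> // t; have [-> -> ->] := per t.
- move=> t tT; have [n1 n2 n3] := nr t tT.
  apply: lift_dist => //; last by rewrite subr0.
  by move=> i j; apply: unit_rows_entry.
Qed.

End Frames.

Section ActionContinuity.
Variables (R : realType) (b : base R).
Local Notation tpi := (pi *+ 2 : R).

(** Gives the continuity in the rotation that the existence of a minimum requires. *)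
Lemma action_lipschitz (B rho C : R) : 0 <= B -> 0 < rho -> 0 <= C ->
  exists e1 K : R, [/\ 0 < e1, 0 <= K &
  forall P P' (eps : R) o o' (d : R),
   pert b B rho P -> pert b B rho P' -> `|eps| <= e1 ->
   is_orbit b eps P (C * `|eps|) o -> is_orbit b eps P' (C * `|eps|) o' -> 0 <= d ->
   (forall j t x1 x2 x3, near_circle b t rho x1 x2 x3 ->
      `|P j x1 x2 x3 - P' j x1 x2 x3| <= d) ->
   `|action b eps P o - action b eps P' o'| <= K * d].
Proof.
move=> B0 rho0 C0.
have pl := pos_lip_gt0 b; have tp := tpi_gt0 R.
have [e0 [q0 [e00 e01 q01 Hreg]]] := @orbit_regular R b B rho C B0 rho0 C0.
have [kd [ed [Cd [kd0 ed0 Cd0 Hdiff]]]] := @orbit_diff R b B rho B0 rho0.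
have [L sA'] := sdiff_A b.
have [CA [rA [CA0 rA0 HA]]] := sdiff_lip sA'.
have [es [D [es0 D0 Hsm]]] := @orbit_small R b B rho C rA B0 rho0 C0 rA0.
have C10 : 0 < C + 1 by rewrite ltr_wpDl.
pose K := 2 * Cd + 2 * (B * (pos_lip b * Cd) + 1).
have BpC : 0 <= B * (pos_lip b * Cd) by rewrite !mulr_ge0// ltW.
have K0 : 0 <= K by rewrite /K; lra.
exists (Num.min (Num.min e0 es) (Num.min ed (kd / (C + 1)))), (CA * K * tpi); split.
- by rewrite !lt_min e00 es0 ed0 divr_gt0.
- by rewrite !mulr_ge0// ltW.
move=> P P' eps o o' d Pp Pp'; rewrite !le_min => /andP[/andP[ee0 ees] /andP[eed eek]] ob ob' d0 PP.
have eps0 := normr_ge0 eps; have e_1 := le_trans ee0 e01.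
have Ckd : C * `|eps| <= kd.
  by move: eek; rewrite ler_pdivlMr//; clear -eps0; lra.
have [sk pos _] := Hreg P eps o Pp ee0 ob.
have [sk' pos' _] := Hreg P' eps o' Pp' ee0 ob'.
have skr : small b rho (C * `|eps|) by case: sk => ? ? ?; split=> //; lra.
have ed_ : `|eps| * d <= d by rewrite -[leRHS]mul1r ler_wpM2r.
have obd : obounded (Cd * (`|eps| * d)) (osub o o').
  apply: (Hdiff P P' eps) => //.
  - by split; [exact: ob.1|exact: oboundedW Ckd ob.2].
  - by split; [exact: ob'.1|exact: oboundedW Ckd ob'.2].
have cd1 : Cd * (`|eps| * d) <= Cd * d by rewrite ler_wpM2l.
have cd2 : `|eps| * (B * (pos_lip b * (Cd * (`|eps| * d))) + d) <= B * (pos_lip b * Cd) * d + d.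
  have h : B * (pos_lip b * (Cd * (`|eps| * d))) <= B * (pos_lip b * Cd) * d.
    by rewrite -!mulrA !ler_wpM2l// ltW.
  have h0 : 0 <= B * (pos_lip b * (Cd * (`|eps| * d))) + d.
    by rewrite addr_ge0// !mulr_ge0// ltW.
  by have := ler_wpM2r h0 e_1; rewrite mul1r => /le_trans; apply; rewrite lerD2r.
have BpCd : 0 <= B * (pos_lip b * Cd) * d by exact: mulr_ge0.
have Cdd : 0 <= Cd * d by exact: mulr_ge0.
have bound t : `|sA b (ost b eps P o t) - sA b (ost b eps P' o' t)| <= CA * (K * d).
  have [lo hi] := ost_cmp eps Pp B0 skr ob.2 ob'.2 obd (fun j => PP j t).
  have [_ H] := Hsm _ _ _ Pp ees ob; have [_ H'] := Hsm _ _ _ Pp' ees ob'.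
  have [h1 h2] := H t; have [h1' _] := H' t.
  apply: HA; [exact: ball0W h1|exact: ball0W h1'|].
  move=> i; have [i6|i6] := ltnP i 6; [move: (lo i i6)|move: (hi i i6)] => /le_trans; apply.
    by rewrite /K; clear -cd1 d0 BpCd; lra.
  by rewrite /K; clear -cd2 Cdd; lra.
rewrite /action.
have [A [A0 dA ->]] := integralP (action_continuous Pp B0 rho0 sk ob pos).
have [A' [A'0 dA' ->]] := integralP (action_continuous Pp' B0 rho0 sk' ob' pos').
have := der_bound (ltW tp) (fun t => derB (dA t) (dA' t)) (fun t _ => bound t).
rewrite A0 A'0 !subr0 => /le_trans; apply.
by rewrite le_eqVlt; apply/orP; left; apply/eqP; ring.
Qed.

End ActionContinuity.

Section SpecialOrthogonal.
Variables (R : realType) (n : nat).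

Lemma det_continuous : continuous (fun N : 'M[R]_n => \det N).
Proof.
have cp (f : 'I_n -> 'I_n) : continuous (fun N : 'M[R]_n => \prod_i N i (f i)).
  apply: continuous_big => [|i _]; first exact: mul_continuous.
  exact: coord_continuous.
apply: continuous_big => [|s _]; first exact: add_continuous.
by move=> N; apply: cvgMl_tmp; [exact: nbhs_filter|exact: cp].
Qed.

Lemma so_compact : compact [set N : 'M[R]_n | special_orthogonal N].
Proof.
apply: bounded_closed_compact_mx.
  exists 1; split; first exact: num_real.
  move=> M M1 N [NN _] /=; apply: le_trans (ltW M1).
  apply: mx_norm_le => // i j.
  by have := unit_rows_entry j i (A := N^T); rewrite mxE trmxK; exact.
rewrite (_ : [set N | _] = (\bigcap_(p in [set: ('I_n * 'I_n)%type])
   [set N : 'M[R]_n | (N^T *m N) p.1 p.2 = (1%:M : 'M[R]_n) p.1 p.2]) `&` [set N | \det N = 1]); last first.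
  apply/seteqP; split=> [N [NN N1]|N [NN N1]]; split=> //.
    by move=> p _ /=; rewrite NN.
  by apply/matrixP => i j; exact: (NN (i, j)).
apply: closedI; last first.
  have C : closed ((fun N : 'M[R]_n => \det N) @^-1` [set x : R | x = 1]).
    move/continuous_closedP: det_continuous; apply; exact: closed_eq.
  exact: C.
apply: closed_bigI => -[i j] _ /=.
have cf : continuous (fun N : 'M[R]_n => (N^T *m N) i j).
  rewrite (_ : (fun N => _) = fun N : 'M[R]_n => \sum_k N k i * N k j); last first.
    by apply/funext => N; rewrite mxE; apply: eq_bigr => k _; rewrite mxE.
  apply: continuous_big => [|k _ N]; first exact: add_continuous.
  by apply: cvgM; [exact: nbhs_filter|exact: coord_continuous|exact: coord_continuous].
have C : closed ((fun N : 'M[R]_n => (N^T *m N) i j) @^-1` [set x : R | x = (1%:M : 'M[R]_n) i j]).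
  move/continuous_closedP: cf; apply; exact: closed_eq.
exact: C.
Qed.

Lemma special_orthogonalM (N K : 'M[R]_n) :
  special_orthogonal N -> special_orthogonal K -> special_orthogonal (N *m K).
Proof.
move=> [NN N1] [KK K1]; split; last by rewrite det_mulmx N1 K1 mulr1.
by rewrite trmx_mul mulmxA -(mulmxA K^T) NN mulmx1.
Qed.

Lemma special_orthogonalT (N : 'M[R]_n) : special_orthogonal N -> special_orthogonal N^T.
Proof. by move=> [/mulmx1C NN N1]; split; rewrite ?trmxK ?det_tr. Qed.

End SpecialOrthogonal.

Section Rotations.
Variable R : realType.

Definition mx3 (m11 m12 m13 m21 m22 m23 m31 m32 m33 : R) : 'M[R]_3 :=
  \matrix_(i, j) nth 0 (nth [::] [:: [:: m11; m12; m13]; [:: m21; m22; m23]; [:: m31; m32; m33]] i) j.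

Lemma mul_mx3_vec3 m11 m12 m13 m21 m22 m23 m31 m32 m33 (y1 y2 y3 : R) :
  mx3 m11 m12 m13 m21 m22 m23 m31 m32 m33 *m vec3 y1 y2 y3 =
  vec3 (m11 * y1 + m12 * y2 + m13 * y3) (m21 * y1 + m22 * y2 + m23 * y3)
    (m31 * y1 + m32 * y2 + m33 * y3).
Proof. by apply/colP => -[[|[|[|i]]] Hi] //; rewrite mul_vec3 !mxE. Qed.

Lemma det_mx3 m11 m12 m13 m21 m22 m23 m31 m32 m33 :
  \det (mx3 m11 m12 m13 m21 m22 m23 m31 m32 m33) =
  m11 * (m22 * m33 - m23 * m32) - m12 * (m21 * m33 - m23 * m31) + m13 * (m21 * m32 - m22 * m31).
Proof.
rewrite (expand_det_row _ 0) !big_ord_recl big_ord0 /cofactor.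
do 3 rewrite (expand_det_row _ 0) !big_ord_recl big_ord0 /cofactor !det_mx11.
by rewrite !mxE /=; ring.
Qed.

Lemma mx3_orthogonal m11 m12 m13 m21 m22 m23 m31 m32 m33 :
  m11 ^+ 2 + m21 ^+ 2 + m31 ^+ 2 = 1 -> m12 ^+ 2 + m22 ^+ 2 + m32 ^+ 2 = 1 ->
  m13 ^+ 2 + m23 ^+ 2 + m33 ^+ 2 = 1 -> m11 * m12 + m21 * m22 + m31 * m32 = 0 ->
  m11 * m13 + m21 * m23 + m31 * m33 = 0 -> m12 * m13 + m22 * m23 + m32 * m33 = 0 ->
  let K := mx3 m11 m12 m13 m21 m22 m23 m31 m32 m33 in K^T *m K = 1%:M.
Proof.
move=> h11 h22 h33 h12 h13 h23 K; apply/matrixP => i j.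
rewrite !mxE !big_ord_recl big_ord0 !mxE /=.
case: i => -[|[|[|i]]] Hi //; case: j => -[|[|[|j]]] Hj //; rewrite /= ?mulr1n ?mulr0n;
  [rewrite -[RHS]h11|rewrite -[RHS]h12|rewrite -[RHS]h13|rewrite -[RHS]h12|rewrite -[RHS]h22|
   rewrite -[RHS]h23|rewrite -[RHS]h13|rewrite -[RHS]h23|rewrite -[RHS]h33]; ring.
Qed.

End Rotations.

(** * The rotation of least action, where the multipliers vanish *)

Section CriticalRotation.
Variable R : realType.

(** A small f with the sign opposite to that of a would make the right-hand side negative if |a|
    exceeded be. *)
Lemma first_order_test (a be C f0 : R) : 0 < f0 -> 0 <= C ->
  (forall f : R, `|f| <= f0 -> 0 <= f * a + be * `|f| + C * f ^+ 2) -> `|a| <= be.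
Proof.
move=> f00 C0 H; rewrite leNgt; apply/negP => ab.
have g0 : 0 < `|a| - be by rewrite subr_gt0.
have C1 : 0 < C + 1 by rewrite ltr_wpDl.
pose f := Num.min f0 ((`|a| - be) / (2 * (C + 1))).
have f_0 : 0 < f by rewrite lt_min f00 divr_gt0// mulr_gt0.
have fC : f * (2 * (C + 1)) <= `|a| - be by rewrite -ler_pdivlMr ?mulr_gt0// ge_min lexx orbT.
have := H (- Num.sg a * f); rewrite normrM normrN normr_sg (gtr0_norm f_0).
have -> : - Num.sg a * f * a = - (f * `|a|) by rewrite [in RHS]normrEsg; ring.
have le1 : (a != 0)%:R * f <= f by case: (a != 0); rewrite ?mul1r// mul0r ltW.
have -> : (- Num.sg a * f) ^+ 2 = (a != 0)%:R * f ^+ 2 by rewrite exprMn sqrrN sqr_sg.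
(* The sign of 0 is 0 and would make the test value vanish, so this case is excluded with [f]
   itself. *)
have an : a != 0.
  apply/eqP => a0; rewrite a0 normr0 in ab g0; have := H f0.
  rewrite a0 mulr0 add0r gtr0_norm// => /(_ (lexx _)).
  have := H f; rewrite a0 mulr0 add0r gtr0_norm// ge_min lexx => /(_ isT).
  rewrite a0 normr0 in fC => h _.
  have : f * (be + C * f) < 0; last by rewrite ltNge mulrDr mulrCA (mulrC f be) -expr2 h.
  by rewrite pmulr_rlt0//; clear -fC f_0 C0 ab; nra.
rewrite an !mul1r ge_min lexx => /(_ isT) h.
have : f * (`|a| - be - C * f) <= 0 by clear -h; lra.
by rewrite pmulr_rle0//; clear -fC f_0 g0; lra.
Qed.

Lemma small_angle (f : R) : `|f| <= 1 ->
  [/\ `|cos f - 1| <= f ^+ 2, `|sin f - f| <= f ^+ 2, `|sin f| <= `|f| & `|cos f - 1| <= `|f|].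
Proof.
move=> f1; have fsq : f ^+ 2 = `|f| * `|f| by rewrite -expr2 real_normK ?num_real.
have sl x : `|sin x| <= `|x| :> R by have [_] := cos_lip x 0; rewrite sin0 !subr0.
have cl x : `|cos x - 1| <= `|x| :> R by have [+ _] := cos_lip x 0; rewrite cos0 !subr0.
suff [h1 h2] : `|cos f - 1| <= f ^+ 2 /\ `|sin f - f| <= f ^+ 2 by split.
have pos (x : R) : 0 <= x -> `|cos x - 1| <= x * x /\ `|sin x - x| <= x * x.
  move=> x0; split.
    have := @der_bound R cos (fun y => - sin y) 0 x x x0 (@dcos R).
    rewrite cos0 subr0; apply=> y /andP[y0 yx]; rewrite normrN (le_trans (sl y))//.
    by rewrite ger0_norm.
  have := @der_bound R (fun y => sin y - y) (fun y => cos y - 1) 0 x x x0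
    (fun y => derB (@dsin R y) (der_id y)).
  rewrite sin0 !subr0; apply=> y /andP[y0 yx]; rewrite (le_trans (cl y))//.
  by rewrite ger0_norm.
rewrite fsq; have [f0|f0] := leP 0 f; first by rewrite (ger0_norm f0); exact: pos.
have [] := pos (- f); first by rewrite oppr_ge0 ltW.
rewrite cosN sinN (ltr0_norm f0) => h1 h2; split=> //.
by rewrite -normrN opprB addrC; rewrite opprK in h2.
Qed.

Variables (b : base R) (U : 'cV[R]_3 -> R) (rho B : R).
Local Notation rad := (bu b)^-1.
Hypotheses (B0 : 0 <= B) (rho0 : 0 < rho) (rhor : rho <= rad) (rU : regular U rad rho B).
Local Notation B' := ((3 * 3%:R + 9) * B).

Lemma so_framed (N : 'M[R]_3) o : special_orthogonal N -> framed N o.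
Proof. by move=> [NN _]; split; [exact: mulmx1C|left]. Qed.

(* The action of the orbits in the rotated potentials U(N x), as a function of the
   rotation N, has a minimum; there its derivatives, which are the multipliers up
   to higher order terms, vanish. *)
Lemma critical_rotation : exists e1 C : R, [/\ 0 < e1, 0 <= C & forall eps : R, `|eps| <= e1 ->
  exists N o, [/\ special_orthogonal N, is_orbit b eps (lift_pert N U) (C * `|eps|) o,
    ol1 o = 0 & ol2 o = 0]].
Proof.
have B'0 : 0 <= B' by rewrite mulr_ge0.
have rho'0 : 0 < rho / 6 by rewrite divr_gt0.
have rad0 : 0 < rad by rewrite invr_gt0 bu_gt0.
have [e0 [C [e00 C0 Hex]]] := @orbit_exists R b B' (rho / 6) B'0 rho'0.
have [e2 [K [e20 K0 Hlip]]] := @action_lipschitz R b B' (rho / 6) C B'0 rho'0 C0.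
pose L := (3%:R + 1) * (B * (1 + 6 * rad)).
have L0 : 0 <= L by rewrite !mulr_ge0// addr_ge0// mulr_ge0// ltW.
have D0 : 0 <= L * 3 by rewrite mulr_ge0.
have [e3 [f1 [C1 [C2 [e30 f10 C10 C20 Hvar]]]]] := @action_variation R b B' (rho / 6) C (L * 3) B'0 rho'0 C0 D0.
have pp : 0 < rad ^+ 2 * pi by rewrite mulr_gt0 ?pi_gt0 ?exprn_gt0.
have C11 : 0 < 2 * C1 + 1 by rewrite ltr_wpDl// mulr_ge0.
(* Below this value of eps the two tests give pi rad^2 (|l1| + |l2|) at most half of itself. *)
pose e4 := rad ^+ 2 * pi / 2 / (2 * C1 + 1).
have e40 : 0 < e4 by rewrite !divr_gt0.
exists (Num.min (Num.min e0 e2) (Num.min e3 e4)), C; split=> //; first by rewrite !lt_min e00 e20 e30.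
move=> eps; rewrite !le_min => /andP[/andP[ee0 ee2] /andP[ee3 ee4]].
have pN N : special_orthogonal N -> pert b B' (rho / 6) (lift_pert N U).
  by move=> sN; apply: lift_pert_ok => //; exact: framed_admissible (so_framed (Orbit 0 0 0 0 0 0) sN).
have aN N : special_orthogonal N -> admissible b N.
  by move=> sN; exact: framed_admissible (so_framed (Orbit 0 0 0 0 0 0) sN).
have ex N : exists o, special_orthogonal N -> is_orbit b eps (lift_pert N U) (C * `|eps|) o.
  have [sN|nN] := pselect (special_orthogonal N); last by exists (Orbit 0 0 0 0 0 0).
  by have [oo oon _] := Hex _ _ (pN _ sN) ee0; exists oo.
have [oN Ho] := choice ex.
pose Phi N := action b eps (lift_pert N U) (oN N).
have PhiL N N' (e : R) : special_orthogonal N -> special_orthogonal N' -> 0 <= e -> e <= 1 ->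
    6 * rad * e <= rho / 2 -> (forall i j, `|N i j - N' i j| <= e) -> `|Phi N - Phi N'| <= K * (L * e).
  move=> sN sN' e_0 e_1 er NN; apply: Hlip => //; try exact: pN; try exact: Ho.
    exact: mulr_ge0.
  exact: (lift_pert_diff B0 rho0 rhor rU (aN _ sN) (aN _ sN')).
have [] := @compact_EVT_min _ R Phi [set N | special_orthogonal N].
- by exists 1%:M => /=; split; [rewrite mulmx1 tr_scalar_mx|exact: det1].
- exact: so_compact.
- apply/subspace_continuousP => N /= sN; apply/cvgrPdist_le => e e_0.
  have KL : 0 < K * L + 1 by rewrite ltr_wpDl// mulr_ge0.
  pose del := Num.min (Num.min 1 (rho / 2 / (6 * rad))) (e / (K * L + 1)).
  have del0 : 0 < del by rewrite !lt_min ltr01 !divr_gt0 ?mulr_gt0 ?bu_gt0.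
  rewrite near_withinE; apply/nbhs_ballP; exists del => //= N'.
  rewrite -ball_normE /= => /ltW NN' sN'.
  have [d1 d2] : del <= 1 /\ 6 * rad * del <= rho / 2.
    by rewrite mulrC -ler_pdivlMr ?mulr_gt0// !ge_min !lexx ?orbT.
  have := PhiL _ _ _ sN sN' (ltW del0) d1 d2 => /(_ _)/le_trans; apply.
    by move=> i j; have := mx_entry_le (N - N') i j; rewrite !mxE => /le_trans; apply.
  have : del * (K * L + 1) <= e by rewrite -ler_pdivlMr// ge_min lexx orbT.
  by clear -del0; lra.
move=> N; rewrite inE /= => sN minN.
exists N, (oN N).
(* The minimum at [N] is compared with [N *m T], where T is a rotation of small angle f; the
   matrices N and N T differ by at most 3 |f| in each entry. *)
have var (f k1 k2 : R) m11 m12 m13 m21 m22 m23 m31 m32 m33 :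
    let T := mx3 m11 m12 m13 m21 m22 m23 m31 m32 m33 in
    special_orthogonal T -> (forall i j, `|(1%:M - T) i j| <= `|f|) ->
    near_rotation f k1 k2 m11 m12 m13 m21 m22 m23 m31 m32 m33 ->
    `|f| <= f1 -> `|f| <= 1 / 3 -> 6 * rad * (3 * `|f|) <= rho / 2 ->
    0 <= f * (rad ^+ 2 * pi * (k2 * ol1 (oN N) - k1 * ol2 (oN N))) +
      C1 * (`|eps| * (`|ol1 (oN N)| + `|ol2 (oN N)|)) * `|f| + C2 * f ^+ 2.
  move=> T sT Tf nr ff1 f13 fr.
  have sNT := special_orthogonalM sN sT.
  have NT i j : `|(N *m T) i j - N i j| <= 3 * `|f|.
    rewrite distrC (_ : _ - _ = (N *m (1%:M - T)) i j); last by rewrite mulmxBr mulmx1 !mxE.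
    rewrite mxE (le_trans (ler_norm_sum _ _ _))//.
    rewrite (_ : 3 * `|f| = \sum_(k < 3) `|f|); last by rewrite sumr_const card_ord mulr_natl.
    apply: ler_sum => k _; rewrite -[leRHS]mul1r; apply: bprod => //; exact: (aN _ sN).1.
  have f0 := normr_ge0 f; have f3 : 0 <= 3 * `|f| by rewrite mulr_ge0.
  have f31 : 3 * `|f| <= 1 by rewrite mulrC -ler_pdivlMr.
  have minNT : 0 <= Phi (N *m T) - Phi N by rewrite subr_ge0; apply: minN; rewrite inE.
  apply: le_trans minNT _.
  apply: le_trans (Hvar (lift_pert N U) (lift_pert (N *m T) U) eps (oN N) (oN (N *m T)) f k1 k2
    _ _ _ _ _ _ _ _ _ (pN _ sN) (pN _ sNT) ee3 (Ho _ sN) (Ho _ sNT) ff1 nr _ _) _.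
  - by move=> y1 y2 y3; rewrite /lift_pert -mulmxA mul_mx3_vec3.
  - move=> j t x1 x2 x3 nx; rewrite -(mulrA L 3).
    exact: (lift_pert_diff B0 rho0 rhor rU (aN _ sNT) (aN _ sN) f3 f31 fr NT _ nx).
  - by rewrite le_eqVlt; apply/orP; left; apply/eqP; ring.
have [l1 l1E] : exists l, l = ol1 (oN N) by exists (ol1 (oN N)).
have [l2 l2E] : exists l, l = ol2 (oN N) by exists (ol2 (oN N)).
rewrite -l1E -l2E in var; pose be := C1 * (`|eps| * (`|l1| + `|l2|)).
pose f0 := Num.min (Num.min f1 (1 / 3)) (rho / 2 / (6 * rad * 3)).
have f00 : 0 < f0 by rewrite !lt_min f10 !divr_gt0 ?mulr_gt0 ?invr_gt0 ?bu_gt0.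
have fP (f : R) : `|f| <= f0 -> [/\ `|f| <= f1, `|f| <= 1 / 3 & 6 * rad * (3 * `|f|) <= rho / 2].
  rewrite !le_min => /andP[/andP[-> ->] h]; split=> //.
  by rewrite mulrA mulrC -ler_pdivlMr ?mulr_gt0.
(* Rotations about the second axis test [l1]; those about the first axis, below, test [l2]. *)
have b2 : `|rad ^+ 2 * pi * l1| <= be.
  apply: (@first_order_test _ _ C2 f0 f00 C20) => f /fP[h1 h2 h3].
  have f1' : `|f| <= 1 by apply: le_trans h2 _; lra.
  have [c1 s1 s2 c2] := small_angle f1'.
  have /(canRL (addrK _)) e := cos2Dsin2 f.
  rewrite (_ : _ * l1 = rad ^+ 2 * pi * (1 * l1 - 0 * l2)); last by rewrite mul1r mul0r subr0.
  apply: (var f 0 1 (cos f) 0 (sin f) 0 1 0 (- sin f) 0 (cos f)) => //.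
  - split; last by rewrite det_mx3; ring: e.
    by apply: mx3_orthogonal; ring: e.
  - move=> i j; rewrite !mxE.
    by case: i => -[|[|[|i]]] Hi //; case: j => -[|[|[|j]]] Hj //=;
      rewrite ?mulr1n ?mulr0n ?subrr ?sub0r ?normr0 ?oppr0 ?normrN ?opprK ?normr0// distrC.
  - split.
    + by rewrite normr0 normr1.
    + by rewrite normr0 mulr1 sqr_ge0.
    + by rewrite mulr0 subrr addr0 normr0 sqr_ge0.
    + by rewrite mulr1 mulr0 subr0 normr0 sqr_ge0 addrC distrC.
    + by move=> y1 y2 y3; ring: e.
have b1 : `|rad ^+ 2 * pi * - l2| <= be.
  apply: (@first_order_test _ _ C2 f0 f00 C20) => f /fP[h1 h2 h3].
  have f1' : `|f| <= 1 by apply: le_trans h2 _; lra.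
  have [c1 s1 s2 c2] := small_angle f1'.
  have /(canRL (addrK _)) e := cos2Dsin2 f.
  rewrite (_ : _ * - l2 = rad ^+ 2 * pi * (0 * l1 - 1 * l2)); last by rewrite mul1r mul0r sub0r.
  apply: (var f 1 0 1 0 0 0 (cos f) (- sin f) 0 (sin f) (cos f)) => //.
  - split; last by rewrite det_mx3; ring: e.
    by apply: mx3_orthogonal; ring: e.
  - move=> i j; rewrite !mxE.
    by case: i => -[|[|[|i]]] Hi //; case: j => -[|[|[|j]]] Hj //=;
      rewrite ?mulr1n ?mulr0n ?subrr ?sub0r ?normr0 ?oppr0 ?normrN ?opprK ?normr0// distrC.
  - split.
    + by rewrite normr0 normr1.
    + by rewrite mulr0 !subrr normr0 sqr_ge0.
    + by rewrite mulr1 normr0 sqr_ge0 c1 -[`|- _ + _|]normrN opprD opprK s1.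
    + by rewrite mulr0 addr0 mulr1 normr0 sqr_ge0.
    + by move=> y1 y2 y3; ring: e.
have sum0 : `|l1| + `|l2| <= 0.
  rewrite normrM (gtr0_norm pp) normrN in b1; rewrite normrM (gtr0_norm pp) in b2.
  have : `|eps| * (2 * C1 + 1) <= rad ^+ 2 * pi / 2 by rewrite -ler_pdivlMr.
  have s0 : 0 <= `|l1| + `|l2| by rewrite addr_ge0.
  move=> /(ler_wpM2r s0) h; have es : 0 <= `|eps| * (`|l1| + `|l2|) by rewrite mulr_ge0.
  rewrite -(pmulr_rle0 _ pp); move: b1 b2 h es; rewrite /be; clear -R b B rho U B0 rho0 rhor rU; lra.
have [n1 n2] := (normr_ge0 l1, normr_ge0 l2).
split; [exact: sN|exact: Ho| |].
  by rewrite -l1E; apply/eqP; rewrite -normr_le0; rewrite (le_trans _ sum0)// lerDl.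
by rewrite -l2E; apply/eqP; rewrite -normr_le0; rewrite (le_trans _ sum0)// lerDr.
Qed.

End CriticalRotation.

Section PeriodicSolutions.
Variables (R : realType) (b : base R).
Local Notation rad := (bu b)^-1.
Local Notation tpi := (pi *+ 2 : R).

Definition follows_circle (d : nat) (A : 'M[R]_(d, 3)) (Tmax eta : R) (x : R -> 'cV[R]_d) (sigma : R) :=
  `|sigma - T0 b * tpi| <= eta /\ forall t, 0 <= t <= Tmax ->
    `|x t - A *m vec3 (rad * cos (t / T0 b)) (rad * sin (t / T0 b)) 0| <= 3 * eta.

(** A zero third column makes the third partial derivative of the lifted potential vanish, so
    [orbit_exists] returns a flat orbit with zero multipliers. *)
Lemma planar_solution (d : nat) (U : 'cV[R]_d -> R) (A : 'M[R]_(d, 3)) (Tmax eta : R) :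
  (0 < d <= 4)%N -> smooth_on [set x | x != 0] U -> 0 <= Tmax -> 0 < eta ->
  A *m A^T = 1%:M -> (forall i, A i 2 = 0) ->
  (forall y1 y2, enorm (A *m vec3 y1 y2 0) ^+ 2 = y1 ^+ 2 + y2 ^+ 2) ->
  exists2 e0 : R, 0 < e0 & forall eps : R, `|eps| <= e0 -> exists (x : R -> 'cV[R]_d) (sigma : R),
    [/\ fixed_energy_solution (bm b) (bc b) (bal b) eps (bh b) U x, is_period x sigma &
      follows_circle A Tmax eta x sigma].
Proof.
move=> d4 sU Tm0 eta0 AA A2 An.
have rad0 : 0 < rad by rewrite invr_gt0 bu_gt0.
have [B B0 rU] := smooth_regular d4 rad0 sU.
have rho0 : 0 < rad / 8 by rewrite divr_gt0.
have [B' [B'0 HB]] : exists B', 0 <= B' /\ pert b B' (rad / 8 / 6) (lift_pert A U).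
  exists ((3 * d%:R + 9) * B); split; first by rewrite mulr_ge0// addr_ge0// mulr_ge0.
  apply: lift_pert_ok => //; apply: (@framed_admissible _ _ _ _ (Orbit 0 0 0 0 0 0)).
  by split=> //; right.
have rho'0 : 0 < rad / 8 / 6 by rewrite divr_gt0.
have [e1 [C [e10 C0 Hex]]] := orbit_exists b B'0 rho'0.
have [e2 e20 Hs] := @solution_near R d b B' (rad / 8 / 6) C Tmax eta B'0 rho'0 C0 Tm0 eta0.
exists (Num.min e1 e2); first by rewrite lt_min e10.
move=> eps; rewrite le_min => /andP[h1 h2].
have [oo ob] := Hex _ _ HB h1; case.
  move=> x1 x2 x3; rewrite /lift_pert /= big1// => i _.
  by rewrite (_ : inord 2 = 2) ?A2 ?mul0r//; apply/val_inj; rewrite /= inordK.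
move=> z0 _ l1 l2.
have fA : framed A oo by split=> //; right.
have [x [sigma [h3 h4 h5 h6]]] := Hs _ _ _ _ fA HB h2 ob l1 l2.
by exists x, sigma; split.
Qed.

Lemma spatial_solution (U : 'cV[R]_3 -> R) (Tmax eta : R) :
  smooth_on [set x | x != 0] U -> 0 <= Tmax -> 0 < eta ->
  exists2 e0 : R, 0 < e0 & forall eps : R, `|eps| <= e0 ->
  exists (x : R -> 'cV[R]_3) (sigma : R) (N : 'M[R]_3),
    [/\ fixed_energy_solution (bm b) (bc b) (bal b) eps (bh b) U x, is_period x sigma,
      special_orthogonal N & follows_circle N Tmax eta x sigma].
Proof.
move=> sU Tm0 eta0.
have rad0 : 0 < rad by rewrite invr_gt0 bu_gt0.
have [B B0 rU] := smooth_regular (isT : (0 < 3 <= 4)%N) rad0 sU.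
have rho0 : 0 < rad / 8 by rewrite divr_gt0.
have rhor : rad / 8 <= rad by rewrite ler_pdivrMr// ler_peMr ?(ltW rad0)// ler1n.
have [e1 [C [e10 C0 Hc]]] := critical_rotation B0 rho0 rhor rU.
pose B' := (3 * 3%:R + 9) * B.
have B'0 : 0 <= B' by rewrite mulr_ge0.
have rho'0 : 0 < rad / 8 / 6 by rewrite divr_gt0.
have [e2 e20 Hs] := @solution_near R 3 b B' (rad / 8 / 6) C Tmax eta B'0 rho'0 C0 Tm0 eta0.
exists (Num.min e1 e2); first by rewrite lt_min e10.
move=> eps; rewrite le_min => /andP[h1 h2].
have [N [oo [sN ob l1 l2]]] := Hc _ h1.
have fN := so_framed oo sN.
have pN : pert b B' (rad / 8 / 6) (lift_pert N U).
  by apply: lift_pert_ok => //; exact: framed_admissible fN.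
have [x [sigma [h3 h4 h5 h6]]] := Hs _ _ _ _ fN pN h2 ob l1 l2.
by exists x, sigma, N; split.
Qed.

End PeriodicSolutions.

Section InitialFrame.
Variable R : realType.

Definition frame (d : nat) (r : R) (y0 y z : 'cV[R]_d) : 'M[R]_(d, 3) :=
  \matrix_(i, j) (nth 0 [:: y0 i 0; y i 0; z i 0] j / r).

Lemma frame_vec3 d r (y0 y z : 'cV[R]_d) (a1 a2 : R) : r != 0 ->
  frame r y0 y z *m vec3 (r * a1) (r * a2) 0 = a1 *: y0 + a2 *: y.
Proof. by move=> r0; apply/colP => i; rewrite mul_vec3 !mxE /=; field. Qed.

Lemma frame_planar (r : R) (y0 y : 'cV[R]_2) : r != 0 ->
  \sum_i y0 i 0 ^+ 2 = r ^+ 2 -> \sum_i y i 0 ^+ 2 = r ^+ 2 -> \sum_i y0 i 0 * y i 0 = 0 ->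
  let A := frame r y0 y 0 in [/\ A *m A^T = 1%:M, forall i, A i 2 = 0 &
    forall a1 a2, enorm (A *m vec3 a1 a2 0) ^+ 2 = a1 ^+ 2 + a2 ^+ 2].
Proof.
move=> r0; rewrite !big_ord_recl !big_ord0 !addr0 => n0 n1 n01 A; split.
(* A square matrix is needed to pass from M^T M = 1 to M M^T = 1; the zero third column adds nothing
   to A A^T. *)
- pose M : 'M[R]_2 := \matrix_(i, j) A i (widen_ord (leqnSn 2) j).
  have MM : M^T *m M = 1%:M.
    apply/matrixP => i j; rewrite !mxE !big_ord_recl big_ord0 !mxE /= addr0.
    by case: i => -[|[|i]] Hi //; case: j => -[|[|j]] Hj //=; rewrite ?mulr1n ?mulr0n;
      rewrite mulf_div (mulf_div _ r) -mulrDl -?expr2 ?n0 ?n1 ?(mulrC (y _ _)) ?n01 ?mul0r ?divff ?expf_neq0.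
  have {}MM := mulmx1C MM; rewrite -MM; apply/matrixP => i j.
  rewrite !mxE !big_ord_recl !big_ord0 !mxE /= mul0r mul0r addr0.
  by rewrite !addr0.
- by move=> i; rewrite !mxE /= mul0r.
- move=> a1 a2; rewrite -[a1](mulVKf r0) -[a2](mulVKf r0) frame_vec3// enorm_sqr.
  rewrite !big_ord_recl big_ord0 !mxE addr0; set x1 := y0 _ _ in n0 n01 *.
  move: n0 n1 n01; set x2 := y0 _ _; set x3 := y _ _; set x4 := y _ _ => n0 n1 n01.
  rewrite [LHS](_ : _ = (r^-1 * a1) ^+ 2 * (x1 ^+ 2 + x2 ^+ 2) + (r^-1 * a2) ^+ 2 * (x3 ^+ 2 + x4 ^+ 2)
    + 2 * (r^-1 * a1) * (r^-1 * a2) * (x1 * x3 + x2 * x4)); last by ring.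
  by rewrite n0 n1 n01; ring.
Qed.

Lemma frame_spatial (r : R) (y0 y : 'cV[R]_3) : r != 0 ->
  \sum_i y0 i 0 ^+ 2 = r ^+ 2 -> \sum_i y i 0 ^+ 2 = r ^+ 2 -> \sum_i y0 i 0 * y i 0 = 0 ->
  exists z, special_orthogonal (frame r y0 y z).
Proof.
move=> r0; rewrite !big_ord_recl !big_ord0 !addr0 !addrA.
set a1 := y0 _ _; set a2 := y0 _ _; set a3 := y0 _ _.
set b1 := y _ _; set b2 := y _ _; set b3 := y _ _ => n0 n1 n01.
(* The cross product over r has length r like the other two vectors, by Lagrange's identity. *)
have [z1 z1E] : exists z, z = (a2 * b3 - a3 * b2) / r by eexists.
have [z2 z2E] : exists z, z = (a3 * b1 - a1 * b3) / r by eexists.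
have [z3 z3E] : exists z, z = (a1 * b2 - a2 * b1) / r by eexists.
exists (vec3 z1 z2 z3).
rewrite (_ : frame _ _ _ _ = mx3 (a1 / r) (b1 / r) (z1 / r) (a2 / r) (b2 / r) (z2 / r)
   (a3 / r) (b3 / r) (z3 / r)).
  have zE : z1 * a1 + z2 * a2 + z3 * a3 = 0 by rewrite z1E z2E z3E; field.
  have zE' : z1 * b1 + z2 * b2 + z3 * b3 = 0 by rewrite z1E z2E z3E; field.
  have zn : z1 ^+ 2 + z2 ^+ 2 + z3 ^+ 2 = r ^+ 2.
    rewrite [LHS](_ : _ = ((a1 ^+ 2 + a2 ^+ 2 + a3 ^+ 2) * (b1 ^+ 2 + b2 ^+ 2 + b3 ^+ 2)
      - (a1 * b1 + a2 * b2 + a3 * b3) ^+ 2) / r ^+ 2); last by rewrite z1E z2E z3E; field.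
    by rewrite n0 n1 n01; field.
  have r2 : r ^+ 2 != 0 by rewrite expf_neq0.
  split.
    apply: mx3_orthogonal; rewrite ?expr_div_n ?mulf_div -!mulrDl -?expr2 ?n0 ?n1 ?zn ?n01 ?divff ?mul0r//.
      by rewrite (mulrC a1) (mulrC a2) (mulrC a3) zE mul0r.
    by rewrite (mulrC b1) (mulrC b2) (mulrC b3) zE' mul0r.
  rewrite det_mx3 [LHS](_ : _ = (z1 ^+ 2 + z2 ^+ 2 + z3 ^+ 2) / r ^+ 2); last by rewrite z1E z2E z3E; field.
  by rewrite zn divff.
apply/matrixP => i j; rewrite !mxE.
by case: i => -[|[|[|i]]] Hi //; case: j => -[|[|[|j]]] Hj //=; congr (_ _ _ / r); apply/val_inj.
Qed.

End InitialFrame.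

Lemma enorm_lt (R : realType) (d : nat) (z : 'cV[R]_d) (eta : R) : (d <= 3)%N -> 0 < eta ->
  `|z| <= 3 * (eta / 6) -> enorm z < eta.
Proof.
move=> d3 eta0 zn; have [_ e2] := enorm_bounds z.
rewrite -(@ltr_pXn2r _ 2) ?nnegrE ?sqrtr_ge0 ?(ltW eta0)//; apply: le_lt_trans e2 _.
have h : `|z| ^+ 2 <= (eta / 2) ^+ 2 by rewrite lerXn2r ?nnegrE//; lra.
have h3 : d%:R * `|z| ^+ 2 <= 3 * `|z| ^+ 2 by rewrite ler_wpM2r ?sqr_ge0// ler_nat.
have := exprn_gt0 2 eta0; rewrite expr_div_n in h.
by lra.
Qed.

Theorem theorem1p2 (R : realType) (d : nat) (hd : d = 2%N \/ d = 3%N)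
    (m c alpha : R) (hm : 0 < m) (hc : 0 < c) (halpha : 0 < alpha)
    (U : 'cV[R]_d -> R) (hU : smooth_on [set x : 'cV[R]_d | x != 0] U)
    (h : R) (hh0 : 0 < h) (hh1 : h < m * c ^+ 2)
    (tau : R) (x_tau : R -> 'cV[R]_d)
    (hsol : fixed_energy_solution m c alpha 0 h U x_tau)
    (hcirc : circular x_tau)
    (htau : is_minimal_period x_tau tau) :
  forall eta : R, 0 < eta ->
  exists2 eps_star : R, 0 < eps_star &
  forall eps : R, - eps_star < eps -> eps < eps_star ->
    (d = 2%N ->
       exists (x : R -> 'cV[R]_d) (sigma : R),
         [/\ fixed_energy_solution m c alpha eps h U x,
             is_period x sigma,
             `|sigma - tau| < eta &
             forall t : R, 0 <= t <= tau + eta ->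
               enorm (x t - x_tau t) < eta]) /\
    (d = 3%N ->
       exists (x : R -> 'cV[R]_d) (sigma : R) (M : 'M[R]_d),
         [/\ fixed_energy_solution m c alpha eps h U x,
             is_period x sigma,
             special_orthogonal M,
             `|sigma - tau| < eta &
             forall t : R, 0 <= t <= tau + eta ->
               enorm (x t - M *m x_tau t) < eta]).
Proof.
move=> eta eta0; have [r r0 xr] := hcirc.
have rn : r != 0 by rewrite gt_eqF.
have [w [k [y [[w0 k01 k2 kE wE] xE n0 n1 n01]]]] := circular_solution hm hc halpha r0 hsol xr.
have tauE := circular_period w0 r0 xE n0 n01 htau.
have [b [[bmE bcE balE bhE] buE TE]] := circular_base hm hc halpha r0 w0 k01 k2 kE wE.
have Tm0 : 0 <= tau + eta by rewrite addr_ge0// ltW//; have [[]] := htau.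
(* Each coordinate is then within 3 eta / 6 = eta / 2, and the Euclidean norm in dimension at most 3
   is at most sqrt(3) / 2 times eta. *)
have eta'0 : 0 < eta / 6 by rewrite divr_gt0.
have ltin (s : R) : `|s| <= eta / 6 -> `|s| < eta by move=> /le_lt_trans; apply; lra.
have close_le (e0 eps : R) : - e0 < eps -> eps < e0 -> `|eps| <= e0.
  by move=> h1 h2; rewrite ler_norml !ltW.
have tpiE : T0 b * (pi *+ 2) = tau by rewrite tauE TE mulrC.
have angE t : t / T0 b = w * t by rewrite TE invrK mulrC.
have [dE|dE] := hd; subst d.
- have [AA A2 An] := frame_planar rn n0 n1 n01.
  have [e0 e00 H] := planar_solution b (isT : (0 < 2 <= 4)%N) hU Tm0 eta'0 AA A2 An.
  exists e0 => // eps h1 h2; split=> // _.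
  have [x [sigma [h3 h4 [h5 h6]]]] := H eps (close_le _ _ h1 h2).
  rewrite bmE bcE balE bhE in h3; rewrite tpiE in h5.
  exists x, sigma; split=> //; first exact: ltin.
  move=> t tT; apply: enorm_lt => //.
  by have := h6 t tT; rewrite buE invrK angE (frame_vec3 _ _ _ _ _ rn) -xE.
- have [z sM] := frame_spatial rn n0 n1 n01.
  have [e0 e00 H] := spatial_solution b hU Tm0 eta'0.
  exists e0 => // eps h1 h2; split=> // _.
  have [x [sigma [N [h3 h4 sN [h5 h6]]]]] := H eps (close_le _ _ h1 h2).
  rewrite bmE bcE balE bhE in h3; rewrite tpiE in h5.
  (* [x_tau] is the image under the frame of the standard circle, which [N] carries to the circle
     followed by [x]. *)
  exists x, sigma, (N *m (frame r (x_tau 0) y z)^T); split=> //.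
  + exact: special_orthogonalM sN (special_orthogonalT sM).
  + exact: ltin.
  + move=> t tT; apply: enorm_lt => //.
    rewrite (xE t) -(frame_vec3 (x_tau 0) y z _ _ rn) mulmxA -(mulmxA N) sM.1 mulmx1.
    by have := h6 t tT; rewrite buE invrK angE.
Qed.
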